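(* Let $a>0$, let $\Lambda=\lambda^+\otimes\nu$ be a translation invariant, locally finite measure on the set of affine hyperplanes of $E=\mathbb{R}^d$ with $\mathrm{span}(\mathrm{supp}(\nu))=E$, and let $P_a$ be the law of the STIT tessellation with parameters $a$ and $\Lambda$ (viewed as the random closed set of cell boundaries). Then for all Borel sets $A,B\subset\mathbb{R}^d$, $$P_a(\mathcal{F}^{A}\cap\mathcal{F}^{T_hB})\longrightarrow P_a(\mathcal{F}^{A})\,P_a(\mathcal{F}^{B})\qquad\text{as } \|h\|\to\infty,\ h\in\mathbb{R}^d .$$
   Context: Notation. $E=\mathbb{R}^d$; $\mathcal{F}$ is the class of closed subsets of $E$ with the Fell topology (generated by the sets $\{F\in\mathcal F: F\cap K=\emptyset\}$, $K$ compact, and $\{F\in\mathcal F: F\cap O\neq\emptyset\}$, $O$ open) and its Borel $\sigma$-algebra. For $A\subset E$ Borel, $\mathcal{F}^A=\{C\in\mathcal{F}: C\cap A=\emptyset\}$. Since $\mathcal F^A$ is universally measurable for Borel $A$, probabilities of such events are understood with respect to the completion of $P_a$. $T_hB=\{x+h: x\in B\}$. Hyperplane measure. $\mathcal{H}$ is the set of affine hyperplanes of $E$ (with the Borel $\sigma$-algebra of the Fell topology); $[A]$ is the set of $\gamma\in\mathcal{H}$ with $\gamma\cap A\neq\emptyset$. $\Lambda$ is a translation invariant locally finite measure on $\mathcal{H}$ (locally finite: $\Lambda([K])<\infty$ for compact $K$). Identifying $(r,u)\in\mathbb{R}^+\times\mathcal{S}^{d-1}$ with the hyperplane at distance $r$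 from the origin with normal vector $u$ pointing to the side not containing $0$, one has $\Lambda=\lambda^+\otimes\nu$, where $\lambda^+$ is Lebesgue measure on $\mathbb{R}^+=[0,\infty)$ and $\nu$ is a finite measure on the unit sphere $\mathcal{S}^{d-1}$; it is assumed that $\mathrm{span}(\mathrm{supp}(\nu))=E$. For a hyperplane $\gamma$ not containing $0$, $\gamma^+$ is the closed half-space bounded by $\gamma$ not containing $0$ and $\gamma^-$ is the other closed half-space. STIT tessellation. Let $W$ be a compact set with non-empty interior (window). Let $(\epsilon_k)_{k\ge1}$ be i.i.d. exponential variables with parameter $\Lambda([W])$ and, independently, let $(\gamma_k)_{k\ge1}$ be i.i.d. random hyperplanes with law $\Lambda([W]\cap\,\cdot\,)/\Lambda([W])$. Put $C_1=W$, $b_1=0$, and recursively $d_k=b_k+\epsilon_k$, $b_k=d_{\lfloor k/2\rfloor}$ for $k\ge2$, $C_{2k}=C_k\cap\gamma_k^-$, $C_{2k+1}=C_k\cap\gamma_k^+$. Define $Y_{a,W}=\bigcup_{k:\,b_k\le a}\partial C_k$. It is known (Nagel–Weiss consistency) that for compact $W\subset W'$ with non-empty interiors $Y_{a,W}\stackrel{(d)}{=}(Y_{a,W'}\cap W)\cup\partial W$; hence for compact $K$ the number $T_a(K)=\mathbb{P}(Y_{a,W}\cap K\neq\emptyset)$ is the same for every $W$ with $K\subset\mathrm{int}(W)$. The STIT tessellation $Y_a$ with parameters $a,\Lambda$ is the random closed set of $\mathbb{R}^d$ with capacity functional $K\mapsto\mathbb{P}(Y_a\cap K\neq\emptyset)=T_a(K)$,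 $K$ compact; its law is $P_a$.
   Formalization: In the construction of the STIT tessellation the windows W are taken to be connected as well as compact with non-empty interior, because for disconnected W the number T_a(K) depends on W; the law P_a and the theorem's range are unchanged. *)

(* Defs.v *)
(* The ambient space E = R^d is 'rV[R]_n.+1, so d = n.+1
   ranges over all dimensions d >= 1. *)
From HB Require Import structures.
From Corelib Require Import PosDef.
From mathcomp Require Import all_boot all_order all_algebra.
From mathcomp Require Import all_classical all_reals all_analysis.

Set Implicit Arguments.
Unset Strict Implicit.
Unset Printing Implicit Defensive.

Import Order.TTheory GRing.Theory Num.Theory.
Import numFieldTopology.Exports numFieldNormedType.Exports.

Local Open Scope classical_set_scope.
Local Open Scope ring_scope.

Notation borel T := (g_sigma_algebraType (@open T)).

Definition frontier {T : topologicalType} (A : set T) : set T :=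
  closure A `\` A°.

Record closed_set (T : topologicalType) : Type := ClosedSet {
  carrier :> set T;
  carrier_closed : closed carrier }.

HB.instance Definition _ (T : topologicalType) :=
  gen_eqMixin (closed_set T).
HB.instance Definition _ (T : topologicalType) :=
  gen_choiceMixin (closed_set T).
HB.instance Definition _ (T : topologicalType) :=
  isPointed.Build (closed_set T) (ClosedSet (@closed0 T)).

Definition avoid {T : topologicalType} (A : set T) : set (closed_set T) :=
  [set F : closed_set T | F `&` A = set0].

Definition hit {T : topologicalType} (A : set T) : set (closed_set T) :=
  [set F : closed_set T | F `&` A !=set0].

Definition fell_subbase (T : topologicalType) : set (set (closed_set T)) :=
  [set avoid K | K in @compact T] `|` [set hit O | O in @open T].

HB.instance Definition _ (T : topologicalType) :=
  @isSubBaseTopological.Build (closed_set T) (set (closed_set T))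
    (@fell_subbase T) id.

Definition independent_systems {d} {T : measurableType d} {R : realType}
    (P : probability T R) {I : Type} (G : I -> set (set T)) :=
  forall (m : nat) (i : 'I_m -> I), injective i ->
  forall A : 'I_m -> set T, (forall j, G (i j) (A j)) ->
  P (\bigcap_(j in [set: 'I_m]) A j) = (\prod_(j < m) P (A j))%E.

Definition generated_sigma {d d'} {T : measurableType d} {T' : measurableType d'}
    (X : T -> T') : set (set T) :=
  preimage_set_system [set: T] X measurable.

Definition generated_sigma_family {d d'} {T : measurableType d}
    {T' : measurableType d'} {I : Type} (X : I -> T -> T') : set (set T) :=
  <<s \bigcup_(i in [set: I]) generated_sigma (X i) >>.

(** The completion of P: the outer measure induced by P, which on the
    P-completion of the sigma-algebra is the completed measure. *)
Definition completion {d} {T : measurableType d} {R : realType}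
    (P : probability T R) : set T -> \bar R :=
  @completed_measure_extension _ _ _ P.

Definition dot {R : realType} {n : nat} (x y : 'rV[R]_n) : R :=
  \sum_(i < n) x 0 i * y 0 i.

Definition enorm {R : realType} {n : nat} (x : 'rV[R]_n) : R :=
  Num.sqrt (dot x x).

Definition enorm_infty {R : realType} {n : nat} : set_system 'rV[R]_n :=
  filter_from [set: R] (fun M => [set h | M < enorm h]).

Definition translate {R : realType} {n : nat} (h : 'rV[R]_n) (B : set 'rV[R]_n)
  : set 'rV[R]_n := [set x + h | x in B].

Definition linear_span {R : realType} {n : nat} (S : set 'rV[R]_n) :
    set 'rV[R]_n :=
  [set x | exists2 s : seq 'rV[R]_n,
     (forall v, v \in s -> S v) & x \in span s].

Record sphere (R : realType) (n : nat) : Type := Sphere {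
  direction :> 'rV[R]_n.+1;
  direction_unit : enorm direction = 1 }.

Lemma enorm_delta (R : realType) n : enorm (delta_mx 0 0 : 'rV[R]_n.+1) = 1.
Proof.
rewrite /enorm /dot (bigD1 ord0)//= big1 ?addr0; last first.
  by move=> i i0; rewrite !mxE (negbTE i0) andbF mul0r.
by rewrite !mxE !eqxx mulr1 sqrtr1.
Qed.

HB.instance Definition _ R n := gen_eqMixin (sphere R n).
HB.instance Definition _ R n := gen_choiceMixin (sphere R n).
HB.instance Definition _ R n :=
  isPointed.Build (sphere R n) (Sphere (enorm_delta R n)).
HB.instance Definition _ R n := Topological.copy (sphere R n)
  (initial_topology (@direction R n)).

Definition measure_support {T : ptopologicalType} {R : realType}
    (nu : set (borel T) -> \bar R) : set T :=
  [set u | forall U : set T, open U -> U u -> (0 < nu U)%E].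

Definition is_hyperplane {R : realType} {n : nat} (F : set 'rV[R]_n.+1) : Prop :=
  exists (u : 'rV[R]_n.+1) (c : R), u != 0 /\ F = [set x | dot x u = c].

Record hyperplane (R : realType) (n : nat) : Type := Hyperplane {
  hyperplane_set :> closed_set 'rV[R]_n.+1;
  hyperplaneP : is_hyperplane hyperplane_set }.

Section hyperplane_of.
Context {R : realType} {n : nat}.

Lemma closed_dot_eq (u : 'rV[R]_n.+1) (c : R) : closed [set x | dot x u = c].
Proof.
apply: (@preimage_closed _ _ (fun x => dot x u) [set c]); last exact: closed_eq.
move=> x _; rewrite /dot; elim: (index_enum _) => [|i r IH].
  by under eq_fun do rewrite big_nil; exact: cst_continuous.
under eq_fun do rewrite big_cons.
have cx : (fun y : 'rV[R]_n.+1 => y 0 i) y @[y --> x] --> x 0 i.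
  exact: coord_continuous.
exact: cvgD (cvgMr_tmp cx) IH.
Qed.

Lemma sphere_neq0 (u : sphere R n) : (u : 'rV[R]_n.+1) != 0.
Proof.
apply: contra_eq_neq (direction_unit u) => ->.
rewrite /enorm /dot big1 ?sqrtr0 1?eq_sym ?oner_neq0// => i _.
by rewrite mxE mul0r.
Qed.

(** For r >= 0: the hyperplane at distance r from 0 with unit normal u, pointing
    (when r > 0) to the side not containing 0. *)
Definition hyperplane_of (ru : R * sphere R n) : hyperplane R n :=
  @Hyperplane R n (ClosedSet (@closed_dot_eq ru.2 ru.1))
    (ex_intro _ _ (ex_intro _ _ (conj (sphere_neq0 ru.2) erefl))).

End hyperplane_of.

HB.instance Definition _ R n := gen_eqMixin (hyperplane R n).
HB.instance Definition _ R n := gen_choiceMixin (hyperplane R n).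
HB.instance Definition _ R n :=
  isPointed.Build (hyperplane R n) (hyperplane_of (0, point)).
HB.instance Definition _ R n := Topological.copy (hyperplane R n)
  (initial_topology (@hyperplane_set R n)).

Section hyperplane_measure.
Context {R : realType} {n : nat}.
Implicit Types (g : hyperplane R n) (Lambda : set (borel (hyperplane R n)) -> \bar R).

Definition hitting (A : set 'rV[R]_n.+1) : set (hyperplane R n) :=
  [set g : hyperplane R n | g `&` A !=set0].

(** [far_side g] and [near_side g] are the closed half-spaces bounded by g that
    do not, resp. do, contain 0.  They are meant for 0 \notin g; both are empty
    when g passes through 0, and the latter hyperplanes are Lambda-negligible. *)
Definition far_side g : set 'rV[R]_n.+1 :=
  [set x | exists r (u : sphere R n),
     [/\ 0 < r, g = hyperplane_of (r, u) & r <= dot x u]].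

Definition near_side g : set 'rV[R]_n.+1 :=
  [set x | exists r (u : sphere R n),
     [/\ 0 < r, g = hyperplane_of (r, u) & dot x u <= r]].

Definition translate_hyperplanes (h : 'rV[R]_n.+1) (A : set (hyperplane R n)) :
    set (hyperplane R n) :=
  [set g : hyperplane R n | exists2 g0 : hyperplane R n,
     A g0 & carrier g = translate h g0].

Definition translation_invariant Lambda :=
  forall (h : 'rV[R]_n.+1) (A : set (borel (hyperplane R n))), measurable A ->
  Lambda (translate_hyperplanes h A) = Lambda A.

Definition locally_finite Lambda :=
  forall K : set 'rV[R]_n.+1, compact K -> (Lambda (hitting K) < +oo)%E.

Definition lebesgue_plus : set R -> \bar R :=
  mrestr lebesgue_measure (measurable_itv `[(0 : R), +oo[).

Definition polar_decomposition Lambda (nu : set (borel (sphere R n)) -> \bar R) :=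
  forall A : set (borel (hyperplane R n)), measurable A ->
  Lambda A = (lebesgue_plus \x nu)%E (hyperplane_of @^-1` A).

End hyperplane_measure.

(** The indices k >= 1 are encoded by [positive]: xH is 1, xO k is 2k and
    xI k is 2k+1, so the index floor(k/2) is obtained by removing the outermost
    constructor. *)
Section cells.
Context {R : realType} {n : nat} (W : set 'rV[R]_n.+1).
Variables (e : positive -> R) (g : positive -> hyperplane R n).

Fixpoint birth (k : positive) : R :=
  match k with
  | xH => 0
  | xO j => birth j + e j
  | xI j => birth j + e j
  end.

Fixpoint cell (k : positive) : set 'rV[R]_n.+1 :=
  match k with
  | xH => W
  | xO j => cell j `&` near_side (g j)
  | xI j => cell j `&` far_side (g j)
  end.

Definition cell_boundaries (a : R) : set 'rV[R]_n.+1 :=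
  \bigcup_(k in [set k | birth k <= a]) frontier (cell k).

End cells.

(** Connectedness of W is needed for the consistency of the construction between
    windows: if a hyperplane could separate W without meeting it, the two parts
    of W would be subdivided independently in a larger window, but not in W. *)
Definition window {R : realType} {n : nat} (W : set 'rV[R]_n.+1) : Prop :=
  [/\ compact W, connected W & W° !=set0].

Section stit.
Context {R : realType} {n : nat}.
Variables (Lambda : set (borel (hyperplane R n)) -> \bar R).

Record stit_variables (W : set 'rV[R]_n.+1) d (Omega : measurableType d)
    (Q : probability Omega R)
    (eps : positive -> {mfun Omega >-> R})
    (gam : positive -> {mfun Omega >-> borel (hyperplane R n)}) : Prop := {
  eps_law : forall k (A : set R), measurable A ->
    pushforward Q (eps k) A = exponential_prob (fine (Lambda (hitting W))) A;
  gam_law : forall k (A : set (borel (hyperplane R n))), measurable A ->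
    pushforward Q (gam k) A =
    (Lambda (hitting W `&` A) * ((fine (Lambda (hitting W)))^-1)%:E)%E;
  eps_indep : independent_systems Q (fun k => generated_sigma (eps k));
  gam_indep : independent_systems Q (fun k => generated_sigma (gam k));
  eps_gam_indep : forall A B : set Omega,
    generated_sigma_family eps A -> generated_sigma_family gam B ->
    Q (A `&` B) = (Q A * Q B)%E }.

(** P is the law of a random closed set whose capacity functional is the one of
    the construction in any window W with K in its interior; such a P is unique
    by Choquet's theorem. *)
Definition stit_law (a : R) (P : probability (borel (closed_set 'rV[R]_n.+1)) R) :=
  forall W : set 'rV[R]_n.+1, window W ->
  exists d (Omega : measurableType d) (Q : probability Omega R)
    (eps : positive -> {mfun Omega >-> R})
    (gam : positive -> {mfun Omega >-> borel (hyperplane R n)}),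
    stit_variables W Q eps gam /\
    forall K : set 'rV[R]_n.+1, compact K -> K `<=` W° ->
    P (hit K) =
    Q [set w | cell_boundaries W (eps^~ w) (gam^~ w) a `&` K !=set0].

End stit.

(* Main.v *)
(** Compact sets first.  If K lies in a box around 0 and T_h L in a congruent box
    around h, then conditioning on the first division of a large window shows that
    the avoidance probabilities satisfy a recursion: after an exponential time a
    random hyperplane either meets the set, or splits it into two parts that are
    treated by independent copies of the process.  A hyperplane missing both boxes
    either leaves them on the same side, or separates them, after which K and
    T_h L evolve independently.  The Lambda-measure of the hyperplanes meeting a
    box does not depend on h, whereas the measure of those separating the boxes
    tends to infinity, since the support of nu spans E.  Following
    the recursion along small time steps gives
      |P (F^K & F^(T_h L)) - P F^K * P F^L| <= 6 Lambda(meeting) / Lambda(separating).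

    A Borel set is the projection of a closed subset of E * N^N.  As in Choquet's
    capacitability theorem, the events of hitting it are approximated from inside,
    in the completion of P, by those of hitting its compact subsets, uniformly in
    the translation h. *)
Require Import Defs.
From HB Require Import structures.
From Corelib Require Import PosDef.
From mathcomp Require Import all_boot all_order all_algebra.
From mathcomp Require Import finmap ring lra.
From mathcomp Require Import all_classical all_reals all_analysis.
From mathcomp Require Import measurable_realfun.

Set Implicit Arguments.
Unset Strict Implicit.
Unset Printing Implicit Defensive.

Import Order.TTheory GRing.Theory Num.Theory.
Import numFieldTopology.Exports numFieldNormedType.Exports.

Local Open Scope classical_set_scope.
Local Open Scope ring_scope.

(** * Souslin sets and capacitability *)

Module Import SouslinTopology.
Import ArrowAsProduct.

Definition souslin (T : topologicalType) (A : set T) :=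
  exists2 D : set (T * (nat -> nat)), closed D & A = fst @` D.

Lemma reindex_continuous (f : nat -> nat) :
  continuous (fun s : nat -> nat => s \o f : nat -> nat).
Proof.
move=> s; apply/cvg_sup => i; apply/cvg_image.
  by apply/seteqP; split => // k _; exists (fun=> k).
move=> A nA; exists [set t : nat -> nat | A (t i)].
  exact: (@proj_continuous nat (fun=> nat) (f i) s _ nA).
apply/seteqP; split => [_ [t /= At <-]//|k Ak]; by exists (fun=> k).
Qed.

Definition reindex_snd (T : Type) (f : nat -> nat) (p : T * (nat -> nat)) :
  T * (nat -> nat) := (p.1, p.2 \o f).

Lemma reindex_snd_continuous (T : topologicalType) (f : nat -> nat) :
  continuous (@reindex_snd T f).
Proof.
move=> [x s] A [[B C] /= [nB nC] BCA].
exists (B, [set t : nat -> nat | C (t \o f)]) => /=.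
  by split => //; exact: (@reindex_continuous f s _ nC).
by move=> [y t] /= [By Ct]; apply: BCA.
Qed.

Section souslin_sets.
Context (T : topologicalType).
Implicit Types A : set T.

Lemma souslin_closed A : closed A -> souslin A.
Proof.
move=> cA; exists (fst @^-1` A).
  by apply: preimage_closed => // x _; exact: cvg_fst.
apply/seteqP; split => [x Ax|x [[y s] /= Ay <-]//].
by exists (x, fun=> 0%N).
Qed.

Lemma souslin_bigcup (A : nat -> set T) :
  (forall i, souslin (A i)) -> souslin (\bigcup_i A i).
Proof.
move=> /(_ _)/cid2-/all_sig2[D cD AD].
exists [set p : T * (nat -> nat) | D (p.2 0%N) (p.1, p.2 \o S)]; last first.
  apply/seteqP; split => [x [i _]|x [[y s]/= Dys <-]].
    rewrite AD => -[[y s]/= Dys <-]; exists (y, fun k => if k is k'.+1 then s k' else i) => //=.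
  by exists (s 0%N) => //; rewrite AD; exists (y, s \o S).
rewrite -openC openE => -[x s] /= Dxs.
have cshift := @reindex_snd_continuous T S (x, s).
have n1 : nbhs (x, s) [set p : T * (nat -> nat) | ~ D (s 0%N) (p.1, p.2 \o S)].
  apply: (cshift (~` D (s 0%N))); apply: open_nbhs_nbhs; split => //.
  exact: closed_openC.
have n2 : nbhs (x, s) [set p : T * (nat -> nat) | p.2 0%N = s 0%N].
  have : (fun p : T * (nat -> nat) => p.2 0%N) @ (x, s) --> s 0%N.
    apply: (@cvg_comp _ _ _ snd (fun t : nat -> nat => t 0%N)); first exact: cvg_snd.
    exact: (@proj_continuous nat (fun=> nat) 0%N s).
  by move=> /(_ [set s 0%N]); apply.
by apply: filterS2 n1 n2 => -[y t] /= Dyt ->.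
Qed.

Lemma souslin_bigcap (A : nat -> set T) :
  (forall i, souslin (A i)) -> souslin (\bigcap_i A i).
Proof.
move=> /(_ _)/cid2-/all_sig2[D cD AD].
exists (\bigcap_i [set p : T * (nat -> nat) | D i (p.1, p.2 \o (fun m => choice.pickle (i, m)))]); last first.
  apply/seteqP; split => [x Ax|x [[y s] Dys <-] i _]; last first.
    by rewrite AD; exists (y, s \o (fun m => choice.pickle (i, m))) => //; exact: Dys.
  have /choice[s Ds] : forall i, exists s, D i (x, s).
    by move=> i; move: (Ax i I); rewrite AD => -[[y s] /= ? <-]; exists s.
  exists (x, fun k => if @choice.unpickle (nat * nat)%type k is Some im then s im.1 im.2 else 0%N) => //=.
  move=> i _ /=.
  rewrite (_ : _ \o _ = s i) //.
  by apply/funext => m /=; rewrite choice.pickleK.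
apply: closed_bigI => i _.
apply: (@preimage_closed _ _
  (reindex_snd (fun m => choice.pickle (i, m)))) => // p _.
exact: reindex_snd_continuous.
Qed.

End souslin_sets.

Lemma souslin_borel (T : topologicalType) (A : set T) :
  (forall O : set T, open O -> souslin O) -> <<s open >> A -> souslin A.
Proof.
move=> osous mA.
suff : [set B : set T | souslin B /\ souslin (~` B)] A by case.
apply: (@smallest_sub _ (sigma_algebra setT) open _ _ _ _ mA).
  split=> /=.
  - rewrite setC0; split; apply: souslin_closed; [exact: closed0|exact: closedT].
  - by move=> B [sB sCB]; rewrite setTD setCK.
  - move=> B sB; split; first by apply: souslin_bigcup => i; have [] := sB i.
    by rewrite setC_bigcup; apply: souslin_bigcap => i; have [] := sB i.
move=> O oO; split; first exact: osous.
by apply: souslin_closed; exact: open_closedC.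
Qed.

Lemma souslin_open (R : realType) (n : nat) (O : set 'rV[R]_n.+1) :
  open O -> souslin O.
Proof.
move=> oO.
rewrite (_ : O = \bigcup_k [set x | ball x k.+1%:R^-1 `<=` O]).
  apply: souslin_bigcup => k; apply: souslin_closed.
  rewrite -openC openE => x /= /existsNP[y /not_implyP[xy nOy]].
  rewrite /interior; have : nbhs x (ball y k.+1%:R^-1).
    by apply: open_nbhs_nbhs; split; [exact: ball_open | exact: ball_sym].
  by apply: filterS => z yz /(_ _ (ball_sym yz)).
apply/seteqP; split => [x Ox|x [k _]]; last by apply; exact: ballxx.
have /nbhs_ballP[e /= e0 eO] : nbhs x O by exact: open_nbhs_nbhs.
have [k ke] := @ltr_add_invr R 0 e e0.
exists k => // y xy; apply: eO; apply: le_ball xy.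
by move: ke; rewrite add0r => /ltW.
Qed.

End SouslinTopology.

Section outer_probability.
Context d (T : measurableType d) (R : realType) (P : probability T R).
Local Open Scope ereal_scope.

Lemma le_completion (X Y : set T) :
  X `<=` Y -> completion P X <= completion P Y.
Proof. exact: le_mu_ext. Qed.

Lemma completionE (X : set T) : measurable X -> completion P X = P X.
Proof. exact: measurable_mu_extE. Qed.

Lemma completion_ge0 (X : set T) : 0 <= completion P X.
Proof. exact: mu_ext_ge0. Qed.

Lemma completion_le1 (X : set T) : completion P X <= 1.
Proof.
rewrite -(probability_setT P) -completionE//; exact: le_completion.
Qed.

Lemma completion_fin_num (X : set T) : completion P X \is a fin_num.
Proof.
rewrite ge0_fin_numE ?completion_ge0//.
by rewrite (le_lt_trans (completion_le1 X))// ltry.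
Qed.

Lemma completionU (X Y : set T) :
  completion P (X `|` Y) <= completion P X + completion P Y.
Proof. exact: (outer_measureU2 (completion P)). Qed.

Lemma completion_split (X Y : set T) : measurable Y ->
  completion P X = completion P (X `&` Y) + completion P (X `\` Y).
Proof.
move=> mY; have := @caratheodory_measurable_mu_ext _ _ _ P _ mY X.
by rewrite setDE.
Qed.

Lemma completion_hull (X : set T) (e : R) : (0 < e)%R ->
  exists2 Y, measurable Y /\ X `<=` Y & P Y <= completion P X + e%:E.
Proof.
move=> e0; have /(lb_ereal_inf_adherent e0) := completion_fin_num X.
move=> [_ [F [mF XF] <-] lt].
exists (\bigcup_i F i); first by split => //; exact: bigcup_measurable.
apply: le_trans (ltW lt).
apply: measure_sigma_subadditive => //; exact: bigcup_measurable.
Qed.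

Lemma completion_bigcup_gt (X : (set T)^nat) (c : R) :
  {homo X : i j / (i <= j)%N >-> (i <= j)%O} ->
  c%:E < completion P (\bigcup_i X i) -> exists i, c%:E < completion P (X i).
Proof.
move=> ndX; apply: contraPP => /forallNP Xc; apply/negP; rewrite -leNgt.
apply/lee_addgt0Pr => e e0.
have /(_ _)/cid2-/all_sig2[H mH PH] := fun i => completion_hull (X i) e0.
pose G i := \bigcap_(j in [set j | (i <= j)%N]) H j.
have mG i : measurable (G i) by apply: bigcap_measurable => [|j _]; [by exists i => /=|exact: (mH j).1].
have XG i : X i `<=` G i.
  by move=> x Xx j /= ij; apply: (mH j).2; have /subsetPset := ndX _ _ ij; exact.
have PG i : P (G i) <= c%:E + e%:E.
  rewrite (le_trans (_ : _ <= P (H i)))//.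
    by apply: le_measure; rewrite ?inE//; [exact: (mH i).1|move=> x; apply => /=].
  rewrite (le_trans (PH i))// leeD2r// leNgt; exact/negP.
have mUG : measurable (\bigcup_i G i) by exact: bigcup_measurable.
apply: (@le_trans _ _ (P (\bigcup_i G i))).
  rewrite -completionE//; apply: le_completion.
  by move=> x [i _ Xx]; exists i => //; exact: XG.
have ndG : {homo G : i j / (i <= j)%N >-> (i <= j)%O}.
  move=> i j ij; apply/subsetPset => x Gx k /= jk; apply: Gx => /=.
  exact: leq_trans jk.
have cG := @nondecreasing_cvg_mu _ _ _ P G mG mUG ndG.
rewrite -(cvg_lim _ cG)//; apply: lime_le; first by apply/cvg_ex; eexists; exact: cG.
exact: nearW.
Qed.

End outer_probability.

Section fell.
Context (T : topologicalType).

Lemma hitE (A : set T) : hit A = ~` avoid A.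
Proof. by apply/seteqP; split=> F; rewrite /hit /avoid/=; [move/set0P/eqP|move/eqP/set0P]. Qed.

Lemma avoidE (A : set T) : avoid A = ~` hit A.
Proof. by rewrite hitE setCK. Qed.

Lemma fell_subbase_open (U : set (closed_set T)) : fell_subbase U -> open U.
Proof.
move=> fU; exists [set U]; last by rewrite bigcup_set1.
move=> _ ->; exists [fset U]%fset.
  by move=> V /fset1P ->; exact: mem_set.
apply/seteqP; split=> [F|F UF V /fset1P ->//]; apply.
exact/fset1P.
Qed.

Lemma measurable_avoid (K : set T) : compact K ->
  measurable (avoid K : set (borel (closed_set T))).
Proof.
move=> cK; apply: sub_sigma_algebra.
by apply: fell_subbase_open; left; exists K.
Qed.

Lemma measurable_hit (K : set T) : compact K ->
  measurable (hit K : set (borel (closed_set T))).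
Proof. by move=> cK; rewrite hitE; apply: measurableC; exact: measurable_avoid. Qed.

Lemma hitS (A B : set T) : A `<=` B -> hit A `<=` hit B.
Proof. by move=> AB F [x [Fx /AB Bx]]; exists x. Qed.

Lemma hit_bigcup (A : nat -> set T) : hit (\bigcup_i A i) = \bigcup_i hit (A i).
Proof.
apply/seteqP; split => [F [x [Fx [i _ Ax]]]|F [i _ [x [Fx Ax]]]].
  by exists i => //; exists x.
by exists x; split => //; exists i.
Qed.

End fell.

Section compact_boxes.
Context (R : realType) (n : nat).
Implicit Types x : 'rV[R]_n.+1.

Definition box x (r : R) := [set y : 'rV[R]_n.+1 | `|y - x| <= r].

Lemma box_closed x r : closed (box x r).
Proof.
rewrite -openC openE => y /= /negP; rewrite -ltNge => ryx.
apply/nbhs_ballP; exists (`|y - x| - r) => /=; first by rewrite subr_gt0.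
move=> z; rewrite -ball_normE /= => yz; apply/negP; rewrite -ltNge.
have : `|y - x| <= `|y - z| + `|z - x|.
  by rewrite (le_trans _ (ler_normD _ _))// addrA subrK.
lra.
Qed.

Lemma box_compact x r : compact (box x r).
Proof.
apply: bounded_closed_compact; last exact: box_closed.
exists (r + `|x|); split; first exact: num_real.
move=> M ltM y /= yx; apply: le_trans (ltW ltM).
by rewrite -(subrK x y); apply: le_trans (ler_normD _ _) _; rewrite lerD2r.
Qed.

End compact_boxes.

Section translate.
Import ArrowAsProduct.
Context (R : realType) (n : nat).
Implicit Types (h : 'rV[R]_n.+1) (A : set 'rV[R]_n.+1).

Lemma translateE h A : translate h A = [set x | A (x - h)].
Proof.
apply/seteqP; split=> [_ [x Ax <-]|x Axh] /=; first by rewrite addrK.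
by exists (x - h) => //; rewrite subrK.
Qed.

Lemma translateK h A : translate (- h) (translate h A) = A.
Proof. by rewrite !translateE; apply/seteqP; split=> x /=; rewrite opprK addrK. Qed.

Lemma translateNK h A : translate h (translate (- h) A) = A.
Proof. by rewrite -{1}(opprK h) translateK. Qed.

Lemma translateS h A (B : set 'rV[R]_n.+1) :
  A `<=` B -> translate h A `<=` translate h B.
Proof. by rewrite !translateE => AB x; exact: AB. Qed.

Lemma add_continuous h : continuous (fun x : 'rV[R]_n.+1 => x + h).
Proof.
move=> x V /nbhs_ballP[e /= e0 eV]; apply/nbhs_ballP; exists e => // y.
rewrite -ball_normE /= => xy; apply: eV; rewrite -ball_normE /=.
by rewrite opprD addrACA subrr addr0.
Qed.

Lemma translate_compact h A : compact A -> compact (translate h A).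
Proof.
move=> cA; apply: continuous_compact => //.
by apply: continuous_subspaceT; exact: add_continuous.
Qed.

Lemma translate_closed h A : closed A -> closed (translate h A).
Proof.
move=> cA; rewrite translateE.
apply: (@preimage_closed _ _ (fun x : 'rV[R]_n.+1 => x + - h) A) => // x _.
exact: add_continuous.
Qed.

Lemma souslin_translate h A : souslin A -> souslin (translate h A).
Proof.
move=> [D cD ->]; exists [set p | D (p.1 - h, p.2)]; last first.
  rewrite translateE; apply/seteqP; split=> [x [[y s] Dys /= yx]|x [[y s] /= Dys <-]].
    by exists (x, s) => //=; rewrite -yx.
  by exists (y - h, s).
apply: (@preimage_closed _ _ (fun p : 'rV[R]_n.+1 * (nat -> nat) => (p.1 - h, p.2)) D) => //.
move=> [x s] _ V [[U W] /= [nU nW] UWV].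
exists ([set y | U (y - h)], W) => /=; last by move=> [y t] [/= ? ?]; exact: UWV.
split => //; exact: (@add_continuous (- h) x _ nU).
Qed.

End translate.

Section capacitability.
Import ArrowAsProduct.
Context (R : realType) (n : nat).
Local Notation E := 'rV[R]_n.+1.
Variable P : probability (borel (closed_set E)) R.

Lemma cluster_seq (T : topologicalType) (C : set T) (u : nat -> T) :
  compact C -> (forall i, C (u i)) ->
  exists2 p, C p & forall V, nbhs p V -> forall N, exists2 i, (N <= i)%N & V (u i).
Proof.
move=> cC Cu; have [|p [Cp clp]] := cC (u @ \oo) _; first by exists 0%N => // i _; exact: Cu.
exists p => // V nV N.
have [||_ [[i iN <-] Vui]] := clp (u @` [set i | (N <= i)%N]) V => //; last by exists i.
by exists N => // i /= Ni; exists i.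
Qed.

Lemma bounded_souslin_capacitable (A : set E) (M c : R) : souslin A ->
  A `<=` box 0 M -> (c%:E < completion P (hit A))%E ->
  exists2 K, compact K /\ K `<=` A & (c%:E <= P (hit K))%E.
Proof.
move=> [D cD AD] AM cA.
(* Bound the coordinates of the parameter t one after the other, keeping the outer
   measure of the hitting event above c; the parameters respecting all bounds form
   a compact set by Tychonoff. *)
pose A_ (s : seq nat) := [set x | exists2 t : nat -> nat, D (x, t) &
  forall i, (i < size s)%N -> (t i <= nth 0%N s i)%N].
pose X := {s | (c%:E < completion P (hit (A_ s)))%E}.
have A_0 : A_ [::] = A.
  rewrite AD; apply/seteqP; split=> [x [t Dxt _]|_ [[x t] Dxt <-]].
    by exists (x, t).
  by exists t.
have x0 : (c%:E < completion P (hit (A_ [::])))%E by rewrite A_0.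
have [|f [f0 fS]] := @dependent_choice X (fun s s' => exists m, sval s' = rcons (sval s) m) _ (exist (fun s => is_true (c%:E < completion P (hit (A_ s)))%E) [::] x0).
  move=> [s cs]; apply/cid => /=.
  have As : A_ s = \bigcup_m A_ (rcons s m).
    apply/seteqP; split=> [x [t Dxt ts]|x [m _ [t Dxt ts]]]; last first.
      exists t => // i si; have := ts i; rewrite size_rcons nth_rcons si.
      by apply; rewrite ltnS ltnW.
    exists (t (size s)) => //; exists t => // i.
    rewrite size_rcons ltnS leq_eqVlt nth_rcons => /predU1P[->|si].
      by rewrite ltnn eqxx.
    by rewrite si; exact: ts.
  have [||m cm] := @completion_bigcup_gt _ _ _ P (fun m => hit (A_ (rcons s m))) c.
  - move=> i j ij; apply/subsetPset; apply: hitS => x [t Dxt ts].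
    exists t => // k sk; have := ts k; move: (sk); rewrite !size_rcons => -> /(_ isT); rewrite !nth_rcons; case: ifPn => // _.
    by case: ifPn => // _ /leq_trans; apply.
  - by rewrite -hit_bigcup -As.
  - by exists (exist (fun s => is_true (c%:E < completion P (hit (A_ s)))%E) _ cm); exists m.
pose b i := nth 0%N (sval (f i.+1)) i.
have szf i : size (sval (f i)) = i.
  elim: i => [|i IH]; first by rewrite f0.
  by have [m ->] := fS i; rewrite size_rcons IH.
have bf i j : (j < i)%N -> nth 0%N (sval (f i)) j = b j.
  elim: i => // i IH; rewrite ltnS leq_eqVlt => /predU1P[->//|ji].
  by have [m ->] := fS i; rewrite nth_rcons szf ji IH.
pose K := [set x | box 0 M x /\ exists2 t : nat -> nat, D (x, t) & forall i, (t i <= b i)%N].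
have cbnd (b' : nat -> nat) : compact [set t : nat -> nat | forall i, (t i <= b' i)%N].
  apply: (@tychonoff nat (fun=> nat) (fun i => [set k | (k <= b' i)%N])) => i.
  apply: finite_compact; apply: sub_finite_set (finite_II (b' i).+1).
  by move=> k /=; rewrite ltnS.
have cK : compact K.
  rewrite (_ : K = fst @` (D `&` (box 0 M `*` [set t : nat -> nat | forall i, (t i <= b i)%N]))).
    apply: continuous_compact.
      by apply: continuous_subspaceT => x; exact: cvg_fst.
    rewrite setIC; apply: compact_closedI => //.
    by apply: compact_setX => //; exact: box_compact.
  apply/seteqP; split=> [x [xM [t Dxt tb]]|_ [[x t] /= [Dxt [xM tb]] <-]].
    by exists (x, t).
  by split => //; exists t.
exists K; first by split=> // x [_ [t Dxt _]]; rewrite AD; exists (x, t).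
have cl_compact i : compact (closure (A_ (sval (f i)))).
  apply: (@subclosed_compact _ _ (box 0 M)); [exact: closed_closure|exact: box_compact|].
  rewrite [X in _ `<=` X](_ : _ = closure (box 0 M)); last by apply/closure_id; exact: box_closed.
  apply: closure_subset => x [t Dxt _]; apply: AM; rewrite AD; by exists (x, t).
have mhit i : measurable (hit (closure (A_ (sval (f i)))) : set (borel (closed_set E))).
  exact: measurable_hit.
have ndA i j : (i <= j)%N -> A_ (sval (f j)) `<=` A_ (sval (f i)).
  move=> ij x [t Dxt tb]; exists t => // k; rewrite szf => ki.
  have kj := leq_trans ki ij.
  by have := tb k; rewrite szf !bf//; apply.
have cvgP : P (hit (closure (A_ (sval (f i))))) @[i --> \oo] -->
    P (\bigcap_i hit (closure (A_ (sval (f i))))).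
  apply: nonincreasing_cvg_mu => //.
  - by rewrite (le_lt_trans (probability_le1 _ _))// ltry.
  - exact: bigcapT_measurable.
  - by move=> i j ij; apply/subsetPset; apply: hitS; apply: closure_subset; exact: ndA.
have : (c%:E <= P (\bigcap_i hit (closure (A_ (sval (f i))))))%E.
  rewrite -(cvg_lim _ cvgP)//; apply: lime_ge; first by apply/cvg_ex; eexists; exact: cvgP.
  apply: nearW => i; rewrite -completionE//; apply: le_trans (ltW (svalP (f i))) _.
  by apply: le_completion; apply: hitS; exact: subset_closure.
move=> /le_trans; apply; apply: le_measure; rewrite ?inE//.
- exact: bigcapT_measurable.
- exact: measurable_hit.
suff sub (F : closed_set E) : (forall i, (F `&` closure (A_ (sval (f i)))) !=set0) ->
    (F `&` K) !=set0 by move=> F hF; apply: sub => i; exact: hF.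
move=> hF.
have /choice[u uP] : forall i : nat, exists y : E * (nat -> nat), [/\ D y,
    forall k, (k < i)%N -> (y.2 k <= b k)%N & exists2 x, carrier F x & ball x i.+1%:R^-1 y.1].
  move=> i; have [x [Fx clx]]  := hF i.
  have i0 : (0 : R) < i.+1%:R^-1 by rewrite invr_gt0.
  have [y [[t Dyt tb] xy]] := clx (ball x i.+1%:R^-1) (nbhsx_ballx _ _ i0).
  exists (y, t); split => //=; last by exists x.
  by move=> k ki; have := tb k; rewrite szf bf//; exact.
pose b' k := maxn (b k) (\max_(i < k.+1) (u i).2 k).
have [||[x t] [xM tb'] clu] := @cluster_seq _ (box 0 M `*` [set t : nat -> nat | forall i, (t i <= b' i)%N]) u.
- by apply: compact_setX; [exact: box_compact|exact: cbnd].
- move=> i; have [Du ub _] := uP i; split.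
    by apply: AM; rewrite AD; exists (u i).
  move=> k /=; rewrite /b' leq_max; have [ki|ik] := ltnP k i; first by rewrite ub.
  by rewrite (@leq_bigmax _ (fun i : 'I_k.+1 => (u i).2 k) (Ordinal (ik : (i < k.+1)%N))) orbT.
have Dxt : D (x, t).
  apply: cD => V nV; have [i _ Vi] := clu V nV 0%N.
  by exists (u i); split => //; have [] := uP i.
have tb i : (t i <= b i)%N.
  have nV : nbhs (x, t) [set p : E * (nat -> nat) | p.2 i = t i].
    exists (setT, [set t' : nat -> nat | t' i = t i]) => /=.
      split; first exact: filterT.
      exact: (@proj_continuous nat (fun=> nat) i t [set t i]).
    by move=> [y t1] [].

  by have [j ij /= <-] := clu _ nV i.+1; have [_ /(_ i ij)] := uP j.
exists x; split; last by split => //; exists t.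
apply: (@carrier_closed _ F) => V /nbhs_ballP[r /= r0 rV].
have r20 : 0 < r / 2 by exact: divr_gt0.
have [k ke] := @ltr_add_invr R 0 (r / 2) r20.
have nV : nbhs (x, t) [set p : E * (nat -> nat) | ball x (r / 2) p.1].
  exists (ball x (r / 2), setT) => /=; last by move=> [y t1] [].
  by split; [exact: nbhsx_ballx|exact: filterT].
have [i ki /= xu] := clu _ nV k.
have [_ _ [y Fy yu]] := uP i; exists y; split => //; apply: rV.
rewrite (splitr r); apply: (@ball_triangle _ _ (u i).1) => //; apply: ball_sym.
apply: le_ball yu; rewrite add0r in ke; apply: le_trans (ltW ke).
by rewrite lef_pV2 ?posrE// ler_nat.
Qed.

Lemma souslin_capacitable (A : set E) (e : R) : souslin A -> 0 < e ->
  exists2 K, compact K /\ K `<=` A &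
    (completion P (hit A) <= P (hit K) + e%:E)%E.
Proof.
move=> sA e0; have Afin := completion_fin_num P (hit A).
have eA : ((fine (completion P (hit A)) - e)%:E < completion P (hit A))%E.
  by rewrite -[ltRHS]fineK// lte_fin ltrBlDr ltrDl.
have [||k ek] := @completion_bigcup_gt _ _ _ P (fun k => hit (A `&` box 0 k%:R))
    (fine (completion P (hit A)) - e).
- move=> i j ij; apply/subsetPset; apply: hitS => x [Ax xi]; split => //.
  by apply: le_trans xi _; rewrite ler_nat.
- rewrite -hit_bigcup -setI_bigcupr (_ : \bigcup_i _ = setT) ?setIT//.
  apply/seteqP; split => // x _; have [k _ kx] := nbhs_infty_ger (`|x|).
  by exists k => //; rewrite /box /= subr0; by apply: kx => /=.
have [||K [cK KA] eK] := @bounded_souslin_capacitable (A `&` box 0 k%:R) k%:R _ _ _ ek.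
- rewrite (_ : _ `&` _ = \bigcap_i (fun i => if i is 0%N then A else box 0 k%:R) i); last first.
    by apply/seteqP; split=> [x [Ax xk] [|i] _//|x Ax]; split; [exact: (Ax 0%N)|exact: (Ax 1%N)].
  by apply: souslin_bigcap => -[|i] //; apply: souslin_closed; exact: box_closed.
- by move=> x [].
exists K; first by split=> // x /KA [].
by move: eK; rewrite -leeBlDr// EFinB fineK.
Qed.

End capacitability.

Section enorm_infty_filter.
Context (R : realType) (n : nat).

Lemma enorm_infty_filter : Filter (@enorm_infty R n).
Proof.
apply: filter_from_filter; first by exists 0.
move=> M N _ _; exists (Num.max M N) => // h /=.
by rewrite gt_max => /andP[].
Qed.

End enorm_infty_filter.
#[export] Existing Instance enorm_infty_filter.

Section mixing_borel.
Context (R : realType) (n : nat).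
Local Notation E := 'rV[R]_n.+1.
Variable P : probability (borel (closed_set E)) R.

Lemma completion_hit_translate (h : E) (A : set E) :
  (forall K h, compact K -> P (hit (translate h K)) = P (hit K)) ->
  souslin A -> (completion P (hit (translate h A)) <= completion P (hit A))%E.
Proof.
move=> Ph sA; apply/lee_addgt0Pr => e e0.
have [K [cK KA] /le_trans] := souslin_capacitable P (souslin_translate h sA) e0.
apply; rewrite leeD2r// -(Ph K (- h))// -completionE; last first.
  by apply: measurable_hit; exact: translate_compact.
apply: le_completion; apply: hitS; rewrite -[X in _ `<=` X](translateK h A).
exact: translateS.
Qed.

Lemma completion_hitD (A K : set E) (e : R) : compact K -> K `<=` A ->
  (completion P (hit A) <= P (hit K) + e%:E)%E ->
  (completion P (hit A `\` hit K) <= e%:E)%E.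
Proof.
move=> cK KA; have mK := measurable_hit cK.
rewrite (completion_split P (hit A) mK) setIidr; last exact: hitS.
by rewrite completionE// leeD2lE// -completionE// completion_fin_num.
Qed.

Lemma fine_completion (X Y Z : set (borel (closed_set E))) (e : R) :
  X `<=` Y -> Y `<=` X `|` Z -> (completion P Z <= e%:E)%E ->
  `|fine (completion P Y) - fine (completion P X)| <= e.
Proof.
move=> XY YXZ Ze.
have le1 : fine (completion P X) <= fine (completion P Y).
  by rewrite fine_le ?completion_fin_num//; exact: le_completion.
rewrite ger0_norm ?subr_ge0// lerBlDl -lee_fin EFinD !fineK ?completion_fin_num//.
apply: le_trans (le_completion P YXZ) _; apply: le_trans (completionU _ _ _) _.
by rewrite leeD2l.
Qed.

Lemma mixing_borel (A B : set E) : souslin A -> souslin B ->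
  (forall K h, compact K -> P (hit (translate h K)) = P (hit K)) ->
  (forall K L, compact K -> compact L ->
    fine (P (avoid K `&` avoid (translate h L))) @[h --> enorm_infty] -->
      fine (P (avoid K)) * fine (P (avoid L))) ->
  completion P (avoid A `&` avoid (translate h B)) @[h --> enorm_infty] -->
    (completion P (avoid A) * completion P (avoid B))%E.
Proof.
move=> sA sB Ph mix.
have fin := completion_fin_num P.
rewrite -(fineK (fin (avoid A))) -(fineK (fin (avoid B))) -EFinM.
apply/fine_cvgP; split; first by apply: nearW => h; exact: fin.
apply/cvgrPdist_le => e e0; have e60 : 0 < e / 6 by exact: divr_gt0.
have [K [cK KA] Ke] := souslin_capacitable P sA e60.
have [L [cL LB] Le] := souslin_capacitable P sB e60.
have aKA : `|fine (completion P (avoid K)) - fine (completion P (avoid A))| <= e / 6.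
  apply: (@fine_completion _ _ (hit A `\` hit K)); last exact: completion_hitD.
    by rewrite !avoidE; apply: subsetC; exact: hitS.
  by rewrite !avoidE => F KF; have [] := pselect (hit A F); [right|left].
have aLB : `|fine (completion P (avoid L)) - fine (completion P (avoid B))| <= e / 6.
  apply: (@fine_completion _ _ (hit B `\` hit L)); last exact: completion_hitD.
    by rewrite !avoidE; apply: subsetC; exact: hitS.
  by rewrite !avoidE => F KF; have [] := pselect (hit B F); [right|left].
have bnd X : 0 <= fine (completion P X) <= 1.
  by rewrite fine_ge0 ?completion_ge0//= -lee_fin fineK ?fin// completion_le1.
move/cvgrPdist_le : (mix K L cK cL) => /(_ _ e60).
apply: filterS => h.
have cTL : compact (translate h L) by exact: translate_compact.
have mK := measurable_avoid cK; have mL := measurable_avoid cL.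
have mTL := measurable_avoid cTL.
rewrite -!completionE//; last exact: measurableI.
have aU : `|fine (completion P (avoid K `&` avoid (translate h L))) -
    fine (completion P (avoid A `&` avoid (translate h B)))| <= e / 6 + e / 6.
  apply: (@fine_completion _ _ ((hit A `\` hit K) `|` (hit (translate h B) `\` hit (translate h L)))).
  - rewrite !avoidE; apply: setISS; apply: subsetC; apply: hitS => //.
    exact: translateS.
  - rewrite !avoidE => F [KF LF].
    have [hA|nA] := pselect (hit A F); first by right; left.
    have [hB|nB] := pselect (hit (translate h B) F); first by right; right.
    by left.
  - apply: le_trans (completionU _ _ _) _; rewrite EFinD leeD//.
      exact: completion_hitD.
    apply: completion_hitD => //; first exact: translateS.
    by rewrite Ph//; apply: le_trans (completion_hit_translate h Ph sB) _.
move: aU aKA aLB (bnd (avoid A)) (bnd (avoid B)) (bnd (avoid K)) (bnd (avoid L)).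
set a := fine _; set b := fine _; set k := fine _; set l := fine _.
set u := fine _; set v := fine _.
rewrite /= -/b !ler_norml => aU aKA aLB bl bv bk bu mKL.
have p1 : - (e / 6) <= l * (u - v) <= e / 6 by nra.
have p2 : - (e / 6) <= u * (k - l) <= e / 6 by nra.
lra.
Qed.

End mixing_borel.

(** * Hyperplanes and their sides *)

Section dot_product.
Context (R : realType) (n : nat).
Implicit Types (x y z u h : 'rV[R]_n) (c : R).

Lemma dotC x y : dot x y = dot y x.
Proof. by rewrite /dot; apply: eq_bigr => i _; rewrite mulrC. Qed.

Lemma dotDl x y u : dot (x + y) u = dot x u + dot y u.
Proof. by rewrite /dot -big_split; apply: eq_bigr => i _; rewrite mxE mulrDl. Qed.

Lemma dotZl c x u : dot (c *: x) u = c * dot x u.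
Proof. by rewrite /dot mulr_sumr; apply: eq_bigr => i _; rewrite mxE mulrA. Qed.

Lemma dotNl x u : dot (- x) u = - dot x u.
Proof. by rewrite -scaleN1r dotZl mulN1r. Qed.

Lemma dotBl x y u : dot (x - y) u = dot x u - dot y u.
Proof. by rewrite dotDl dotNl. Qed.

Lemma dot0l u : dot 0 u = 0.
Proof. by rewrite -(scale0r 0) dotZl mul0r. Qed.

Lemma dotDr x y u : dot u (x + y) = dot u x + dot u y.
Proof. by rewrite dotC dotDl !(dotC u). Qed.

Lemma dotZr c x u : dot u (c *: x) = c * dot u x.
Proof. by rewrite dotC dotZl dotC. Qed.

Lemma dotNr x u : dot u (- x) = - dot u x.
Proof. by rewrite dotC dotNl dotC. Qed.

Lemma dot_ge0 x : 0 <= dot x x.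
Proof. by apply: sumr_ge0 => i _; rewrite -expr2 sqr_ge0. Qed.

Lemma dot_eq0 x : (dot x x == 0) = (x == 0).
Proof.
apply/eqP/eqP => [|->]; last by rewrite dot0l.
move/eqP; rewrite psumr_eq0; last by move=> i _; rewrite -expr2 sqr_ge0.
move=> /allP x0; apply/rowP => i; rewrite mxE.
by have := x0 i (mem_index_enum _); rewrite -expr2 sqrf_eq0 => /eqP.
Qed.

Lemma enorm_sqr x : enorm x ^+ 2 = dot x x.
Proof. by rewrite /enorm sqr_sqrtr// dot_ge0. Qed.

Lemma enorm_ge0 x : 0 <= enorm x.
Proof. exact: sqrtr_ge0. Qed.

Lemma enorm_gt0 x : x != 0 -> 0 < enorm x.
Proof. by move=> x0; rewrite /enorm sqrtr_gt0 lt0r dot_eq0 x0 dot_ge0. Qed.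

End dot_product.

Section segment.
Context (R : realType) (n : nat).
Implicit Types (x y z u : 'rV[R]_n.+1) (r : R).

Definition seg x y : set 'rV[R]_n.+1 :=
  [set (1 - t) *: x + t *: y | t in [set t : R | 0 <= t <= 1]].

Lemma seg_compact x y : compact (seg x y).
Proof.
apply: (@continuous_compact R^o).
  apply: continuous_subspaceT => t.
  apply: cvgD; apply: cvgZr_tmp; last exact: cvg_id.
  by apply: cvgB; [exact: cvg_cst|exact: cvg_id].
rewrite (_ : [set t | _] = `[0, 1]%classic); first exact: segment_compact.
by apply/seteqP; split => t /=; rewrite in_itv.
Qed.

Lemma dot_seg x y u t : dot ((1 - t) *: x + t *: y) u = dot x u + t * (dot y u - dot x u).
Proof. by rewrite dotDl !dotZl; ring. Qed.

Lemma seg_cross x y u r : dot x u <= r -> r <= dot y u ->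
  exists2 z, seg x y z & dot z u = r.
Proof.
move=> xr ry; have [e|ne] := eqVneq (dot x u) (dot y u).
  exists x; last by apply/le_anti; rewrite xr e ry.
  by exists 0 => /=; rewrite ?lexx ?ler01// subr0 scale1r scale0r addr0.
have lt : 0 < dot y u - dot x u by rewrite subr_gt0 lt_neqAle ne (le_trans xr).
exists ((1 - (r - dot x u) / (dot y u - dot x u)) *: x + ((r - dot x u) / (dot y u - dot x u)) *: y).
  exists ((r - dot x u) / (dot y u - dot x u)) => //=.
  apply/andP; split; first by apply: divr_ge0; [rewrite subr_ge0|exact: ltW].
  by rewrite ler_pdivrMr// mul1r lerB.
by rewrite dot_seg divfK ?gt_eqF// addrC subrK.
Qed.

Lemma seg_box x r y z : 0 <= r -> box x r y -> seg x y z -> box x r z.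
Proof.
move=> r0; rewrite /box /= => yr [t /andP[t0 t1] <-].
rewrite (_ : _ - x = t *: (y - x)); last first.
  by apply/rowP => i; rewrite !mxE; ring.
by rewrite normrZ (ger0_norm t0) (le_trans _ yr)// ler_piMl.
Qed.

End segment.

Section hyperplanes.
Context (R : realType) (n : nat).
Local Notation E := 'rV[R]_n.+1.
Implicit Types (g : hyperplane R n) (x y : E) (r : R) (u : sphere R n).

Lemma closed_set_inj (T : topologicalType) (F G : closed_set T) :
  carrier F = carrier G -> F = G.
Proof.
case: F G => [F cF] [G cG] /= FG; rewrite FG in cF *.
by congr ClosedSet; exact: Prop_irrelevance.
Qed.

Lemma hyperplane_inj g g' : carrier g = carrier g' -> g = g'.
Proof.
case: g g' => [F hF] [G hG] /= /closed_set_inj FG; rewrite FG in hF *.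
by congr Hyperplane; exact: Prop_irrelevance.
Qed.

Lemma sphere_inj u u' : direction u = direction u' -> u = u'.
Proof.
case: u u' => [u hu] [v hv] /= uv; rewrite uv in hu *.
by congr Sphere; exact: Prop_irrelevance.
Qed.

Lemma dot_sphere u : dot u u = 1.
Proof. by rewrite -enorm_sqr direction_unit expr1n. Qed.

Lemma hyperplane_polar g : ~ carrier g 0 ->
  exists r u, 0 < r /\ g = hyperplane_of (r, u).
Proof.
case: (hyperplaneP g) => v [c [v0 gE]]; rewrite gE /= dot0l => c0.
pose s : R := if 0 < c then 1 else -1.
have s2 : s * s = 1 by rewrite /s; case: ifP => _; rewrite ?mulr1// mulrNN mulr1.
have e0 := enorm_gt0 v0.
pose w := (s / enorm v) *: v.
have w1 : enorm w = 1.
  rewrite /enorm dotZl dotZr -enorm_sqr.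
  rewrite (_ : _ * _ = 1) ?sqrtr1//.
  rewrite expr2 (_ : _ * _ = s * s * (enorm v / enorm v) * (enorm v / enorm v)); last by ring.
  by rewrite s2 divff ?gt_eqF// !mulr1.
exists (s * c / enorm v), (Sphere w1); split.
  rewrite divr_gt0//; have [c1|c1] := ltP 0 c; rewrite /s.
    by rewrite c1 mul1r.
  rewrite (le_gtF c1) mulN1r oppr_gt0 lt_neqAle c1 andbT.
  by apply/eqP => /esym.
apply: hyperplane_inj; rewrite gE; apply/seteqP; split => x /=.
  by move=> xv; rewrite dotZr xv; ring.
rewrite dotZr => /(congr1 (fun t => t * enorm v * s)).
rewrite (_ : s / _ * _ * _ * _ = s * s * dot x v * (enorm v / enorm v)); last by ring.
rewrite (_ : s * _ / _ * _ * _ = s * s * c * (enorm v / enorm v)); last by ring.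
by rewrite s2 divff ?gt_eqF// !mulr1 !mul1r.
Qed.

Lemma hyperplane_of_inj r r' u u' : 0 < r -> 0 < r' ->
  hyperplane_of (r, u) = hyperplane_of (r', u') -> r = r' /\ u = u'.
Proof.
move=> r0 r0' /(congr1 (fun g => carrier (hyperplane_set g))) /= e.
have : [set x | dot x u = r] (r *: direction u) by rewrite /= dotZl dot_sphere mulr1.
rewrite e /= dotZl => e1.
have : [set x | dot x u' = r'] (r' *: direction u') by rewrite /= dotZl dot_sphere mulr1.
rewrite -e /= dotZl dotC => e2.
have rr' : r = r'.
  have : r * r = r' * r' by rewrite -{2}e2 -{2}e1; ring.
  by move=> /eqP; rewrite -!expr2 eqrXn2 ?ltW// => /eqP.
split => //; apply: sphere_inj; apply/eqP; rewrite -subr_eq0 -dot_eq0.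
have uu' : dot u u' = 1.
  by apply: (mulfI (lt0r_neq0 r0)); rewrite mulr1 e1.
by rewrite dotBl !dotDr !dotNr !dot_sphere uu' dotC uu'; apply/eqP; ring.
Qed.

Lemma near_sideE r u : 0 < r ->
  near_side (hyperplane_of (r, u)) = [set x | dot x u <= r].
Proof.
move=> r0; apply/seteqP; split => [x [r' [u' [r0' e xr]]]|x xr]; last by exists r, u.
by have [-> ->] := hyperplane_of_inj r0 r0' e.
Qed.

Lemma far_sideE r u : 0 < r ->
  far_side (hyperplane_of (r, u)) = [set x | r <= dot x u].
Proof.
move=> r0; apply/seteqP; split => [x [r' [u' [r0' e xr]]]|x xr]; last by exists r, u.
by have [-> ->] := hyperplane_of_inj r0 r0' e.
Qed.

Lemma near_side_through0 g : carrier g 0 -> near_side g = set0.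
Proof.
move=> g0; apply/seteqP; split => // x [r [u [r0 gE _]]].
by move: g0 r0; rewrite gE /= dot0l => ->; rewrite ltxx.
Qed.

Lemma far_side_through0 g : carrier g 0 -> far_side g = set0.
Proof.
move=> g0; apply/seteqP; split => // x [r [u [r0 gE _]]].
by move: g0 r0; rewrite gE /= dot0l => ->; rewrite ltxx.
Qed.

Lemma far_side_seg g x :
  far_side g x <-> (g `&` seg 0 x !=set0 /\ ~ carrier g 0).
Proof.
have [g0|/hyperplane_polar[r [u [r0 gE]]]] := pselect (carrier g 0).
  by rewrite far_side_through0//; split => // -[].
rewrite gE far_sideE//= dot0l; split => [rx|[[y /= [yu [t /andP[t0 t1] yE]]] _]].
  split; last by move=> e; rewrite e ltxx in r0.
  have [|z zs zr] := @seg_cross _ _ 0 x u r _ rx; first by rewrite dot0l ltW.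
  by exists z.
move: yu; rewrite -yE dot_seg dot0l add0r subr0 => tr.
by rewrite -tr ler_piMl//; nra.
Qed.

Lemma near_side_seg g x :
  near_side g x <-> (~ carrier g 0 /\ (~ far_side g x \/ carrier g x)).
Proof.
have [g0|/[dup] ng0 /hyperplane_polar[r [u [r0 gE]]]] := pselect (carrier g 0).
  by rewrite near_side_through0//; split => // -[].
split => [nx|[_]].
  split => //; move: nx; rewrite gE near_sideE// far_sideE//= le_eqVlt => /predU1P[|xr]; first by right.
  by left; apply/negP; rewrite -ltNge.
rewrite gE near_sideE// far_sideE//= => -[/negP|->//].
by rewrite -ltNge => /ltW.
Qed.

End hyperplanes.

Section sphere_opposite.
Context (R : realType) (n : nat).

Lemma sphereN_subproof (u : sphere R n) : enorm (- direction u) = 1.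
Proof. by rewrite /enorm dotNl dotNr opprK -[RHS](direction_unit u). Qed.

Definition sphereN (u : sphere R n) : sphere R n := Sphere (sphereN_subproof u).

End sphere_opposite.

Section hyperplane_measurability.
Context (R : realType) (n : nat).
Local Notation E := 'rV[R]_n.+1.
Local Notation H := (borel (hyperplane R n)).
Implicit Types (g : hyperplane R n) (x y h : E) (r : R).

Lemma hitting_preimage (A : set E) :
  hitting A = @hyperplane_set R n @^-1` hit A.
Proof. by []. Qed.

Lemma measurable_hyperplane_preimage (U : set (closed_set E)) : open U ->
  measurable (@hyperplane_set R n @^-1` U : set H).
Proof.
by move=> oU; apply: sub_sigma_algebra; exists U.
Qed.

Lemma measurable_hitting (K : set E) : compact K -> measurable (hitting K : set H).
Proof.
move=> cK; rewrite hitting_preimage hitE -preimage_setC; apply: measurableC.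
rewrite ?hitting_preimage; apply: measurable_hyperplane_preimage; apply: fell_subbase_open.
by left; exists K.
Qed.

Lemma measurable_hitting_open (O : set E) : open O -> measurable (hitting O : set H).
Proof.
move=> oO; rewrite ?hitting_preimage; apply: measurable_hyperplane_preimage; apply: fell_subbase_open.
by right; exists O.
Qed.

Lemma hitting1 x : hitting [set x] = [set g : hyperplane R n | carrier g x].
Proof.
apply/seteqP; split=> g; first by move=> [y [gy /= <-]].
by move=> gx; exists x.
Qed.

Lemma measurable_through x : measurable ([set g : hyperplane R n | carrier g x] : set H).
Proof. by rewrite -hitting1; apply: measurable_hitting; exact: compact_set1. Qed.

Lemma measurable_far x : measurable ([set g : hyperplane R n | far_side g x] : set H).
Proof.
rewrite (_ : [set g : hyperplane R n | _] = hitting (seg 0 x) `\` [set g : hyperplane R n | carrier g 0]).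
  apply: measurableD; [apply: measurable_hitting; exact: seg_compact|exact: measurable_through].
apply/seteqP; split=> g /=; first by move=> /far_side_seg.
by move=> ?; exact/far_side_seg.
Qed.

Lemma measurable_near x : measurable ([set g : hyperplane R n | near_side g x] : set H).
Proof.
rewrite (_ : [set g : hyperplane R n | _] = (~` [set g : hyperplane R n | far_side g x] `|` [set g : hyperplane R n | carrier g x])
    `\` [set g : hyperplane R n | carrier g 0]).
  apply: measurableD; last exact: measurable_through.
  apply: measurableU; last exact: measurable_through.
  by apply: measurableC; exact: measurable_far.
apply/seteqP; split=> g /=; first by move=> /near_side_seg[].
by move=> [? ?]; exact/near_side_seg.
Qed.

Definition ratv (q : 'rV[rat]_n.+1) : E := map_mx ratr q.

Lemma ratv_dense x r : 0 < r -> exists q, ball x r (ratv q).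
Proof.
move=> r0.
have /choice[q qP] : forall i, exists q : rat, `|x ord0 i - ratr q| < r.
  move=> i; have /rat_in_itvoo[q] : x ord0 i - r < x ord0 i + r by lra.
  by rewrite in_itv /= => qi; exists q; rewrite ltr_norml; lra.
exists (\row_i q i); split => // i j; rewrite !mxE ord1.
exact: qP.
Qed.

Lemma open_side_dense (A : set E) (x : E) (r : R) :
  (forall y, A y -> forall e, 0 < e -> exists2 z, ball y e z & A° z) ->
  (A `&` ball x r !=set0) <-> exists q, A (ratv q) /\ ball x r (ratv q).
Proof.
move=> dA; split=> [[y [Ay xy]]|[q [Aq xq]]]; last by exists (ratv q).
have : nbhs y (ball x r) by apply: open_nbhs_nbhs; split => //; exact: ball_open.
move=> /nbhs_ballP[e /= e0 ye].
have [z yz] := dA y Ay e e0; move/nbhs_ballP => [e' /= e0' ze'].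
have : nbhs z (ball x r) by apply: open_nbhs_nbhs; split; [exact: ball_open|exact: ye].
move=> /nbhs_ballP[e'' /= e0'' ze''].
have [|q zq] := @ratv_dense z (Num.min e' e''); first by rewrite lt_min e0' e0''.
exists q; split; [apply: ze'|apply: ze'']; apply: le_ball zq; rewrite ge_min lexx ?orbT//.
Qed.

Lemma dot_continuous (u : E) : continuous (fun x : E => dot x u).
Proof.
move=> x; rewrite /dot; elim: (index_enum _) => [|i s IH].
  under eq_fun do rewrite big_nil.
  exact: cst_continuous.
under eq_fun do rewrite big_cons.
have cx : (fun y : E => y 0 i) y @[y --> x] --> x 0 i by exact: coord_continuous.
exact: cvgD (cvgMr_tmp cx) IH.
Qed.

Lemma half_space_dense (u : sphere R n) (c : R) (y : E) (e : R) :
  c <= dot y u -> 0 < e ->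
  exists2 z, ball y e z & [set x : E | c <= dot x u]° z.
Proof.
move=> cy e0; have uP : 0 < `|direction u| by rewrite normr_gt0 sphere_neq0.
pose t := e / 2 / `|direction u|.
have t0 : 0 < t by rewrite !divr_gt0.
exists (y + t *: direction u).
  rewrite -ball_normE /= opprD addrA subrr add0r normrN normrZ (gtr0_norm t0).
  by rewrite /t divfK ?gt_eqF//; lra.
have oU : open [set x : E | c < dot x u].
  apply: (@open_comp _ _ (fun x : E => dot x u) [set s | c < s]) => [x _|]; last exact: open_gt.
  exact: dot_continuous.
apply: (filterS _ (open_nbhs_nbhs (conj oU _))) => [x /=|/=]; first exact: ltW.
by rewrite dotDl dotZl dot_sphere mulr1 (le_lt_trans cy)// ltrDl.
Qed.

Lemma measurable_far_ball x r :
  measurable ([set g : hyperplane R n | far_side g `&` ball x r !=set0] : set H).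
Proof.
rewrite (_ : [set g : hyperplane R n | _] =
    \bigcup_q [set g : hyperplane R n | far_side g (ratv q) /\ ball x r (ratv q)]).
  apply: countable_bigcupT_measurable => // q.
  have [xq|nxq] := pselect (ball x r (ratv q)).
    rewrite (_ : [set g : hyperplane R n | _] = [set g : hyperplane R n | far_side g (ratv q)]).
      exact: measurable_far.
    by apply/seteqP; split => g //= [].
  rewrite (_ : [set g : hyperplane R n | _] = set0); first exact: measurable0.
  by apply/seteqP; split => g //= [].
apply/seteqP; split => g.
  move=> /open_side_dense[|q [gq xq]]; last by exists q.
  have [g0|/hyperplane_polar[s [u [s0 ->]]]] := pselect (carrier g 0).
    by rewrite far_side_through0.
  by rewrite far_sideE// => y ys e e0; exact: half_space_dense.
by move=> [q _ [gq xq]]; exists (ratv q).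
Qed.

Lemma measurable_near_ball x r :
  measurable ([set g : hyperplane R n | near_side g `&` ball x r !=set0] : set H).
Proof.
rewrite (_ : [set g : hyperplane R n | _] =
    \bigcup_q [set g : hyperplane R n | near_side g (ratv q) /\ ball x r (ratv q)]).
  apply: countable_bigcupT_measurable => // q.
  have [xq|nxq] := pselect (ball x r (ratv q)).
    rewrite (_ : [set g : hyperplane R n | _] = [set g : hyperplane R n | near_side g (ratv q)]).
      exact: measurable_near.
    by apply/seteqP; split => g //= [].
  rewrite (_ : [set g : hyperplane R n | _] = set0); first exact: measurable0.
  by apply/seteqP; split => g //= [].
apply/seteqP; split => g.
  move=> /open_side_dense[|q [gq xq]]; last by exists q.
  have [g0|/hyperplane_polar[s [u [s0 ->]]]] := pselect (carrier g 0).
    by rewrite near_side_through0.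
  rewrite near_sideE// => y ys e e0.
  have [|z yz zi] := @half_space_dense (sphereN u) (- s) y e _ e0.
    by rewrite dotNr lerN2.
  exists z => //; move: zi; congr (_° z); apply/seteqP; split=> w /=;
    by rewrite dotNr lerN2.
by move=> [q _ [gq xq]]; exists (ratv q).
Qed.

End hyperplane_measurability.

(** * Division trees *)

Fixpoint code_positive (k : positive) : seq bool :=
  match k with
  | xH => [::]
  | xO j => false :: code_positive j
  | xI j => true :: code_positive j
  end.

Fixpoint decode_positive (s : seq bool) : positive :=
  match s with
  | [::] => xH
  | false :: s => xO (decode_positive s)
  | true :: s => xI (decode_positive s)
  end.

Lemma code_positiveK : cancel code_positive decode_positive.
Proof. by elim=> //= k ->. Qed.

HB.instance Definition _ := Countable.copy positive (can_type code_positiveK).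

(* [graft_index b k] is the index in the whole tree of the node k of the subtree
   rooted at 2 (b = false) or 3 (b = true). *)
Fixpoint graft_index (b : bool) (k : positive) : positive :=
  match k with
  | xH => if b then xI xH else xO xH
  | xO j => xO (graft_index b j)
  | xI j => xI (graft_index b j)
  end.

Fixpoint prune_index (k : positive) : option (bool * positive) :=
  match k with
  | xH => None
  | xO j => if prune_index j is Some (b, i) then Some (b, xO i) else Some (false, xH)
  | xI j => if prune_index j is Some (b, i) then Some (b, xI i) else Some (true, xH)
  end.

Lemma graft_indexK b k : prune_index (graft_index b k) = Some (b, k).
Proof. by elim: k => [k /= ->|k /= ->|] //; case: b. Qed.

Lemma prune_indexK k :
  if prune_index k is Some (b, j) then graft_index b j = k else k = xH.
Proof.
elim: k => [k|k|] //=; by case: (prune_index k) => [[b j] /= ->|->].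
Qed.

Lemma graft_index_inj b : injective (graft_index b).
Proof. by move=> i j /(congr1 prune_index); rewrite !graft_indexK => -[]. Qed.

Lemma positive_root_ind (Q : positive -> Prop) : Q xH ->
  (forall b k, Q k -> Q (graft_index b k)) -> forall k, Q k.
Proof.
move=> Q1 Qg k.
have [m] := ubnP (size (code_positive k)); elim: m k => // m IH k km.
have := prune_indexK k; case: (prune_index k) => [[b j] jk|->//].
rewrite -jk; apply/Qg/IH; rewrite -jk in km.
suff e : size (code_positive (graft_index b j)) = (size (code_positive j)).+1.
  by rewrite e in km.
by elim: (j) => [i /= ->|i /= ->|] //=; case: (b).
Qed.

(* The 2^N - 1 nodes of the first N generations. *)
Fixpoint nodes (N : nat) : seq positive :=
  if N is M.+1 then
    xH :: map (graft_index false) (nodes M) ++ map (graft_index true) (nodes M)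
  else [::].

Lemma mem_nodesS N k : (k \in nodes N.+1) =
  if prune_index k is Some (b, j) then j \in nodes N else true.
Proof.
have := prune_indexK k; case E : (prune_index k) => [[b j]|] => [<-|->]; last by rewrite inE eqxx.
rewrite /= inE mem_cat.
have -> : (graft_index b j == xH) = false by case: (j) => //; case: (b).
have neq b' : (graft_index b j \in map (graft_index b') (nodes N)) = (b == b') && (j \in nodes N).
  have [->|bb'] := eqVneq b b'; first by rewrite mem_map//; exact: graft_index_inj.
  apply/mapP => -[i _ /(congr1 prune_index)]; rewrite !graft_indexK => -[].
  by move/eqP: bb'.
by rewrite !neq /=; case: (b); rewrite ?orbF.
Qed.

Lemma nodes_leq N M : (N <= M)%N -> {subset nodes N <= nodes M}.
Proof.
elim: N M => [//|N IH] [//|M] NM k; rewrite !mem_nodesS.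
by case: (prune_index k) => [[b j]|//]; exact: IH.
Qed.

Lemma nodes_uniq N : uniq (nodes N).
Proof.
elim: N => //= N IH; rewrite mem_cat cat_uniq !map_inj_uniq ?IH; try exact: graft_index_inj.
have nx b : (xH \in map (graft_index b) (nodes N)) = false.
  by apply/negP => /mapP[j _]; case: j => //; case: b.
rewrite !nx /= andbT; apply/hasPn => k /mapP[i _ ->]; apply/mapP => -[j _].
by move=> /(congr1 prune_index); rewrite !graft_indexK.
Qed.

Lemma nodes_exhaust k : exists N, k \in nodes N.
Proof.
elim/positive_root_ind: k => [|b k [N kN]]; first by exists 1%N.
by exists N.+1; rewrite mem_nodesS graft_indexK.
Qed.

Section trees.
Context (R : realType) (n : nat).
Local Notation H := (borel (hyperplane R n)).

Definition tree0 : Type := (positive -> R) * (positive -> hyperplane R n).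
HB.instance Definition _ := Pointed.on tree0.

Definition coordinate_sets : set (set tree0) :=
  [set C | exists k, (exists2 A : set R, measurable A & C = [set t | A (t.1 k)]) \/
    (exists2 B : set H, measurable B & C = [set t | B (t.2 k)])].

Definition tree := g_sigma_algebraType coordinate_sets.

Definition cylinder N (A : positive -> set R) (B : positive -> set H) : set tree :=
  [set t | forall k, k \in nodes N -> A k (t.1 k) /\ B k (t.2 k)].

Definition cylinders : set (set tree) :=
  [set C | exists N A B, [/\ forall k, measurable (A k), forall k, measurable (B k) &
     C = cylinder N A B]].

Lemma measurable_tree_time k : measurable_fun [set: tree] (fun t : tree => t.1 k).
Proof.
move=> _ A mA; rewrite setTI; apply: sub_sigma_algebra.
by exists k; left; exists A.
Qed.

Lemma measurable_tree_hyperplane k :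
  measurable_fun [set: tree] (fun t : tree => t.2 k : H).
Proof.
move=> _ B mB; rewrite setTI; apply: sub_sigma_algebra.
by exists k; right; exists B.
Qed.

Lemma measurable_fun_tree d (T : measurableType d) (f : T -> tree) :
  (forall k, measurable_fun setT (fun x => (f x).1 k)) ->
  (forall k, measurable_fun setT (fun x => (f x).2 k : H)) ->
  measurable_fun setT f.
Proof.
move=> f1 f2; apply: (@measurability _ _ T tree setT f coordinate_sets erefl).
move=> _ [_ [k [[A mA ->]|[B mB ->]]] <-].
  exact: f1.
exact: f2.
Qed.

Lemma cylinders_generate : @measurable _ tree = <<s cylinders >>.
Proof.
apply/seteqP; split; last first.
  apply: smallest_sub; first exact: sigma_algebra_measurable.
  move=> _ [N [A [B [mA mB ->]]]].
  rewrite (_ : cylinder N A B = \bigcap_(k in [set k | k \in nodes N])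
     ([set t : tree | A k (t.1 k)] `&` [set t : tree | B k (t.2 k)])); last first.
    by apply/seteqP; split.
  apply: fin_bigcap_measurable => //.
  move=> k _; apply: measurableI.
    by rewrite -[X in measurable X]setTI; exact: measurable_tree_time.
  by rewrite -[X in measurable X]setTI; exact: (measurable_tree_hyperplane k measurableT (mB k)).
apply: smallest_sub; first exact: smallest_sigma_algebra.
move=> _ [k [[A mA ->]|[B mB ->]]]; apply: sub_sigma_algebra; have [N kN] := nodes_exhaust k.
  exists N, (fun j => if j == k then A else setT), (fun=> setT).
  split => //; first by move=> j; case: ifP.
  apply/seteqP; split=> [t Akt j jN|t /(_ k kN)] /=; last by rewrite eqxx => -[].
  by split => //; case: eqP => // ->.
exists N, (fun=> setT), (fun j => if j == k then B else setT).
split => //; first by move=> j; case: ifP.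
apply/seteqP; split=> [t Akt j jN|t /(_ k kN)] /=; last by rewrite eqxx => -[].
by split => //; case: eqP => // ->.
Qed.

Lemma cylinders_setI : setI_closed cylinders.
Proof.
move=> _ _ [N [A [B [mA mB ->]]]] [N' [A' [B' [mA' mB' ->]]]].
exists (maxn N N'), (fun k => (if k \in nodes N then A k else setT) `&`
   (if k \in nodes N' then A' k else setT)), (fun k => (if k \in nodes N then B k else setT) `&`
   (if k \in nodes N' then B' k else setT)).
split; [by move=> k; apply: measurableI; case: ifP|by move=> k; apply: measurableI; case: ifP|].
apply/seteqP; split=> [t [h h'] k _|t h]; last first.
  split=> k kN.
    have /h : k \in nodes (maxn N N') by apply: nodes_leq kN; exact: leq_maxl.
    by rewrite kN => -[[? _] [? _]].
  have /h : k \in nodes (maxn N N') by apply: nodes_leq kN; exact: leq_maxr.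
  by rewrite kN => -[[_ ?] [_ ?]].
by split; split; case: ifP => // kN; [have [] := h k kN|have [] := h' k kN|have [] := h k kN|have [] := h' k kN].
Qed.

Lemma tree_measure_unique (P Q : probability tree R) :
  (forall C, cylinders C -> P C = Q C) -> forall C, measurable C -> P C = Q C.
Proof.
move=> PQ C mC.
apply: (measure_unique cylinders (fun=> setT)) => //.
- exact: cylinders_generate.
- exact: cylinders_setI.
- by move=> _; exists 0%N, (fun=> setT), (fun=> setT); split => //; apply/seteqP; split.
- by rewrite bigcup_const//; exists 0%N.
- by move=> _; rewrite (le_lt_trans (probability_le1 _ _))// ltry.
Qed.

End trees.

Section product_probability.
Context d1 d2 (T1 : measurableType d1) (T2 : measurableType d2) (R : realType).
Variables (P1 : probability T1 R) (P2 : probability T2 R).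
Local Open Scope ereal_scope.

Definition pprod : probability (T1 * T2)%type R := P1 \x P2.

Lemma pprodX (A : set T1) (B : set T2) : measurable A -> measurable B ->
  pprod (A `*` B) = P1 A * P2 B.
Proof. exact: product_measure1E. Qed.

Lemma pprodE (X : set (T1 * T2)) : pprod X = \int[P1]_x P2 (xsection X x).
Proof. by []. Qed.

End product_probability.

Section tree_law.
Context (R : realType) (n : nat).
Local Notation H := (borel (hyperplane R n)).
Local Notation tree := (tree R n).
Variables (m : probability R R) (mu : probability H R) (theta : probability tree R).

Definition product_law := forall N A B,
  (forall k, measurable (A k)) -> (forall k, measurable (B k)) ->
  theta (cylinder N A B) = (\prod_(k <- nodes N) (m (A k) * mu (B k)))%E.

Definition graft (p : (R * H) * (tree * tree)) : tree :=
  (fun k => if prune_index k is Some (b, j) then (if b then p.2.2 else p.2.1).1 j else p.1.1,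
   fun k => if prune_index k is Some (b, j) then (if b then p.2.2 else p.2.1).2 j else p.1.2).

Lemma measurable_graft : measurable_fun setT graft.
Proof.
apply: measurable_fun_tree => k; rewrite /graft /=; case: (prune_index k) => [[b j]|].
- case: b.
    apply: (measurableT_comp (@measurable_tree_time R n j)).
    exact: (measurableT_comp measurable_snd measurable_snd).
  apply: (measurableT_comp (@measurable_tree_time R n j)).
  exact: (measurableT_comp measurable_fst measurable_snd).
- exact: (measurableT_comp measurable_fst measurable_fst).
- case: b.
    apply: (measurableT_comp (measurable_tree_hyperplane j)).
    exact: (measurableT_comp measurable_snd measurable_snd).
  apply: (measurableT_comp (measurable_tree_hyperplane j)).
  exact: (measurableT_comp measurable_fst measurable_snd).
- exact: (measurableT_comp measurable_snd measurable_fst).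
Qed.

Hypothesis law : product_law.

Lemma measurable_cylinder N A B :
  (forall k, measurable (A k)) -> (forall k, measurable (B k)) ->
  measurable (cylinder N A B : set tree).
Proof.
move=> mA mB; rewrite cylinders_generate; apply: sub_sigma_algebra.
by exists N, A, B.
Qed.

Lemma graft_law_cylinder N A B :
  (forall k, measurable (A k)) -> (forall k, measurable (B k)) ->
  pprod (pprod m mu) (pprod theta theta) (graft @^-1` (cylinder N.+1 A B)) = theta (cylinder N.+1 A B).
Proof.
move=> mA mB.
pose A_ b k := A (graft_index b k); pose B_ b k := B (graft_index b k).
have -> : graft @^-1` (cylinder N.+1 A B) =
    (A xH `*` B xH) `*` (cylinder N (A_ false) (B_ false) `*` cylinder N (A_ true) (B_ true)).
  apply/seteqP; split=> [[[r g] [t1 t2]] h|[[r g] [t1 t2]] [[Ar Bg] [h1 h2]] k].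
    split; first by have [] := h xH; rewrite ?inE.
    split=> k kN.
      by have := h (graft_index false k); rewrite mem_nodesS /graft/= graft_indexK; exact.
    by have := h (graft_index true k); rewrite mem_nodesS /graft/= graft_indexK; exact.
  rewrite mem_nodesS /graft /=; have := prune_indexK k.
  by case: (prune_index k) => [[[] j] <- jN|-> _//]; [exact: h2|exact: h1].
have mc b : measurable (cylinder N (A_ b) (B_ b)).
  by apply: measurable_cylinder => k; [exact: mA|exact: mB].
rewrite pprodX; [|exact: measurableX|exact: measurableX].
rewrite !pprodX//.
rewrite !law//; try by [move=> k; exact: mA|move=> k; exact: mB].
by rewrite big_cons big_cat !big_map.
Qed.

Lemma graft_law C : measurable C ->
  theta C = pprod (pprod m mu) (pprod theta theta) (graft @^-1` C).
Proof.
move=> mC; have : measurable_fun setT graft := measurable_graft.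
move=> mg; pose G := mfun_Sub (mem_set mg).
apply: (tree_measure_unique (Q := distribution (pprod (pprod m mu) (pprod theta theta)) G)) mC.
move=> _ [[|N] [A [B [mA mB ->]]]].
  rewrite (_ : cylinder 0 A B = setT) ?probability_setT//.
  by apply/seteqP; split.
by rewrite /distribution /pushforward /= graft_law_cylinder.
Qed.

End tree_law.
 

Lemma independent_systems_seq d (T : measurableType d) (R : realType)
    (P : probability T R) (I : eqType) (G : I -> set (set T)) (s : seq I) (A : I -> set T) :
  independent_systems P G -> uniq s -> (forall k, G k (A k)) ->
  P (\bigcap_(k in [set` s]) A k) = (\prod_(k <- s) P (A k))%E.
Proof.
move=> ind us GA.
have := @ind (size s) (tnth (in_tuple s)) _ (fun j => A (tnth (in_tuple s) j)) (fun j => GA _).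
rewrite (big_tnth _ _ s) => <-; last exact/tuple_uniqP.
congr (P _); apply/seteqP; split=> x /= h i.
  by move=> _; apply: h; exact: mem_tnth.
by move=> /= /(tnthP (in_tuple s))[j ->]; exact: h.
Qed.

Lemma g_sigma_algebra_bigcap_seq (T : pointedType) (G : set (set T)) (I : choiceType)
    (s : seq I) (X : I -> set T) :
  (forall k, G (X k)) -> <<s G >> (\bigcap_(k in [set` s]) X k).
Proof.
move=> GX; apply: (@fin_bigcap_measurable _ (g_sigma_algebraType G)) => //.
by move=> k _; apply: sub_sigma_algebra; exact: GX.
Qed.

Section tree_of_variables.
Context (R : realType) (n : nat).
Local Notation H := (borel (hyperplane R n)).
Variables (Lambda : set H -> \bar R) (W : set 'rV[R]_n.+1).
Context d (Omega : measurableType d) (Q : probability Omega R).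
Variables (eps : positive -> {mfun Omega >-> R}) (gam : positive -> {mfun Omega >-> H}).

Definition tree_of (w : Omega) : tree R n := (eps^~ w, gam^~ w).

Lemma measurable_tree_of : measurable_fun setT tree_of.
Proof. by apply: measurable_fun_tree => k; exact: measurable_funP. Qed.

Definition mtree_of := mfun_Sub (mem_set measurable_tree_of).

Hypothesis sv : stit_variables Lambda W Q eps gam.

Lemma tree_of_product_law :
  product_law (distribution Q (eps xH)) (distribution Q (gam xH)) (distribution Q mtree_of).
Proof.
move=> N A B mA mB.
transitivity (Q ((\bigcap_(k in [set` nodes N]) (eps k @^-1` A k)) `&`
    (\bigcap_(k in [set` nodes N]) (gam k @^-1` B k)))).
  congr (Q _); apply/seteqP; split=> [w h|w [h1 h2] k kN]; last by split; [exact: h1|exact: h2].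
  by split => k /= kN; have [] := h k kN.
have gA k : generated_sigma (eps k) (eps k @^-1` A k).
  by exists (A k) => //; rewrite setTI.
have gB k : generated_sigma (gam k) (gam k @^-1` B k).
  by exists (B k) => //; rewrite setTI.
rewrite (eps_gam_indep sv); last 2 first.
- by apply: g_sigma_algebra_bigcap_seq => k; exists k.
- by apply: g_sigma_algebra_bigcap_seq => k; exists k.
rewrite (independent_systems_seq (eps_indep sv))// ?nodes_uniq//.
rewrite (independent_systems_seq (gam_indep sv))// ?nodes_uniq//.
rewrite -big_split /=; apply: eq_bigr => k _.
congr (_ * _)%E.
  by have := eps_law sv k (mA k); rewrite /pushforward => ->; rewrite -(eps_law sv xH (mA k)).
by have := gam_law sv k (mB k); rewrite /pushforward => ->; rewrite -(gam_law sv xH (mB k)).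
Qed.

End tree_of_variables.

Section hits.
Context (R : realType) (n : nat).
Local Notation E := 'rV[R]_n.+1.
Local Notation H := (borel (hyperplane R n)).
Local Notation tree := (tree R n).
Local Notation ratv := (@ratv R n).
Implicit Types (K : set E) (t : tree) (g : positive -> hyperplane R n) (s r : R).

Definition side (b : bool) (h : hyperplane R n) := if b then far_side h else near_side h.

(* K is hit by time s when some cell is divided before s by a hyperplane meeting
   the part of K in that cell; restricting to finite sets of nodes D allows
   inductions over the generations. *)
Definition hits_in (D : set positive) K s : set tree :=
  [set t : tree | exists2 k, D k & birth t.1 k + t.1 k <= s /\
    K `&` cell setT t.2 k `&` t.2 k !=set0].

Definition hits K s := hits_in setT K s.

Lemma birth_graft p b k :
  birth (graft p).1 (graft_index b k) = p.1.1 + birth (if b then p.2.2 else p.2.1 : tree).1 k.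
Proof.
elim: k => [k IH|k IH|] /=; last by case: b => /=; rewrite add0r addr0.
  by rewrite IH -addrA /graft /= graft_indexK.
by rewrite IH -addrA /graft /= graft_indexK.
Qed.

Lemma cell_graft (p : (R * H) * (tree * tree)) b k :
  cell setT (graft p).2 (graft_index b k) =
  side b p.1.2 `&` cell setT (if b then p.2.2 else p.2.1 : tree).2 k.
Proof.
elim: k => [k IH|k IH|] /=; last by case: b => /=; rewrite setTI setIT.
  by rewrite IH -setIA /graft /= graft_indexK.
by rewrite IH -setIA /graft /= graft_indexK.
Qed.

Definition grafted (D D' : set positive) :=
  D xH /\ forall b k, D (graft_index b k) <-> D' k.

Lemma nodes_grafted N : grafted [set` nodes N.+1] [set` nodes N].
Proof.
by split=> [|b k] /=; [rewrite inE eqxx|rewrite mem_nodesS graft_indexK].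
Qed.

Lemma setT_grafted : grafted setT setT.
Proof. by []. Qed.

Lemma hits_in_graft (p : (R * H) * (tree * tree)) D D' K s : grafted D D' ->
  hits_in D K s (graft p) <->
  [\/ p.1.1 <= s /\ K `&` (p.1.2 : hyperplane R n) !=set0,
     hits_in D' (K `&` near_side p.1.2) (s - p.1.1) p.2.1 |
     hits_in D' (K `&` far_side p.1.2) (s - p.1.1) p.2.2].
Proof.
move=> [D1 DD']; split.
  move=> [k Dk [ks kK]]; move: Dk ks kK.
  have := prune_indexK k; case: (prune_index k) => [[b j] <- /DD' D'j|-> _]; last first.
    by rewrite /= add0r setIT /graft /= => ? ?; apply: Or31.
  rewrite birth_graft cell_graft setIA /graft /= graft_indexK.
  case: b => /= ks kK; [apply: Or33|apply: Or32]; exists j => //; split => //;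
  by rewrite lerBrDl addrA.
case=> [[ps pK]|[k kN [ks kK]]|[k kN [ks kK]]].
- exists xH => //.
  by rewrite /= add0r setIT.
- exists (graft_index false k); first exact/DD'.
  rewrite birth_graft cell_graft /graft /= graft_indexK setIA; split => //.
  by rewrite -addrA -lerBrDl.
- exists (graft_index true k); first exact/DD'.
  rewrite birth_graft cell_graft /graft /= graft_indexK setIA; split => //.
  by rewrite -addrA -lerBrDl.
Qed.

Lemma hits_bigcup K s : hits K s = \bigcup_N hits_in [set` nodes N] K s.
Proof.
apply/seteqP; split=> [t [k _ kK]|t [N _ [k kN kK]]]; last by exists k.
by have [N kN] := nodes_exhaust k; exists N => //; exists k.
Qed.

Lemma hits_in_set0 D s : hits_in D set0 s = set0.
Proof. by apply/seteqP; split=> // t [k _ [_ [x [[[]]]]]]. Qed.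

Lemma hits_in_nodes0 K s : hits_in [set` nodes 0] K s = set0.
Proof. by apply/seteqP; split=> // t [k]. Qed.

Lemma hits_in_nodes_nd K s : {homo (fun N => hits_in [set` nodes N] K s) : i j / (i <= j)%N >-> (i <= j)%O}.
Proof.
move=> i j ij; apply/subsetPset => t [k ki kK]; exists k => //=.
exact: nodes_leq ki.
Qed.

Lemma near_side_closed (h : hyperplane R n) : closed (near_side h).
Proof.
have [h0|/hyperplane_polar[r [u [r0 ->]]]] := pselect (carrier h 0).
  by rewrite near_side_through0//; exact: closed0.
rewrite near_sideE//; apply: (@preimage_closed _ R^o (fun x : E => dot x u) [set s | s <= r]); last exact: closed_le.
by move=> x _; exact: dot_continuous.
Qed.

Lemma far_side_closed (h : hyperplane R n) : closed (far_side h).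
Proof.
have [h0|/hyperplane_polar[r [u [r0 ->]]]] := pselect (carrier h 0).
  by rewrite far_side_through0//; exact: closed0.
rewrite far_sideE//; apply: (@preimage_closed _ R^o (fun x : E => dot x u) [set s | r <= s]); last exact: closed_ge.
by move=> x _; exact: dot_continuous.
Qed.

(* The point x is r-close to each of the half-spaces that cut out the cell k; with x
   rational, this leaves only countably many events. *)
Fixpoint touches g (k : positive) (x : E) r : Prop :=
  match k with
  | xH => True
  | xO j => touches g j x r /\ near_side (g j) `&` ball x r !=set0
  | xI j => touches g j x r /\ far_side (g j) `&` ball x r !=set0
  end.

Lemma measurable_touches k x r : measurable ([set t : tree | touches t.2 k x r] : set tree).
Proof.
have mB (B : set H) j : measurable B -> measurable ([set t : tree | B (t.2 j)] : set tree).
  by move=> mB; rewrite -[X in measurable X]setTI; exact: (measurable_tree_hyperplane j measurableT mB).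
elim: k => [k IH|k IH|] /=; last exact: measurableT.
  by apply: measurableI IH _; exact: mB (measurable_far_ball x r).
by apply: measurableI IH _; exact: mB (measurable_near_ball x r).
Qed.

Lemma touches_cell g k x y r : cell setT g k y -> ball x r y -> touches g k x r.
Proof.
by elim: k => [k IH|k IH|] //= [cy hy] xy; split; [exact: IH|exists y|exact: IH|exists y].
Qed.

Lemma limit_point_closed (C : set E) (z : nat -> E) (p : E) (q : nat -> E) :
  closed C ->
  (forall V, nbhs p V -> forall N, exists2 i, (N <= i)%N & V (z i)) ->
  (forall i, ball (q i) i.+1%:R^-1 (z i)) ->
  (forall i, C `&` ball (q i) i.+1%:R^-1 !=set0) -> C p.
Proof.
move=> cC zp qz Cq; apply: cC => V /nbhs_ballP[e /= e0 pV].
have e30 : 0 < e / 3 by exact: divr_gt0.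
have [N Ne] := @ltr_add_invr R 0 (e / 3) e30; rewrite add0r in Ne.
have [i Ni piz] := zp _ (nbhsx_ballx p (e / 3) e30) N.
have ie : i.+1%:R^-1 <= e / 3.
  by apply: le_trans (ltW Ne); rewrite lef_pV2 ?posrE// ler_nat.
have [y [Cy qy]] := Cq i; exists y; split => //; apply: pV.
rewrite (_ : e = e / 3 + (e / 3 + e / 3)); last by field.
apply: ball_triangle piz _; apply: (@ball_triangle _ _ (q i)).
  by apply: ball_sym; exact: le_ball ie _ (qz i).
exact: le_ball ie _ qy.
Qed.

Lemma touches_limit g k (z : nat -> E) (p : E) (q : nat -> E) :
  (forall V, nbhs p V -> forall N, exists2 i, (N <= i)%N & V (z i)) ->
  (forall i, ball (q i) i.+1%:R^-1 (z i)) ->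
  (forall i, touches g k (q i) i.+1%:R^-1) -> cell setT g k p.
Proof.
move=> zp qz; elim: k => [k IH|k IH|] //= tq.
  split; first by apply: IH => i; have [] := tq i.
  by apply: limit_point_closed zp qz _ => [|i]; [exact: far_side_closed|have [] := tq i].
split; first by apply: IH => i; have [] := tq i.
by apply: limit_point_closed zp qz _ => [|i]; [exact: near_side_closed|have [] := tq i].
Qed.

Lemma cell_hyperplane_meet K g j k : compact K ->
  (K `&` cell setT g k `&` g j !=set0) <->
  forall i, exists q, [/\ K `&` ball (ratv q) i.+1%:R^-1 !=set0,
    g j `&` ball (ratv q) i.+1%:R^-1 !=set0 & touches g k (ratv q) i.+1%:R^-1].
Proof.
move=> cK; split=> [[x [[Kx cx] gx]] i|/choice[q /all_and3[qK qj qk]]].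
  have [|q /ball_sym xq] := @ratv_dense _ _ x i.+1%:R^-1; first by rewrite invr_gt0.
  by exists q; split; [exists x|exists x|exact: touches_cell xq].
have /choice[z zP] := qK.
have [p Kp zp] := cluster_seq cK (fun i => (zP i).1).
exists p; split; last first.
  exact: limit_point_closed (@carrier_closed _ (g j)) zp (fun i => (zP i).2) qj.
by split => //; exact: touches_limit zp (fun i => (zP i).2) qk.
Qed.

Lemma measurable_cell_hyperplane_meet K j k : compact K ->
  measurable ([set t : tree | K `&` cell setT t.2 k `&` t.2 j !=set0] : set tree).
Proof.
move=> cK.
rewrite (_ : [set t : tree | _] = \bigcap_i \bigcup_q [set t : tree | [/\ K `&` ball (ratv q) i.+1%:R^-1 !=set0,
    (t.2 j : hyperplane R n) `&` ball (ratv q) i.+1%:R^-1 !=set0 & touches t.2 k (ratv q) i.+1%:R^-1]]); last first.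
  apply/seteqP; split=> [t /(cell_hyperplane_meet _ _ _ cK) h i _|t h].
    by have [q hq] := h i; exists q.
  by apply/(cell_hyperplane_meet _ _ _ cK) => i; have [q _ hq] := h i I; exists q.
apply: bigcapT_measurable => i; apply: countable_bigcupT_measurable => // q.
have [Kq|nKq] := pselect (K `&` ball (ratv q) i.+1%:R^-1 !=set0); last first.
  rewrite (_ : [set t : tree | _] = set0); first exact: measurable0.
  by apply/seteqP; split => // t [].
rewrite (_ : [set t : tree | _] = [set t : tree | hitting (ball (ratv q) i.+1%:R^-1) (t.2 j)] `&`
   [set t : tree | touches t.2 k (ratv q) i.+1%:R^-1]); last first.
  by apply/seteqP; split => [t []|t []]; split.
apply: measurableI; last exact: measurable_touches.
rewrite -[X in measurable X]setTI.
apply: (measurable_tree_hyperplane j measurableT).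
by apply: measurable_hitting_open; exact: ball_open.
Qed.

Lemma measurable_birth k : measurable_fun [set: tree] (fun t : tree => birth t.1 k).
Proof.
elim: k => [k IH|k IH|] /=; last exact: measurable_cst.
  by apply: measurable_funD => //; exact: measurable_tree_time.
by apply: measurable_funD => //; exact: measurable_tree_time.
Qed.

Lemma measurable_hits_in D K s : compact K -> measurable (hits_in D K s).
Proof.
move=> cK.
rewrite (_ : hits_in D K s = \bigcup_(k in D) ([set t : tree | birth t.1 k + t.1 k <= s] `&`
    [set t : tree | K `&` cell setT t.2 k `&` t.2 k !=set0])); last first.
  by apply/seteqP; split => [t [k ? []]|t [k ? []]]; exists k.
rewrite bigcup_mkcond; apply: countable_bigcupT_measurable => // k.
case: ifPn => // _; apply: measurableI; last exact: measurable_cell_hyperplane_meet.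
rewrite -[X in measurable X]setTI.
have mf : measurable_fun [set: tree] (fun t : tree => birth t.1 k + t.1 k).
  by apply: measurable_funD; [exact: measurable_birth|exact: measurable_tree_time].
have := mf measurableT `]-oo, s]%classic; rewrite (_ : _ @^-1` _ = [set t : tree | birth t.1 k + t.1 k <= s]).
  by apply; exact: measurable_itv.
by apply/seteqP; split => t /=; rewrite in_itv.
Qed.

End hits.

Section frontiers.
Context (R : realType) (n : nat).
Local Notation E := 'rV[R]_n.+1.
Local Notation H := (borel (hyperplane R n)).
Local Notation tree := (tree R n).
Implicit Types (K W : set E) (t : tree) (h : hyperplane R n) (g : positive -> hyperplane R n) (x : E).

Fixpoint ancestors (k : positive) : seq positive :=
  match k with
  | xH => [::]
  | xO j => j :: ancestors j
  | xI j => j :: ancestors j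
  end.

Lemma cell_window W g k : cell W g k = W `&` cell setT g k.
Proof. by elim: k => [k /= ->|k /= ->|/=]; rewrite ?setIA ?setIT. Qed.

Lemma cell_closed g k : closed (cell setT g k).
Proof.
elim: k => [k IH|k IH|] /=; last exact: closedT.
  by apply: closedI IH _; exact: far_side_closed.
by apply: closedI IH _; exact: near_side_closed.
Qed.

Lemma on_side b h x : carrier h x -> ~ carrier h 0 -> side b h x.
Proof.
move=> + /hyperplane_polar[r [u [r0 hE]]]; rewrite hE /= => xu.
by case: b => /=; rewrite ?far_sideE ?near_sideE//= xu.
Qed.

Lemma side_boundary b h x : carrier h x -> ~ (side b h)° x.
Proof.
have [h0|/hyperplane_polar[r [u [r0 ->]]] /= xu] := pselect (carrier h 0).
  case: b => _ /=; rewrite ?far_side_through0 ?near_side_through0//.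
    by move/interior_subset.
  by move/interior_subset.
have uP : 0 < `|direction u| by rewrite normr_gt0 sphere_neq0.
move=> /nbhs_ballP[e /= e0 xe].
pose c : R := if b then -1 else 1; pose t := c * (e / 2 / `|direction u|).
have : side b (hyperplane_of (r, u)) (x + t *: direction u).
  apply: xe; rewrite -ball_normE /= opprD addrA subrr add0r normrN normrZ.
  rewrite normrM (_ : `|c| = 1); last by rewrite /c; case: (b); rewrite ?normrN normr1.
  by rewrite mul1r ger0_norm ?divr_ge0// ?ltW// divfK ?gt_eqF//; lra.
have e1 : 0 < e / 2 / `|direction u| by rewrite !divr_gt0.
rewrite /t /c; case: (b) => /=; rewrite ?far_sideE ?near_sideE//= dotDl dotZl dot_sphere xu mulr1; lra.
Qed.

Lemma side_interior b h x : side b h x -> ~ carrier h x -> (side b h)° x.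
Proof.
have [h0|/hyperplane_polar[r [u [r0 ->]]] /=] := pselect (carrier h 0).
  by case: b => /=; rewrite ?far_side_through0 ?near_side_through0.
have dc : {in setT, continuous (fun y : E => dot y u)}.
  by move=> y _; exact: dot_continuous.
case: b => /=; rewrite ?far_sideE ?near_sideE//= => xr /eqP neq.
- have oU : open [set y : E | r < dot y u].
    apply: (@open_comp _ _ (fun y : E => dot y u) [set s | r < s]); last exact: open_gt.
    by move=> y _; exact: dot_continuous.
  apply: (filterS _ (open_nbhs_nbhs (conj oU _))) => [y /=|/=]; first exact: ltW.
  by rewrite lt_neqAle eq_sym neq.
- have oU : open [set y : E | dot y u < r].
    apply: (@open_comp _ _ (fun y : E => dot y u) [set s | s < r]); last exact: open_lt.
    by move=> y _; exact: dot_continuous.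
  apply: (filterS _ (open_nbhs_nbhs (conj oU _))) => [y /=|/=]; first exact: ltW.
  by rewrite lt_neqAle neq.
Qed.

Lemma frontier_cell W g k x : W° x ->
  frontier (cell W g k) x <-> cell setT g k x /\ exists2 j, j \in ancestors k & carrier (g j) x.
Proof.
move=> Wx; rewrite cell_window; split=> [[clx nix]|[cx [j jk gx]]].
  have cx : cell setT g k x.
    apply: (@cell_closed g k); apply: closure_subset clx; exact: subIsetr.
  split => //; apply: contrapT => /forall2NP noj; apply: nix.
  rewrite interiorI; split => //.
  have {noj} noj j : j \in ancestors k -> ~ carrier (g j) x.
    by move=> jk; have [] := noj j.
  elim: k cx noj {clx} => [k IH|k IH|] /=; last by rewrite interiorT.
    move=> [cx hx] noj; rewrite interiorI; split.
      by apply: IH => // j jk; apply: noj; rewrite inE jk orbT.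
    by apply: (@side_interior true) => //; apply: noj; rewrite inE eqxx.
  move=> [cx hx] noj; rewrite interiorI; split.
    by apply: IH => // j jk; apply: noj; rewrite inE jk orbT.
  by apply: (@side_interior false) => //; apply: noj; rewrite inE eqxx.
split; first by apply: subset_closure; split => //; exact: interior_subset.
have [b kb] : exists b, cell setT g k `<=` side b (g j).
  elim: k jk {cx} => [k IH|k IH|] //=; rewrite inE => /predU1P[->|/IH[b cb]].
  - by exists true => y [].
  - by exists b => y [/cb].
  - by exists false => y [].
  - by exists b => y [/cb].
move=> ix; apply: (@side_boundary b _ _ gx).
by apply: interiorS ix => y [_ /kb].
Qed.

Lemma cell_ancestor g j k : j \in ancestors k -> cell setT g k `<=` cell setT g j.
Proof.
elim: k => [k IH|k IH|] //=; rewrite inE => /predU1P[->|/IH kj] x [] //.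
  by move=> /kj.
by move=> /kj.
Qed.

Lemma birth_ancestor (e : positive -> R) j k : (forall i, 0 <= e i) ->
  j \in ancestors k -> birth e j + e j <= birth e k.
Proof.
move=> e0; elim: k => [k IH|k IH|] //=; rewrite inE => /predU1P[->//|/IH le].
  by rewrite (le_trans le)// lerDl.
by rewrite (le_trans le)// lerDl.
Qed.

Definition boundary_hits K a : set tree :=
  [set t | exists k, birth t.1 k <= a /\
    exists2 j, j \in ancestors k & K `&` cell setT t.2 k `&` t.2 j !=set0].

Lemma cell_boundaries_hits W K a t : K `<=` W° ->
  (cell_boundaries W t.1 t.2 a `&` K !=set0) <-> boundary_hits K a t.
Proof.
move=> KW; split=> [[x [[k ka fx] Kx]]|[k [ka [j jk [x [[Kx cx] gx]]]]]].
  have [cx [j jk gx]] := (@frontier_cell W t.2 k x (KW _ Kx)).1 fx.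
  by exists k; split => //; exists j => //; exists x.
exists x; split => //; exists k => //; apply/frontier_cell; first exact: KW.
by split => //; exists j.
Qed.

Lemma measurable_boundary_hits K a : compact K -> measurable (boundary_hits K a).
Proof.
move=> cK.
rewrite (_ : boundary_hits K a = \bigcup_k ([set t : tree | birth t.1 k <= a] `&`
   \bigcup_(j in [set` ancestors k]) [set t : tree | K `&` cell setT t.2 k `&` t.2 j !=set0])); last first.
  apply/seteqP; split=> [t [k [ka [j jk h]]]|t [k _ [ka [j jk h]]]].
    by exists k => //; split => //; exists j.
  by exists k; split => //; exists j.
apply: countable_bigcupT_measurable => // k; apply: measurableI.
  rewrite -[X in measurable X]setTI.
  have := @measurable_birth R n k measurableT `]-oo, a]%classic.
  rewrite (_ : _ @^-1` _ = [set t : tree | birth t.1 k <= a]).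
    by apply; exact: measurable_itv.
  by apply/seteqP; split => t /=; rewrite in_itv.
apply: fin_bigcup_measurable => // j _.
exact: measurable_cell_hyperplane_meet.
Qed.

(* Outside these null trees births increase along the branches, and no dividing
   hyperplane passes through 0, where both of its sides would be empty. *)
Definition irregular_trees : set tree :=
  \bigcup_k ([set t : tree | t.1 k <= 0] `|` [set t : tree | carrier (t.2 k) 0]).

Lemma boundary_hits_regular K a t : ~ irregular_trees t ->
  boundary_hits K a t <-> hits K a t.
Proof.
move=> nt.
have e0 k : 0 <= t.1 k.
  by rewrite leNgt; apply/negP => /ltW tk; apply: nt; exists k => //; left.
have g0 k : ~ carrier (t.2 k) 0 by move=> tk; apply: nt; exists k => //; right.
split=> [[k [ka [j jk [x [[Kx cx] gx]]]]]|[k _ [ka [x [[Kx cx] gx]]]]].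
  exists j => //; split; first by apply: le_trans ka; exact: birth_ancestor.
  by exists x; split => //; split => //; exact: cell_ancestor cx.
exists (xO k); split => //=; exists k; first by rewrite inE eqxx.
exists x; split => //; split => //; split => //.
exact: (@on_side false).
Qed.

Lemma measurable_irregular_trees : measurable irregular_trees.
Proof.
apply: countable_bigcupT_measurable => // k; apply: measurableU; rewrite -[X in measurable X]setTI.
  have := @measurable_tree_time R n k measurableT `]-oo, 0]%classic.
  rewrite (_ : _ @^-1` _ = [set t : tree | t.1 k <= 0]).
    by apply; exact: measurable_itv.
  by apply/seteqP; split => t /=; rewrite in_itv.
exact: (measurable_tree_hyperplane k measurableT (measurable_through 0)).
Qed.

End frontiers.

Section tree_law_marginals.
Context (R : realType) (n : nat).
Local Notation H := (borel (hyperplane R n)).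
Local Notation tree := (tree R n).
Variables (m : probability R R) (mu : probability H R) (theta : probability tree R).
Hypothesis law : product_law m mu theta.

Lemma tree_time_law k (A : set R) : measurable A ->
  theta [set t | A (t.1 k)] = m A.
Proof.
move=> mA; have [N kN] := nodes_exhaust k.
rewrite (_ : [set t | _] = cylinder N (fun j => if j == k then A else setT) (fun=> setT)); last first.
  apply/seteqP; split=> [t Akt j jN|t /(_ k kN)] /=; last by rewrite eqxx => -[].
  by split => //; case: eqP => // ->.
rewrite law//; last by move=> j; case: ifP.
rewrite (bigD1_seq k)//= ?nodes_uniq// eqxx probability_setT mule1 big1 ?mule1//.
by move=> j /negbTE ->; rewrite !probability_setT mule1.
Qed.

Lemma tree_hyperplane_law k (B : set H) : measurable B ->
  theta [set t | B (t.2 k)] = mu B.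
Proof.
move=> mB; have [N kN] := nodes_exhaust k.
rewrite (_ : [set t | _] = cylinder N (fun=> setT) (fun j => if j == k then B else setT)); last first.
  apply/seteqP; split=> [t Akt j jN|t /(_ k kN)] /=; last by rewrite eqxx => -[].
  by split => //; case: eqP => // ->.
rewrite law//; last by move=> j; case: ifP.
rewrite (bigD1_seq k)//= ?nodes_uniq// eqxx probability_setT mul1e big1 ?mule1//.
by move=> j /negbTE ->; rewrite !probability_setT mule1.
Qed.

Lemma irregular_trees_null : m [set x : R | x <= 0] = 0%E -> mu [set g : hyperplane R n | carrier g 0] = 0%E ->
  theta (@irregular_trees R n) = 0%E.
Proof.
move=> m0 mu0.
pose F k := [set t : tree | t.1 k <= 0] `|` [set t : tree | carrier (t.2 k) 0].
have F0 k : theta.-negligible (F k).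
  apply: negligibleU; apply/negligibleP.
  - have := @measurable_tree_time R n k measurableT `]-oo, 0]%classic.
    rewrite setTI (_ : _ @^-1` _ = [set t : tree | t.1 k <= 0]).
      by apply; exact: measurable_itv.
    by apply/seteqP; split => t /=; rewrite in_itv.
  - have e0 : [set x : R | x <= 0] = `]-oo, 0]%classic by apply/seteqP; split => x /=; rewrite in_itv.
    by rewrite -m0 -(@tree_time_law k [set x : R | x <= 0])// e0; exact: measurable_itv.
  - rewrite -[X in measurable X]setTI.
    exact: (measurable_tree_hyperplane k measurableT (measurable_through 0)).
  - by rewrite -mu0 -(@tree_hyperplane_law k)//; exact: measurable_through.
apply/negligibleP; first exact: measurable_irregular_trees.
rewrite (_ : @irregular_trees R n = \bigcup_i
    (if choice.unpickle i is Some k then F k else set0)).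
  apply: negligible_bigcup => i.
  by case: (choice.unpickle i : option positive) => [k|]//; exact: negligible_set0.
apply/seteqP; split=> [t [k _ tk]|t [i _]].
  by exists (choice.pickle k) => //; rewrite choice.pickleK.
by case: (choice.unpickle i : option positive) => // k tk; exists k.
Qed.

Lemma eq_mod_null (X Y N : set tree) : measurable X -> measurable Y -> measurable N ->
  theta N = 0%E -> (forall t, ~ N t -> X t <-> Y t) -> theta X = theta Y.
Proof.
move=> mX mY mN N0 XY.
have h (Z : set tree) : measurable Z -> theta Z = theta (Z `\` N).
  move=> mZ; rewrite (measureDI theta mZ mN) [X in (_ + X)%E](_ : _ = 0%E) ?adde0//.
  by apply: subset_measure0 N0 => //; exact: measurableI.
rewrite h// (h Y)//; congr (theta _); apply/seteqP; split=> t [Zt Nt]; split => //.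
  exact/XY.
exact/XY.
Qed.

End tree_law_marginals.

(** * The first division *)

Section first_split.
Context (R : realType) (n : nat).
Local Notation E := 'rV[R]_n.+1.
Local Notation H := (borel (hyperplane R n)).
Local Notation tree := (tree R n).
Implicit Types (K : set E) (s : R).
Variables (m : probability R R) (mu : probability H R) (theta : probability tree R).
Hypothesis law : product_law m mu theta.
Local Open Scope ereal_scope.

Definition survival (D : set positive) K s : \bar R := theta (~` hits_in D K s).

(* When s < p.1 the factors are taken at the negative time s - p.1, where survival
   has probability 1. *)
Definition split_survival (F : set E -> R -> \bar R) K s (p : R * H) : \bar R :=
  if `[< (p.1 <= s)%R /\ K `&` (p.2 : hyperplane R n) !=set0 >] then 0
  else F (K `&` near_side p.2) (s - p.1)%R * F (K `&` far_side p.2) (s - p.1)%R.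

Context (D D' : set positive).
Hypothesis DD' : grafted D D'.

Lemma split_survivalE K s (p : R * H) : compact K ->
  split_survival (survival D') K s p =
  (pprod theta theta \o xsection (@graft R n @^-1` (~` hits_in D K s))) p.
Proof.
move=> cK; rewrite /split_survival /=.
have mN (C : set E) s' : closed C -> measurable (~` hits_in D' (K `&` C) s').
  by move=> cC; apply: measurableC; apply: measurable_hits_in; exact: compact_closedI.
case: asboolP => [pK|npK].
  rewrite [X in pprod _ _ X](_ : _ = set0) ?measure0//.
  apply/seteqP; split => // t; rewrite /xsection /= inE /= => nh; apply: nh.
  by apply/(hits_in_graft _ _ _ DD'); exact: Or31.
have m1 := mN _ (s - p.1)%R (@near_side_closed _ _ p.2).
have m2 := mN _ (s - p.1)%R (@far_side_closed _ _ p.2).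
rewrite /survival -pprodX//.
congr (pprod _ _ _); apply/seteqP; split => [[t1 t2]|[t1 t2]]; rewrite /xsection /= inE /=.
  by move=> [h1 h2] /(hits_in_graft _ _ _ DD')[].
by move=> nh; split => h; apply: nh; apply/(hits_in_graft _ _ _ DD'); [exact: Or32|exact: Or33].
Qed.

Lemma measurable_graft_hits K s : compact K ->
  measurable (@graft R n @^-1` (~` hits_in D K s)).
Proof.
move=> cK; rewrite -[X in measurable X]setTI; apply: measurable_graft => //.
by apply: measurableC; exact: measurable_hits_in.
Qed.

Lemma survivalS K s : compact K ->
  survival D K s = \int[pprod m mu]_p split_survival (survival D') K s p.
Proof.
move=> cK; rewrite /survival (graft_law law); last first.
  by apply: measurableC; exact: measurable_hits_in.
by rewrite pprodE; apply: eq_integral => p _; rewrite split_survivalE.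
Qed.

Lemma measurable_split_survival K s : compact K ->
  measurable_fun [set: R * H] (split_survival (survival D') K s : R * H -> \bar R).
Proof.
move=> cK; rewrite (funext (fun p => split_survivalE s p cK)).
by apply: measurable_fun_xsection; exact: measurable_graft_hits.
Qed.

End first_split.

Section translated_hyperplanes.
Context (R : realType) (n : nat).
Local Notation E := 'rV[R]_n.+1.
Local Notation H := (borel (hyperplane R n)).
Implicit Types (K : set E) (g : hyperplane R n) (h x : E).

Definition translate_closed_set h (F : closed_set E) : closed_set E :=
  ClosedSet (@translate_closed R n h F (@carrier_closed _ F)).

Lemma translate_hyperplane_subproof h g : is_hyperplane (translate_closed_set h g).
Proof.
have [u [c [u0 gE]]] := hyperplaneP g.
exists u, (c + dot h u); split => //=; rewrite translateE gE.
by apply/seteqP; split => x /=; rewrite dotBl => ?; lra.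
Qed.

Definition translate_hyperplane h g : hyperplane R n :=
  Hyperplane (translate_hyperplane_subproof h g).

Lemma meets_translate (F K : set E) h :
  (translate h F `&` K !=set0) <-> (F `&` translate (- h) K !=set0).
Proof.
rewrite !translateE; split=> [[x [Fx Kx]]|[x [Fx Kx]]].
  by exists (x - h); rewrite /= opprK subrK.
by exists (x + h); rewrite /= addrK; split => //; rewrite opprK in Kx.
Qed.

Lemma translate_open h (O : set E) : open O -> open (translate h O).
Proof.
move=> oO; rewrite translateE.
by apply: (@open_comp _ _ (fun x : E => x + - h) O) => // x _; exact: add_continuous.
Qed.

Lemma translate_closed_set_continuous h : continuous (translate_closed_set h).
Proof.
have sub U : fell_subbase U -> open (translate_closed_set h @^-1` U).
  move=> [[K cK <-]|[V oV <-]]; apply: fell_subbase_open.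
    left; exists (translate (- h) K); first exact: translate_compact.
    apply/seteqP; split=> F; rewrite /avoid /preimage /= => FK; apply/eqP;
    by apply: contraPT FK => /set0P/meets_translate/set0P/eqP.
  right; exists (translate (- h) V); first exact: translate_open.
  by apply/seteqP; split=> F /= /meets_translate.
apply/continuousP => V [D' D'fin <-]; rewrite preimage_bigcup.
apply: bigcup_open => U /D'fin [s ssub <-].
rewrite preimage_bigcap openE => F FU; apply: filter_bigI => i si.
apply: open_nbhs_nbhs; split; last exact: FU.
by apply: sub; have := ssub _ si; rewrite inE.
Qed.

Lemma measurable_translate_hyperplane h :
  measurable_fun [set: H] (translate_hyperplane h : H -> H).
Proof.
apply: (@measurability _ _ H H setT (translate_hyperplane h) open erefl).
move=> _ [_ [V oV <-] <-]; rewrite setTI; apply: sub_sigma_algebra.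
exists (translate_closed_set h @^-1` V) => //.
by move/continuousP: (@translate_closed_set_continuous h); exact.
Qed.

Lemma translate_hyperplane_preimage h (A : set (hyperplane R n)) :
  translate_hyperplane h @^-1` A = translate_hyperplanes (- h) A.
Proof.
apply/seteqP; split=> [g Ag|g [g0 Ag0 gE]].
  by exists (translate_hyperplane h g) => //=; rewrite translateK.
rewrite /preimage /= (_ : translate_hyperplane h g = g0)//.
by apply: hyperplane_inj; rewrite /= gE translateNK.
Qed.

Lemma translate_hyperplane_hitting h K :
  translate_hyperplane h @^-1` hitting (translate h K) = hitting K.
Proof.
apply/seteqP; split=> g; rewrite /preimage /hitting /= => hg.
  by move/meets_translate : hg; rewrite translateK.
by apply/meets_translate; rewrite translateK.
Qed.

(* The sides are exchanged (b = true) when the translation carries g across 0. *)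
Lemma translate_sides h g : ~ carrier g 0 -> ~ carrier (translate_hyperplane h g) 0 ->
  exists b, forall b', side b' (translate_hyperplane h g) = translate h (side (b (+) b') g).
Proof.
move=> /hyperplane_polar[r [u [r0 gE]]].
have tE : carrier (translate_hyperplane h g) = [set x | dot x u = r + dot h u].
  rewrite /= translateE gE /=; by apply/seteqP; split => x /=; rewrite dotBl => ?; lra.
rewrite tE /= dot0l => /eqP; rewrite eq_sym neq_lt => /orP[neg|pos].
  exists true.
  have -> : translate_hyperplane h g = hyperplane_of (- (r + dot h u), sphereN u).
    apply: hyperplane_inj; rewrite tE; apply/seteqP; split => x /=; rewrite dotNr.
      by move=> ->.
    by move=> /oppr_inj.
  have n0 : 0 < - (r + dot h u) by rewrite oppr_gt0.
  by case; rewrite /= translateE gE ?far_sideE ?near_sideE//; apply/seteqP; split => x /=;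
    rewrite dotNr lerN2 dotBl ?lerBlDr ?lerBrDr.
exists false.
have -> : translate_hyperplane h g = hyperplane_of (r + dot h u, u).
  by apply: hyperplane_inj; rewrite tE.
by case; rewrite /= translateE gE ?far_sideE ?near_sideE//; apply/seteqP; split => x /=;
    rewrite dotBl ?lerBlDr ?lerBrDr.
Qed.

Lemma translateI h (A B : set E) : translate h (A `&` B) = translate h A `&` translate h B.
Proof. by rewrite !translateE. Qed.

End translated_hyperplanes.

Section translated_laws.
Context (R : realType) (n : nat).
Local Notation E := 'rV[R]_n.+1.
Local Notation H := (borel (hyperplane R n)).
Local Notation tree := (tree R n).
Variables (m : probability R R) (mu : probability H R) (theta : probability tree R).
Variables (m' : probability R R) (mu' : probability H R) (theta' : probability tree R).
Hypotheses (law : product_law m mu theta) (law' : product_law m' mu' theta').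
Variable h : E.
Hypothesis mm' : forall A, measurable A -> m' A = m A.
Hypothesis mumu' : forall B, measurable B -> mu' B = mu (translate_hyperplane h @^-1` B).
Hypothesis mu0 : forall x : E, mu [set g : hyperplane R n | carrier g x] = 0%E.
Local Open Scope ereal_scope.

Let phi (p : R * H) : R * H := (p.1, translate_hyperplane h p.2).

Let mphi : measurable_fun [set: R * H] phi.
Proof.
apply: measurable_fun_pair; first exact: measurable_fst.
exact: measurableT_comp (measurable_translate_hyperplane h) measurable_snd.
Qed.

Lemma pprod_translate (X : set (R * H)) : measurable X ->
  pprod m' mu' X = pushforward (pprod m mu) phi X.
Proof.
move=> mX; pose f := mfun_Sub (mem_set mphi).
apply: (@product_measure_unique _ _ _ _ _ m' mu' (distribution (pprod m mu) f)) mX => A B mA mB.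
rewrite /distribution /pushforward /=.
rewrite (_ : phi @^-1` (A `*` B) = A `*` (translate_hyperplane h @^-1` B))//.
rewrite mm'// mumu'// -pprodX//.
by rewrite -[X in measurable X]setTI; exact: measurable_translate_hyperplane.
Qed.

Lemma split_survival_ge0 (t : probability tree R) D K s p :
  0 <= split_survival (survival t D) K s p.
Proof. by rewrite /split_survival; case: asboolP => // _; rewrite mule_ge0. Qed.

Lemma survival_translate N (K : set E) s : compact K ->
  survival theta' [set` nodes N] (translate h K) s =
  survival theta [set` nodes N] K s.
Proof.
elim: N K s => [|N IH] K s cK; first by rewrite /survival !hits_in_nodes0 setC0 !probability_setT.
have cTK : compact (translate h K) by exact: translate_compact.
rewrite (survivalS law' (nodes_grafted N))// (survivalS law (nodes_grafted N))//.
rewrite (eq_measure_integral (pushforward (pprod m mu) phi)); last first.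
  by move=> X mX _; exact: pprod_translate.
rewrite ge0_integral_pushforward//; last 2 first.
- exact: (measurable_split_survival _ (nodes_grafted N)).
- by move=> p _; exact: split_survival_ge0.
rewrite preimage_setT; apply: ae_eq_integral => //.
- apply: measurableT_comp => //; exact: (measurable_split_survival _ (nodes_grafted N)).
- exact: (measurable_split_survival _ (nodes_grafted N)).
pose Z : set H := [set g : hyperplane R n | carrier g 0%R] `|` [set g : hyperplane R n | carrier g (- h)%R].
have mZ : measurable Z by apply: measurableU; exact: measurable_through.
exists (setT `*` Z); split.
- exact: measurableX.
- rewrite [LHS](pprodX m mu measurableT mZ) (_ : mu Z = 0) ?mule0//.
  apply/eqP; rewrite eq_le measure_ge0 andbT.
  apply: le_trans (measureU2 _ _ _) _; [exact: measurable_through|exact: measurable_through|].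
  by rewrite [X in X + _](mu0 0%R) [X in _ + X](mu0 (- h)%R) adde0.
move=> [r g] /= /not_implyP[_ neq]; split => //; apply: contrapT => nZ; apply: neq.
have g0 : ~ carrier g 0%R by move=> ?; apply: nZ; left.
have gh : ~ carrier (translate_hyperplane h g) 0%R.
  by rewrite /= translateE /= sub0r => ?; apply: nZ; right.
rewrite /split_survival /phi /=.
have hitE' : ((r <= s)%R /\ translate h K `&` translate h g !=set0) <-> ((r <= s)%R /\ K `&` g !=set0).
  by split=> -[rs]; [move/meets_translate; rewrite translateK|
   move=> Kg; split => //; apply/meets_translate; rewrite translateK].
rewrite (asbool_equiv_eq hitE'); case: ifP => // _.
have [b bE] := translate_sides g0 gh.
have := bE false; have := bE true; rewrite /side => -> ->.
have nc : compact (K `&` near_side g) by apply: compact_closedI => //; exact: near_side_closed.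
have fc : compact (K `&` far_side g) by apply: compact_closedI => //; exact: far_side_closed.
case: b {bE} => /=; rewrite -!translateI !IH//.
by rewrite muleC.
Qed.

Lemma hits_translate (K : set E) s : compact K ->
  theta' (hits (translate h K) s) = theta (hits K s).
Proof.
move=> cK; have cTK : compact (translate h K) by exact: translate_compact.
have c1 := @nondecreasing_cvg_mu _ _ _ theta (fun N => hits_in [set` nodes N] K s)
  (fun N => measurable_hits_in _ _ cK) (bigcupT_measurable _ (fun N => measurable_hits_in _ _ cK)) (@hits_in_nodes_nd _ _ _ _).
have c2 := @nondecreasing_cvg_mu _ _ _ theta' (fun N => hits_in [set` nodes N] (translate h K) s)
  (fun N => measurable_hits_in _ _ cTK) (bigcupT_measurable _ (fun N => measurable_hits_in _ _ cTK)) (@hits_in_nodes_nd _ _ _ _).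
rewrite !hits_bigcup -(cvg_lim _ c1)// -(cvg_lim _ c2)//.
congr (lim (_ @ \oo)); apply/funext => N /=.
have e (t : probability tree R) K' : compact K' -> t (hits_in [set` nodes N] K' s) = 1 - survival t [set` nodes N] K' s.
  move=> cK'; rewrite /survival -probability_setC; last by apply: measurableC; exact: measurable_hits_in.
  by rewrite setCK.
by rewrite !e// survival_translate.
Qed.

End translated_laws.

Section exponential_law.
Context (R : realType) (m : probability R R) (lam : R).
Hypothesis m_exp : forall A : set R, measurable A -> m A = exponential_prob lam A.

Lemma exponential_lt0 : m `]-oo, 0[%classic = 0%E.
Proof.
rewrite m_exp; last exact: measurable_itv.
apply: integral0_eq => x /=; rewrite in_itv /= => x0.
by rewrite lt0_exponential_pdf.
Qed.

Lemma exponential_le0 : m `]-oo, 0]%classic = 0%E.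
Proof.
rewrite (_ : `]-oo, 0]%classic = `]-oo, 0[%classic `|` [set 0]); last first.
  apply/seteqP; split=> x /=; rewrite !in_itv /= le_eqVlt.
    by move=> /predU1P[->|]; [right|left].
  by move=> [->|->]; rewrite ?eqxx ?orbT.
rewrite measureU//; last first.
  by apply/seteqP; split=> // x [/= + x0]; rewrite in_itv /= x0 ltxx.
rewrite -[X in _ = X]adde0; congr (_ + _)%E; first exact: exponential_lt0.
by apply: etrans (m_exp _) _ => //; rewrite /exponential_prob integral_set1.
Qed.

Lemma exponential_tail x : 0 <= x -> m `]x, +oo[%classic = (expR (- lam * x))%:E.
Proof.
move=> x0.
have -> : `]x, +oo[%classic = ~` `]-oo, x]%classic :> set R.
  by apply/seteqP; split => y /=; rewrite !in_itv /= andbT ltNge => /negP.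
rewrite probability_setC; last exact: measurable_itv.
have [->|xn0] := eqVneq x 0.
  by rewrite exponential_le0 mulr0 expR0 sube0.
have x1 : 0 < x by rewrite lt_neqAle eq_sym xn0.
have -> : `]-oo, x]%classic = `]-oo, 0[%classic `|` `[0, x]%classic :> set R.
  apply/seteqP; split => y /=; rewrite !in_itv /=.
    by move=> yx; have [y0|y0] := ltP y 0; [left|right; rewrite yx].
  by move=> [y0|/andP[]//]; rewrite ltW// (lt_trans y0).
have -> : m (`]-oo, 0[%classic `|` `[0, x]%classic) = m `[0, x]%classic.
  rewrite measureU//; last first.
    by apply/seteqP; split=> // y /=; rewrite !in_itv /= => -[y0 /andP[]]; rewrite leNgt y0.
  by rewrite -[RHS]add0e; congr (_ + _)%E; exact: exponential_lt0.
rewrite m_exp; last exact: measurable_itv.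
by rewrite exponential_prob_itv0c// oppeB// addeA subee// add0e.
Qed.

Lemma exponential_memoryless eta (A : set R) : 0 <= eta -> measurable A ->
  A `<=` `]0, +oo[%classic ->
  m ((fun t => t - eta) @^-1` A) = ((expR (- lam * eta))%:E * m A)%E.
Proof.
move=> eta0 mA A0.
have mf : measurable_fun [set: R] (fun t : R => t - eta).
  by apply: measurable_funB => //; exact: measurable_cst.
pose f := mfun_Sub (mem_set mf).
have mD : measurable (`]0, +oo[%classic : set R) by exact: measurable_itv.
pose c : {nonneg R} := NngNum (expR_ge0 (- lam * eta)).
pose m1 : {measure set R -> \bar R} := mrestr (distribution m f) mD.
pose m2 : {measure set R -> \bar R} := mscale c (mrestr m mD).
suff : m1 A = m2 A.
  by rewrite /m1 /m2 /= /mscale /= /mrestr /= (setIidl A0) /distribution /pushforward.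
have gE x : (0 <= x) -> (fun t => t - eta) @^-1` `]x, +oo[ = `]x + eta, +oo[%classic.
  by move=> x0; apply/seteqP; split=> t /=; rewrite !in_itv /= !andbT ltrBrDr.
have rE x : `]x, +oo[%classic `&` `]0, +oo[%classic = `]Num.max x 0, +oo[%classic :> set R.
  by apply/seteqP; split=> t /=; rewrite !in_itv /= !andbT gt_max => /andP.
pose rays k : set R := `]- k%:R, +oo[%classic.
apply: (measure_unique (@RGenOInfty.G R) rays) mA => //.
- exact: RGenOInfty.measurableE.
- move=> _ _ [x ->] [y ->]; exists (Num.max x y).
  by apply/seteqP; split=> t /=; rewrite !in_itv /= !andbT gt_max => /andP.
- by move=> k; exists (- k%:R).
- apply/seteqP; split=> // t _; have [k _ kt] := nbhs_infty_ger (- t + 1).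
  by exists k => //; rewrite /rays /= in_itv /= andbT; have := kt k (leqnn k); lra.
- move=> _ [x ->]; rewrite /m1 /m2 /= /mscale /= /mrestr /distribution /pushforward /= rE.
  have max0 : 0 <= Num.max x 0 by rewrite le_max lexx orbT.
  rewrite gE// !exponential_tail// ?addr_ge0// -EFinM -expRD; congr (expR _)%:E.
  by ring.
- move=> k; rewrite /m1 /= /mrestr (le_lt_trans (probability_le1 _ _))// ?ltry//.
  by apply: measurableI => //; exact: measurable_itv.
Qed.

End exponential_law.

Section first_split_time.
Context (R : realType) (n : nat).
Local Notation E := 'rV[R]_n.+1.
Local Notation H := (borel (hyperplane R n)).
Local Notation tree := (tree R n).
Implicit Types (K : set E) (s u eta : R).
Variables (m : probability R R) (mu : probability H R) (theta : probability tree R).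
Variable lam : R.
Hypothesis law : product_law m mu theta.
Hypothesis m_exp : forall A : set R, measurable A -> m A = exponential_prob lam A.
Hypothesis mu0 : mu [set g : hyperplane R n | carrier g 0] = 0%E.
Local Open Scope ereal_scope.

Definition avoidance K s : \bar R := survival theta setT K s.

Definition split_avoidance K u : \bar R :=
  \int[mu]_g split_survival avoidance K u (0%R, g).

Lemma avoidance_ge0 K s : 0 <= avoidance K s.
Proof. exact: measure_ge0. Qed.

Lemma avoidance_le1 K s : compact K -> avoidance K s <= 1.
Proof.
by move=> cK; apply: probability_le1; apply: measurableC; exact: measurable_hits_in.
Qed.

Lemma avoidance_nonincreasing K s s' : compact K -> (s <= s')%R ->
  avoidance K s' <= avoidance K s.
Proof.
move=> cK ss'; apply: le_measure; rewrite ?inE; try by apply: measurableC; exact: measurable_hits_in.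
by move=> t ns' [k _ [ks hk]]; apply: ns'; exists k => //; split => //; exact: le_trans ss'.
Qed.

Lemma avoidance_le0 K s : compact K -> (s <= 0)%R -> avoidance K s = 1.
Proof.
move=> cK s0; rewrite -(@probability_setT _ _ _ theta).
apply: (@eq_mod_null _ _ theta _ _ (@irregular_trees R n)) => //.
- by apply: measurableC; exact: measurable_hits_in.
- exact: measurable_irregular_trees.
- apply: irregular_trees_null law _ mu0.
  rewrite (_ : [set x : R | (x <= 0)%R] = `]-oo, 0%R]%classic).
    exact: (exponential_le0 m_exp).
  by apply/seteqP; split => x /=; rewrite in_itv.
move=> t nt; split => // _ [k _ [ks _]]; apply: nt.
have [tk|tk] := leP (t.1 k) 0%R; first by exists k => //; left.
have [bk|bk] := leP 0%R (birth t.1 k).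
  by have := le_trans ks s0; rewrite leNgt ltr_wpDl.
suff [j tj] : exists j, (t.1 j < 0)%R by exists j => //; left; exact: ltW.
elim: k bk {ks tk} => [k IH|k IH|] /=; last by rewrite ltxx.
  have [/IH//|bk] := ltP (birth t.1 k) 0%R.
  move=> bt; exists k; rewrite ltNge; apply/negP => tk.
  by move: bt; rewrite ltNge addr_ge0.
have [/IH//|bk] := ltP (birth t.1 k) 0%R.
move=> bt; exists k; rewrite ltNge; apply/negP => tk.
by move: bt; rewrite ltNge addr_ge0.
Qed.

Lemma avoidance0 s : avoidance set0 s = 1.
Proof. by rewrite /avoidance /survival hits_in_set0 setC0 probability_setT. Qed.

Lemma split_survival_shift K s t g :
  split_survival avoidance K s (t, g) = split_survival avoidance K (s - t)%R (0%R, g).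
Proof. by rewrite /split_survival /= subr0 subr_ge0. Qed.

Lemma avoidance_integral K s : compact K ->
  avoidance K s = \int[m]_t split_avoidance K (s - t)%R.
Proof.
move=> cK; rewrite /avoidance (survivalS law setT_grafted)//.
rewrite (@fubini_tonelli1 _ _ _ _ _ m mu); last 2 first.
- exact: (measurable_split_survival _ setT_grafted).
- by move=> p; exact: split_survival_ge0.
apply: eq_integral => t _; apply: eq_integral => g _.
by rewrite -split_survival_shift.
Qed.

Lemma split_le1 K u p : compact K -> split_survival avoidance K u p <= 1.
Proof.
move=> cK; rewrite /split_survival; case: ifP => // _.
rewrite -[leRHS]mule1; apply: lee_pmul; rewrite ?avoidance_ge0//; apply: avoidance_le1.
  by apply: compact_closedI => //; exact: near_side_closed.
by apply: compact_closedI => //; exact: far_side_closed.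
Qed.

Lemma split_nonincreasing K s s' g : compact K -> (s <= s')%R ->
  split_survival avoidance K s' (0%R, g) <= split_survival avoidance K s (0%R, g).
Proof.
move=> cK ss'; have nc : compact (K `&` near_side g) by apply: compact_closedI => //; exact: near_side_closed.
have fc : compact (K `&` far_side g) by apply: compact_closedI => //; exact: far_side_closed.
rewrite /split_survival /= !subr0; case: ifPn => [_|ns'].
  by case: ifP => // _; rewrite mule_ge0 ?avoidance_ge0.
rewrite ifN; last first.
  apply: contra ns' => /asboolP[s0 Kg]; apply/asboolP; split => //; exact: le_trans ss'.
by apply: lee_pmul; rewrite ?avoidance_ge0// avoidance_nonincreasing.
Qed.

Lemma measurable_split_mark K u : compact K ->
  measurable_fun [set: H] (fun g : H => split_survival avoidance K u (0%R, g)).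
Proof.
move=> cK; apply: (measurableT_comp (measurable_split_survival theta setT_grafted u cK)).
by apply: measurable_fun_pair => //; exact: measurable_cst.
Qed.

Lemma split_avoidance_ge0 K u : 0 <= split_avoidance K u.
Proof. by apply: integral_ge0 => g _; exact: split_survival_ge0. Qed.

Lemma split_avoidance_le1 K u : compact K -> split_avoidance K u <= 1.
Proof.
move=> cK; rewrite -(mule1 1) -[X in _ * X](@probability_setT _ _ _ mu) -integral_cst//.
apply: ge0_le_integral => //.
- by move=> g _; exact: split_survival_ge0.
- exact: measurable_split_mark.
- by move=> g _; exact: split_le1.
Qed.

Lemma split_avoidance_nonincreasing K s s' : compact K -> (s <= s')%R ->
  split_avoidance K s' <= split_avoidance K s.
Proof.
move=> cK ss'; apply: ge0_le_integral => //.
- by move=> g _; exact: split_survival_ge0.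
- exact: measurable_split_mark.
- exact: measurable_split_mark.
- by move=> g _; exact: split_nonincreasing.
Qed.

Lemma measurable_split_avoidance K s : compact K ->
  measurable_fun [set: R] (fun t => split_avoidance K (s - t)%R).
Proof.
move=> cK; have := @measurable_fun_fubini_tonelli_F _ _ _ _ _ mu
  (split_survival avoidance K s) (measurable_split_survival theta setT_grafted s cK).
rewrite /fubini_F /= (_ : (fun _ => _) = (fun t => split_avoidance K (s - t)%R)).
  by apply => p; exact: split_survival_ge0.
by apply/funext => t; apply: eq_integral => g _; rewrite -split_survival_shift.
Qed.

Let pos : set R := `]0%R, +oo[%classic.

Let mpos : measurable pos. Proof. exact: measurable_itv. Qed.

Lemma integral_pos (f : R -> \bar R) (D : set R) : measurable D -> (forall t, 0 <= f t) ->
  measurable_fun [set: R] f -> \int[m]_(t in D) f t = \int[m]_(t in D `&` pos) f t.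
Proof.
move=> mD f0 mf.
have mDp : measurable (D `&` pos) by exact: measurableI.
have mDn : measurable (D `\` pos) by exact: measurableD.
rewrite -[in LHS](setUIDK D pos) ge0_integral_setU//.
- rewrite [X in _ + X]null_set_integral ?adde0//.
    exact: measurable_funTS.
  apply/eqP; rewrite eq_le measure_ge0 andbT -(exponential_le0 m_exp).
  by apply: le_measure; rewrite ?inE// => t [_ /negP]; rewrite /pos /= !in_itv /= andbT -leNgt.
- exact: measurable_funTS.
- by apply/disj_setPS => t [[_ ?] []].
Qed.

Lemma avoidance_step K s eta : compact K -> (0 <= eta)%R ->
  let q := (1 - expR (- lam * eta))%R in
  (1 - q)%:E * avoidance K s + q%:E * split_avoidance K (s + eta)%R <= avoidance K (s + eta)%R
  /\ avoidance K (s + eta)%R <= (1 - q)%:E * avoidance K s + q%:E * split_avoidance K s.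
Proof.
move=> cK eta0 q.
have qE : (1 - q = expR (- lam * eta))%R by rewrite /q; ring.
pose late : set R := `]eta, +oo[%classic.
have mlate : measurable late by exact: measurable_itv.
have lateE : late = (fun t => t - eta)%R @^-1` pos.
  by apply/seteqP; split=> t /=; rewrite /late /pos /= !in_itv /= !andbT subr_gt0.
have mlateE : m late = (1 - q)%:E by rewrite qE; exact: (exponential_tail m_exp).
have m0eta : m (~` late `&` pos) = q%:E.
  have mp1 : m pos = 1.
    have := exponential_tail m_exp (lexx 0%R).
    by rewrite mulr0 expR0.
  have lp : pos `&` late = late.
    apply/setIidr => t; rewrite /late /pos /= !in_itv /= !andbT; exact: le_lt_trans.
  have := measureDI m mpos mlate; rewrite lp [X in X = _]mp1 [X in _ = _ + X]mlateE.
  rewrite setDE setIC => e1.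
  have : m (~` late `&` pos) \is a fin_num.
    by apply: fin_num_measure; apply: measurableI => //; exact: measurableC.
  move=> fin; have e2 : m (~` late `&` pos) + (1 - q)%:E = 1 by rewrite -e1.
  rewrite -(fineK fin) -EFinD in e2; rewrite -(fineK fin); congr EFin.
  by move: e2 => -[e2]; apply: (@addIr _ (1 - q)%R); rewrite e2 addrC subrK.
have int_late : \int[m]_(t in late) split_avoidance K (s + eta - t)%R = (1 - q)%:E * avoidance K s.
  have mshift : measurable_fun [set: R] (fun t : R => t - eta)%R.
    by apply: measurable_funB => //; exact: measurable_cst.
  transitivity (\int[pushforward m (fun t : R => t - eta)%R]_(y in pos) split_avoidance K (s - y)%R).
    have mg : measurable_fun pos (fun y => split_avoidance K (s - y)%R).
      by apply: measurable_funTS; exact: measurable_split_avoidance.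
    have g0 : {in pos, forall y : R, 0 <= split_avoidance K (s - y)%R}.
      by move=> y _; exact: split_avoidance_ge0.
    rewrite (ge0_integral_pushforward mshift m mpos mg g0) -lateE.
    by apply: eq_integral => t _ /=; rewrite (_ : s - (t - eta) = s + eta - t)%R//; ring.
  rewrite (eq_measure_integral (mscale (NngNum (expR_ge0 (- lam * eta))) m)); last first.
    by move=> A mA /(exponential_memoryless m_exp eta0 mA).
  rewrite ge0_integral_mscale//; last 2 first.
  - by apply: measurable_funTS; exact: measurable_split_avoidance.
  - by move=> y _; exact: split_avoidance_ge0.
  rewrite /= qE avoidance_integral// [in RHS]integral_pos ?setTI//.
    by move=> t; exact: split_avoidance_ge0.
  exact: measurable_split_avoidance.
have mf := measurable_split_avoidance (s + eta)%R cK.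
have split_int : avoidance K (s + eta)%R = (1 - q)%:E * avoidance K s +
    \int[m]_(t in ~` late `&` pos) split_avoidance K (s + eta - t)%R.
  rewrite avoidance_integral// -int_late -(setUv late) ge0_integral_setU//.
  - congr (_ + _); apply: integral_pos => //; first exact: measurableC.
    by move=> t; exact: split_avoidance_ge0.
  - exact: measurableC.
  - by rewrite setUv.
  - by move=> t _; exact: split_avoidance_ge0.
  - by apply/disj_setPS => t [].
have mI : measurable (~` late `&` pos) by apply: measurableI => //; exact: measurableC.
have tI t : (~` late `&` pos) t -> (0 <= t <= eta)%R.
  by move=> [/negP]; rewrite /late /pos /= !in_itv /= !andbT -leNgt => -> /ltW ->.
have qI c : q%:E * c = \int[m]_(t in ~` late `&` pos) (cst c) t.
  by rewrite integral_cst// muleC; congr (_ * _); exact: (esym m0eta).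
rewrite split_int !qI; split; apply: leeD2l.
  apply: ge0_le_integral => //.
  - by move=> t _; exact: split_avoidance_ge0.
  - exact: measurable_funTS.
  - move=> t /tI/andP[t0 te]; apply: split_avoidance_nonincreasing => //.
    by rewrite lerBlDr lerDl.
apply: ge0_le_integral => //.
- by move=> t _; exact: split_avoidance_ge0.
- exact: measurable_funTS.
- move=> t /tI/andP[t0 te]; apply: split_avoidance_nonincreasing => //.
  by rewrite lerBrDr lerD2l.
Qed.

End first_split_time.

(** * Mixing for compact sets *)

(* fK, fL, fM are the avoidance probabilities of K, L and of their union at the
   times i * eta, q is the probability that the first division occurs before eta,
   and muR, muS, muH are the probabilities that its hyperplane leaves the two boxes
   on the same side, separates them, or meets one of them. *)
Lemma euler_mixing (R : realFieldType) (fK fL fM : nat -> R) (q muR muS muH : R) :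
  0 <= q <= 1 / 2 -> 0 <= muR -> 0 < muS -> 0 <= muH -> muR + muS + muH = 1 ->
  (forall i, 0 <= fK i <= 1) -> (forall i, 0 <= fL i <= 1) -> (forall i, 0 <= fM i <= 1) ->
  fK 0%N = 1 -> fL 0%N = 1 -> fM 0%N = 1 ->
  (forall i, fK i.+1 <= fK i) -> (forall i, fL i.+1 <= fL i) ->
  (forall i, (1 - q) * fK i + q * ((1 - muH) * fK i.+1) <= fK i.+1) ->
  (forall i, (1 - q) * fL i + q * ((1 - muH) * fL i.+1) <= fL i.+1) ->
  (forall i, fM i.+1 <= (1 - q) * fM i + q * (muR * fM i + muS * (fK i * fL i) + muH)) ->
  (forall i, (1 - q) * fM i + q * (muR * fM i.+1 + muS * (fK i.+1 * fL i.+1)) <= fM i.+1) ->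
  forall i, `|fM i - fK i * fL i| <= 6 * (muH / muS).
Proof.
move=> q01 muR0 muS0 muH0 mu1 bK bL bM K0 L0 M0 dK dL stepK stepL stepU stepD.
set x := muH / muS.
have x0 : 0 <= x by rewrite divr_ge0// ltW.
have xS : muS * x = muH by rewrite /x mulrCA divff ?mulr1// gt_eqF.
have incr f i : (forall j, 0 <= f j <= 1) -> (forall j, f j.+1 <= f j) ->
    (1 - q) * f i + q * ((1 - muH) * f i.+1) <= f i.+1 -> f i - f i.+1 <= 2 * (q * muH).
  move=> bf df st; have b1 := bf i; have b2 := bf i.+1; have d1 := df i.
  have qm : 0 <= q * muH by apply: mulr_ge0 => //; lra.
  have h1 : (1 - q) * (f i - f i.+1) <= q * muH * f i.+1 by lra.
  have h2 : q * muH * f i.+1 <= q * muH by rewrite ler_piMr//; lra.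
  have h3 : (1 / 2) * (f i - f i.+1) <= (1 - q) * (f i - f i.+1) by apply: ler_wpM2r; lra.
  lra.
elim=> [|i]; first by rewrite K0 L0 M0 mulr1 subrr normr0 mulr_ge0.
rewrite !ler_norml => /andP[lo up].
have [dKi dLi] : fK i - fK i.+1 <= 2 * (q * muH) /\ fL i - fL i.+1 <= 2 * (q * muH).
  by split; apply: incr.
have [k01 l01 m01] := And3 (bK i) (bL i) (bM i).
have [k01' l01' m01'] := And3 (bK i.+1) (bL i.+1) (bM i.+1).
have dk := dK i; have dl := dL i; have qm : 0 <= q * muH by apply: mulr_ge0 => //; lra.
have GG : fK i * fL i - fK i.+1 * fL i.+1 <= 4 * (q * muH).
  rewrite (_ : _ - _ = (fK i - fK i.+1) * fL i + fK i.+1 * (fL i - fL i.+1)); last by ring.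
  have : (fK i - fK i.+1) * fL i <= fK i - fK i.+1 by rewrite ler_piMr//; lra.
  have : fK i.+1 * (fL i - fL i.+1) <= fL i - fL i.+1 by rewrite ler_piMl//; lra.
  lra.
have GG' : fK i.+1 * fL i.+1 <= fK i * fL i by apply: ler_pM; lra.
have G0 : 0 <= fK i * fL i by apply: mulr_ge0; lra.
have G1 : fK i.+1 * fL i.+1 <= 1 by apply: mulr_ile1; lra.
have G0' : 0 <= fK i.+1 * fL i.+1 by apply: mulr_ge0; lra.
have muRE : muR = 1 - muS - muH by lra.
have qH : q * muH = q * (muS * x) by rewrite xS.
have qHx : 0 <= q * (muH * x) by apply: mulr_ge0; [lra|exact: mulr_ge0].
have sU := stepU i; have sD := stepD i.
move: lo up sU sD GG GG' G0 G1 G0'; set G := fK i * fL i; set G' := fK i.+1 * fL i.+1.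
set M := fM i; set M' := fM i.+1 => lo up sU sD GG GG' G0 G1 G0'.
have qS0 : 0 <= q * muS by apply: mulr_ge0; lra.
have qHG : 0 <= q * muH * G by apply: mulr_ge0.
have qHG' : q * muH * G' <= q * muH by rewrite ler_piMr.
have c0 : 0 <= 1 - q * (muS + muH).
  have S0 : 0 <= muS + muH by rewrite addr_ge0// ltW.
  have S1 : muS + muH <= 1 by rewrite -mu1 -addrA lerDr.
  have q0 : 0 <= q by case/andP: q01.
  have q1 : q <= 1 by lra.
  by rewrite subr_ge0 mulr_ile1.
have c1 : 0 < 1 - q * muR.
  have : q * muR <= q * 1 by apply: ler_wpM2l; lra.
  lra.
apply/andP; split; last first.
  have h1 : (1 - q * (muS + muH)) * (M - G) <= (1 - q * (muS + muH)) * (6 * x).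
    exact: ler_wpM2l.
  move: sU; rewrite muRE => sU; nra.
have h1 : (1 - q) * (- (6 * x)) <= (1 - q) * (M - G) by apply: ler_wpM2l; lra.
rewrite -(ler_pM2l c1).
have h2 : (1 - q) * G' <= (1 - q) * G by apply: ler_wpM2l; lra.
move: sD c1; rewrite muRE => sD c1; nra.
Qed.

Section box_sides.
Context (R : realType) (n : nat).
Local Notation E := 'rV[R]_n.+1.
Implicit Types (g : hyperplane R n) (K : set E) (rho : R) (h : E).

Lemma box_center x rho : 0 <= rho -> box x rho (x : E).
Proof. by rewrite /box /= subrr normr0. Qed.

Lemma sub_side_near g K : (forall x, K x -> near_side g x /\ ~ far_side g x) ->
  K `&` near_side g = K /\ K `&` far_side g = set0.
Proof.
move=> Kg; split; apply/seteqP; split => // x.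
- by move=> Kx; split => //; have [] := Kg _ Kx.
- by move=> [Kx fx]; have [_] := Kg _ Kx; exact.
Qed.

Lemma sub_side_far g K : (forall x, K x -> far_side g x /\ ~ near_side g x) ->
  K `&` near_side g = set0 /\ K `&` far_side g = K.
Proof.
move=> Kg; split; apply/seteqP; split => // x.
- by move=> [Kx fx]; have [_] := Kg _ Kx; exact.
- by move=> Kx; split => //; have [] := Kg _ Kx.
Qed.

Lemma box0_sides g K rho : 0 <= rho -> K `<=` box 0 rho -> ~ hitting (box 0 rho) g ->
  K `&` near_side g = K /\ K `&` far_side g = set0.
Proof.
move=> rho0 KB ng; have g0 : ~ carrier g 0.
  by move=> g0; apply: ng; exists 0; split => //; exact: box_center.
apply: sub_side_near => x /KB Bx.
have nf : ~ far_side g x.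
  move=> /far_side_seg[[z [gz zs]] _]; apply: ng; exists z; split => //.
  exact: seg_box zs.
by split => //; apply/near_side_seg; split => //; left.
Qed.

Lemma boxh_sides g K h rho : 0 <= rho -> K `<=` box h rho -> ~ carrier g 0 ->
  ~ hitting (box h rho) g ->
  (hitting (seg 0 h) g -> K `&` near_side g = set0 /\ K `&` far_side g = K) /\
  (~ hitting (seg 0 h) g -> K `&` near_side g = K /\ K `&` far_side g = set0).
Proof.
move=> rho0 KB /[dup] g0 /hyperplane_polar[r [u [r0 gE]]] ng.
have nbox y : box h rho y -> dot y u <> r.
  by move=> By yu; apply: ng; exists y; split => //; rewrite gE.
have hB := box_center h rho0.
split=> [hs|nhs].
  have rh : r < dot h u.
    have : far_side g h by apply/far_side_seg.
    by rewrite gE far_sideE// /= le_eqVlt => /predU1P[/esym/(nbox _ hB)|].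
  apply: sub_side_far => y /KB By.
  have ry : r < dot y u.
    rewrite ltNge; apply/negP => yr.
    have [||z zs zr] := @seg_cross _ _ h y (- direction u) (- r); rewrite ?dotNr ?lerN2// ?ltW//.
    apply: (nbox z); first exact: seg_box zs.
    by apply: oppr_inj; rewrite -dotNr.
  by rewrite gE far_sideE// near_sideE//=; split; [exact: ltW|apply/negP; rewrite -ltNge].
have rh : dot h u < r.
  rewrite ltNge; apply/negP => rh; apply: nhs.
  have /far_side_seg[//] : far_side g h by rewrite gE far_sideE.
apply: sub_side_near => y /KB By.
have ry : dot y u < r.
  rewrite ltNge; apply/negP => yr.
  have [||z zs zr] := @seg_cross _ _ h y (direction u) r => //; first exact: ltW.
  by apply: (nbox z) => //; exact: seg_box zs.
by rewrite gE far_sideE// near_sideE//=; split; [exact: ltW|apply/negP; rewrite -ltNge].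
Qed.

End box_sides.

Section mixing_estimate.
Context (R : realType) (n : nat).
Local Notation E := 'rV[R]_n.+1.
Local Notation H := (borel (hyperplane R n)).
Local Notation tree := (tree R n).
Implicit Types (K L : set E).
Variables (m : probability R R) (mu : probability H R) (theta : probability tree R).
Variable lam : R.
Hypothesis law : product_law m mu theta.
Hypothesis m_exp : forall A : set R, measurable A -> m A = exponential_prob lam A.
Hypothesis mu0 : mu [set g : hyperplane R n | carrier g 0] = 0%E.
Variables (rho : R) (h : E).
Hypothesis rho_ge0 : 0 <= rho.

Definition box_hits : set H := hitting (box 0 rho) `|` hitting (box h rho).
Definition separating : set H := hitting (seg 0 h) `\` box_hits.
Definition sparing : set H := ~` hitting (seg 0 h) `\` box_hits.

Lemma measurable_box_hits : measurable box_hits.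
Proof. by apply: measurableU; apply: measurable_hitting; exact: box_compact. Qed.

Lemma measurable_separating : measurable separating.
Proof.
apply: measurableD; last exact: measurable_box_hits.
by apply: measurable_hitting; exact: seg_compact.
Qed.

Lemma measurable_sparing : measurable sparing.
Proof.
apply: measurableD; last exact: measurable_box_hits.
by apply: measurableC; apply: measurable_hitting; exact: seg_compact.
Qed.

Local Open Scope ereal_scope.

Lemma split_bounds (f : H -> \bar R) (c1 c2 : \bar R) :
  measurable_fun [set: H] f -> (forall g, 0 <= f g) -> (forall g, f g <= 1) ->
  (forall g, separating g -> f g = c1) -> (forall g, sparing g -> f g = c2) ->
  c2 * mu sparing + c1 * mu separating <= \int[mu]_g f g /\
  \int[mu]_g f g <= c2 * mu sparing + c1 * mu separating + mu box_hits.
Proof.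
move=> mf f0 f1 fS fR.
have mB := measurable_box_hits; have mS := measurable_separating; have mR := measurable_sparing.
have mSR : measurable (sparing `|` separating) by exact: measurableU.
have intE : \int[mu]_g f g = c2 * mu sparing + c1 * mu separating + \int[mu]_(g in box_hits) f g.
  have -> : [set: H] = (sparing `|` separating) `|` box_hits.
    apply/seteqP; split=> // g _; have [gB|gB] := pselect (box_hits g); first by right.
    by left; have [gs|gs] := pselect (hitting (seg 0%R h) g); [right|left].
  rewrite ge0_integral_setU//; last 2 first.
  - exact: measurable_funTS.
  - by apply/disj_setPS => g [[[_ ?]|[_ ?]]].
  rewrite ge0_integral_setU//; last 2 first.
  - exact: measurable_funTS.
  - by apply/disj_setPS => g [[? _] [? _]].
  by rewrite -!integral_cst//; congr (_ + _ + _); apply: eq_integral => g; rewrite inE => ?;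
    [rewrite fR|rewrite fS].
rewrite intE; split; first by rewrite leeDl// integral_ge0.
rewrite leeD2l// -[leRHS]mul1e -integral_cst//; apply: ge0_le_integral => //.
exact: measurable_funTS.
Qed.

Let F := avoidance theta.

Lemma split_pieces (K K1 K2 : set E) (u : R) (g : H) : (0 <= u)%R -> ~ (K `&` (g : hyperplane R n) !=set0) ->
  K `&` near_side g = K1 -> K `&` far_side g = K2 ->
  split_survival F K u (0%R, g) = F K1 u * F K2 u.
Proof.
move=> u0 Kg e1 e2; rewrite /split_survival /= e1 e2 subr0 ifF//.
by apply/asboolP => -[].
Qed.

Variables (K L : set E).
Hypotheses (cK : compact K) (cL : compact L).
Hypotheses (KB : K `<=` box 0 rho) (LB : L `<=` box h rho).

Lemma not_hitting_sub (A B : set E) (g : hyperplane R n) : A `<=` B -> ~ hitting B g ->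
  ~ (A `&` g !=set0).
Proof. by move=> AB nB [x [/AB Bx gx]]; apply: nB; exists x; split. Qed.

Let cM : compact (K `|` L). Proof. exact: compactU. Qed.

Lemma not_through0 (g : hyperplane R n) : ~ hitting (box 0 rho) g -> ~ carrier g 0%R.
Proof. by move=> nB g0; apply: nB; exists 0%R; split => //; exact: box_center. Qed.

Lemma split_bounds_K u : (0 <= u)%R ->
  F K u * mu sparing + F K u * mu separating <= split_avoidance mu theta K u.
Proof.
move=> u0; refine (proj1 (@split_bounds (fun g => split_survival F K u (0%R, g)) (F K u) (F K u) _ _ _ _ _)).
- exact: measurable_split_mark.
- by move=> g; exact: split_survival_ge0.
- by move=> g; exact: split_le1.
- move=> g [_ /not_orP[g1 _]].
  have [e1 e2] := box0_sides rho_ge0 KB g1.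
  by rewrite (split_pieces u0 _ e1 e2) ?[F set0 u]avoidance0 ?mule1//; exact: not_hitting_sub g1.
- move=> g [_ /not_orP[g1 _]].
  have [e1 e2] := box0_sides rho_ge0 KB g1.
  by rewrite (split_pieces u0 _ e1 e2) ?[F set0 u]avoidance0 ?mule1//; exact: not_hitting_sub g1.
Qed.

Lemma split_bounds_L u : (0 <= u)%R ->
  F L u * mu sparing + F L u * mu separating <= split_avoidance mu theta L u.
Proof.
move=> u0; refine (proj1 (@split_bounds (fun g => split_survival F L u (0%R, g)) (F L u) (F L u) _ _ _ _ _)).
- exact: measurable_split_mark.
- by move=> g; exact: split_survival_ge0.
- by move=> g; exact: split_le1.
- move=> g [gs /not_orP[g1 g2]].
  have [e1 e2] := (boxh_sides rho_ge0 LB (not_through0 g1) g2).1 gs.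
  by rewrite (split_pieces u0 _ e1 e2) ?[F set0 u]avoidance0 ?mul1e//; exact: not_hitting_sub g2.
- move=> g [gs /not_orP[g1 g2]].
  have [e1 e2] := (boxh_sides rho_ge0 LB (not_through0 g1) g2).2 gs.
  by rewrite (split_pieces u0 _ e1 e2) ?[F set0 u]avoidance0 ?mule1//; exact: not_hitting_sub g2.
Qed.

Lemma split_bounds_KL u : (0 <= u)%R ->
  F (K `|` L) u * mu sparing + F K u * F L u * mu separating <= split_avoidance mu theta (K `|` L) u /\
  split_avoidance mu theta (K `|` L) u <=
  F (K `|` L) u * mu sparing + F K u * F L u * mu separating + mu box_hits.
Proof.
have nM (g : hyperplane R n) : ~ hitting (box 0 rho) g -> ~ hitting (box h rho) g ->
    ~ ((K `|` L) `&` g !=set0).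
  move=> g1 g2 [x [[Kx|Lx] gx]].
    by apply: (not_hitting_sub KB g1); exists x.
  by apply: (not_hitting_sub LB g2); exists x.
move=> u0; apply: split_bounds.
- exact: measurable_split_mark.
- by move=> g; exact: split_survival_ge0.
- by move=> g; exact: split_le1.
- move=> g [gs /not_orP[g1 g2]].
  have [k1 k2] := box0_sides rho_ge0 KB g1.
  have [e1 e2] := (boxh_sides rho_ge0 LB (not_through0 g1) g2).1 gs.
  apply: split_pieces => //; first exact: nM.
    by rewrite setIUl k1 e1 setU0.
  by rewrite setIUl k2 e2 set0U.
- move=> g [gs /not_orP[g1 g2]].
  have [k1 k2] := box0_sides rho_ge0 KB g1.
  have [e1 e2] := (boxh_sides rho_ge0 LB (not_through0 g1) g2).2 gs.
  rewrite (@split_pieces _ (K `|` L) set0)// ?[F set0 u]avoidance0 ?mule1//.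
  - exact: nM.
  - by rewrite setIUl k1 e1.
  - by rewrite setIUl k2 e2 setU0.
Qed.

Local Close Scope ereal_scope.

Lemma mixing_estimate a : 0 < a -> 0 < lam -> 0 < fine (mu separating) ->
  `|fine (F (K `|` L) a) - fine (F K a) * fine (F L a)| <=
  6 * (fine (mu box_hits) / fine (mu separating)).
Proof.
move=> a0 lam0 S0.
(* With N steps the probability q of a division within one step is at most 1/2. *)
pose N := (Num.bound (2 * lam * a)).+1.
pose eta : R := a / N%:R.
have N0 : 0 < N%:R :> R by rewrite ltr0n.
have eta0 : 0 <= eta by rewrite divr_ge0// ltW.
pose q : R := 1 - expR (- lam * eta).
have q01 : 0 <= q <= 1 / 2.
  have h1 : expR (- lam * eta) <= 1 by rewrite -[leRHS]expR0 ler_expR mulNr oppr_le0 mulr_ge0// ltW.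
  have h2 : 1 + (- lam * eta) <= expR (- lam * eta) by exact: expR_ge1Dx.
  have h3 : lam * eta <= 1 / 2.
    rewrite /eta mulrA ler_pdivrMr//.
    have : 2 * lam * a < (Num.bound (2 * lam * a))%:R by apply: archi_boundP; rewrite !mulr_ge0// ltW.
    have : (Num.bound (2 * lam * a))%:R <= N%:R :> R by rewrite ler_nat.
    lra.
  by rewrite /q; lra.
have [mB mS mR] := And3 measurable_box_hits measurable_separating measurable_sparing.
have finm (X : set H) : measurable X -> mu X = (fine (mu X))%:E.
  by move=> mX; rewrite fineK// fin_num_measure.
have sum1 : fine (mu sparing) + fine (mu separating) + fine (mu box_hits) = 1.
  apply: EFin_inj; rewrite 2!EFinD -!finm//.
  rewrite -measureU//; last by apply/seteqP; split => // g [[? _] [? _]].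
  rewrite -measureU//; last by apply/seteqP; split => // g [[[_ ?]|[_ ?]]].
    rewrite -[RHS](@probability_setT _ _ _ mu); congr (mu _).
    apply/seteqP; split=> // g _; have [gB|gB] := pselect (box_hits g); first by right.
    by left; have [gs|gs] := pselect (hitting (seg 0 h) g); [right|left].
  exact: measurableU.
have sumE : 1 - fine (mu box_hits) = fine (mu sparing) + fine (mu separating).
  by rewrite -sum1 addrK.
have finF C s : compact C -> F C s = (fine (F C s))%:E.
  by move=> cC; rewrite fineK//; apply: fin_num_measure; apply: measurableC; exact: measurable_hits_in.
have bF C s : compact C -> 0 <= fine (F C s) <= 1.
  by move=> cC; rewrite -!lee_fin -finF// avoidance_ge0 avoidance_le1.
have fins C s : compact C -> split_avoidance mu theta C s = (fine (split_avoidance mu theta C s))%:E.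
  move=> cC; rewrite fineK// ge0_fin_numE ?split_avoidance_ge0//.
  by rewrite (le_lt_trans (split_avoidance_le1 _ _ _ cC))// ltry.
pose f C i := fine (F C (eta * i%:R)).
have stepU C i : compact C -> f C i.+1 <= (1 - q) * f C i + q * fine (split_avoidance mu theta C (eta * i%:R)).
  move=> cC; have [_] := avoidance_step law m_exp (eta * i%:R) cC eta0.
  rewrite -/F -/q (_ : eta * i%:R + eta = eta * i.+1%:R); last by rewrite -natr1; ring.
  by rewrite [F C (eta * i.+1%:R)]finF// [F C (eta * i%:R)]finF// fins// -!EFinM -EFinD lee_fin.
have stepL C i : compact C -> (1 - q) * f C i + q * fine (split_avoidance mu theta C (eta * i.+1%:R)) <= f C i.+1.
  move=> cC; have [+ _] := avoidance_step law m_exp (eta * i%:R) cC eta0.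
  rewrite -/F -/q (_ : eta * i%:R + eta = eta * i.+1%:R); last by rewrite -natr1; ring.
  by rewrite [F C (eta * i.+1%:R)]finF// [F C (eta * i%:R)]finF// fins// -!EFinM -EFinD lee_fin.
have q0 : 0 <= q by case/andP: q01.
have u0 i : 0 <= eta * i%:R by rewrite mulr_ge0.
have f0 C : compact C -> f C 0%N = 1.
  by move=> cC; rewrite /f /F (avoidance_le0 law m_exp mu0)// mulr0.
have fdec C i : compact C -> f C i.+1 <= f C i.
  move=> cC; rewrite /f -lee_fin -!finF//; apply: avoidance_nonincreasing => //.
  by apply: ler_wpM2l => //; rewrite ler_nat.
have -> : a = eta * N%:R by rewrite /eta divfK ?gt_eqF.
apply: (@euler_mixing _ (f K) (f L) (f (K `|` L)) q (fine (mu sparing)) (fine (mu separating)) (fine (mu box_hits))) => //.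
- by rewrite fine_ge0.
- by rewrite fine_ge0.
- by move=> i; exact: bF.
- by move=> i; exact: bF.
- by move=> i; exact: bF.
- exact: f0.
- exact: f0.
- exact: f0.
- by move=> i; exact: fdec.
- by move=> i; exact: fdec.
- move=> i; apply: le_trans (stepL K i cK); rewrite lerD2l; apply: ler_wpM2l => //.
  have := split_bounds_K (u0 i.+1); rewrite finF// fins// (finm _ mS) (finm _ mR) -!EFinM -EFinD lee_fin.
  by apply: le_trans; rewrite sumE /f -mulrDr mulrC.
- move=> i; apply: le_trans (stepL L i cL); rewrite lerD2l; apply: ler_wpM2l => //.
  have := split_bounds_L (u0 i.+1); rewrite finF// fins// (finm _ mS) (finm _ mR) -!EFinM -EFinD lee_fin.
  by apply: le_trans; rewrite sumE /f -mulrDr mulrC.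
- move=> i; apply: le_trans (stepU (K `|` L) i cM) _; rewrite lerD2l; apply: ler_wpM2l => //.
  have [_] := split_bounds_KL (u0 i); rewrite [F (K `|` L) _]finF// [F K _]finF// [F L _]finF// fins// (finm _ mS) (finm _ mR) (finm _ mB) -!EFinM -!EFinD lee_fin.
  by move/le_trans; apply; rewrite /f [fine (mu sparing) * _]mulrC [fine (mu separating) * _]mulrC.
- move=> i; apply: le_trans (stepL (K `|` L) i cM); rewrite lerD2l; apply: ler_wpM2l => //.
  have [+ _] := split_bounds_KL (u0 i.+1); rewrite [F (K `|` L) _]finF// [F K _]finF// [F L _]finF// fins// (finm _ mS) (finm _ mR) -!EFinM -!EFinD lee_fin.
  by apply: le_trans; rewrite /f [fine (mu sparing) * _]mulrC [fine (mu separating) * _]mulrC.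
Qed.

End mixing_estimate.

(** * The hyperplane measure *)

Section integral_lower_bound.
Context d (T : measurableType d) (R : realType) (mu : {measure set T -> \bar R}).
Local Open Scope ereal_scope.
Import HBNNSimple.

Lemma integral_ge_rectangle (f : T -> \bar R) (A : set T) (c : R) : measurable A ->
  (0 <= c)%R -> (forall x, 0 <= f x) -> (forall x, A x -> c%:E <= f x) ->
  c%:E * mu A <= \int[mu]_x f x.
Proof.
move=> mA c0 f0 Af.
have <- : sintegral mu (scale_nnsfun (indic_nnsfun R mA) c0) = c%:E * mu A.
  have := sintegralrM mu c (indic_nnsfun R mA).
  by rewrite -(sintegral_indic mu A); exact.
rewrite ge0_integralTE//; apply: ereal_sup_ubound.
exists (scale_nnsfun (indic_nnsfun R mA) c0) => // x /=.
rewrite mindicE; have [/set_mem/Af|] := boolP (x \in A); first by rewrite mulr1.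
by rewrite mulr0.
Qed.

End integral_lower_bound.

Section unit_directions.
Context (R : realType) (n : nat).
Local Notation E := 'rV[R]_n.+1.
Variable nu : {finite_measure set (borel (sphere R n)) -> \bar R}.

Lemma direction_continuous : continuous (@direction R n).
Proof. exact: initial_continuous. Qed.

Lemma dot_sphere_continuous (x : E) : continuous (fun u : sphere R n => dot x u).
Proof.
move=> u; under eq_fun do rewrite dotC.
exact: (continuous_comp (@direction_continuous u) (@dot_continuous R n x _)).
Qed.

Lemma normr_coord (x : E) i : `|x 0 i| <= `|x|.
Proof.
by rewrite [leRHS]mx_normrE; apply: (le_bigmax_cond _ (fun j => `|x j.1 j.2|) (j := (0, i))).
Qed.

Lemma normr_dot (x y : E) : `|dot x y| <= n.+1%:R * (`|x| * `|y|).
Proof.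
apply: le_trans (ler_norm_sum _ _ _) _.
apply: le_trans (_ : \sum_(i < n.+1) `|x| * `|y| <= _).
  by apply: ler_sum => i _; rewrite normrM ler_pM// normr_coord.
by rewrite sumr_const card_ord mulr_natl.
Qed.

Lemma enorm_le (x : E) : enorm x <= n.+1%:R * `|x|.
Proof.
rewrite -(@ler_pXn2r _ 2)// ?nnegrE ?enorm_ge0 ?mulr_ge0// enorm_sqr.
apply: le_trans (ler_norm _) _; apply: le_trans (normr_dot x x) _.
rewrite exprMn expr2 -expr2 ler_pM// ?mulr_ge0// ?sqr_ge0//.
by rewrite ler_peMr// ler1n.
Qed.

Lemma normr_le_enorm (x : E) : `|x| <= enorm x.
Proof.
rewrite [leLHS]mx_normrE; apply: bigmax_le => [|[i j] _ /=]; first exact: enorm_ge0.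
rewrite (ord1 i) -(@ler_pXn2r _ 2)// ?nnegrE ?enorm_ge0// enorm_sqr.
rewrite real_normK ?num_real// /dot (bigD1 j)//= -expr2 lerDl.
by apply: sumr_ge0 => k _; rewrite -expr2 sqr_ge0.
Qed.

Hypothesis nu_span : linear_span (@direction R n @` measure_support nu) = setT.

Lemma support_not_orthogonal (w : E) : w != 0 ->
  exists2 u : sphere R n, measure_support nu u & dot w u != 0.
Proof.
move=> w0; apply: contrapT => nex.
have orth (u : sphere R n) : measure_support nu u -> dot w u = 0.
  by move=> su; apply: contrapT => /eqP wu; apply: nex; exists u.
have : linear_span (@direction R n @` measure_support nu) w by rewrite nu_span.
move=> [s ss ws]; move: w0; rewrite -dot_eq0 => /eqP; apply.
have {}ss v : v \in s -> dot w v = 0 by move=> /ss[u su <-]; exact: orth.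
have dot0r : dot w 0 = 0 by rewrite dotC dot0l.
rewrite {2}(coord_span (X := in_tuple s) ws); apply: (big_ind (fun x => dot w x = 0)) => //.
  by move=> x y wx wy; rewrite dotDr wx wy addr0.
by move=> i _; rewrite dotZr ss ?mulr0// mem_nth.
Qed.

Lemma measurable_dot_ge (w : E) c :
  measurable ([set u : sphere R n | c <= dot w u] : set (borel (sphere R n))).
Proof.
rewrite -[X in measurable X]setCK; apply: measurableC; apply: sub_sigma_algebra.
rewrite (_ : ~` _ = [set u : sphere R n | dot w u < c]).
  apply: (@open_comp _ _ (fun u : sphere R n => dot w u) [set r | r < c]) => [u _|].
    exact: dot_sphere_continuous.
  exact: open_lt.
by apply/seteqP; split => u /=; rewrite ltNge => /negP.
Qed.

Definition one_sided_mass e (w : E) := exists b : bool,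
  (e%:E <= nu [set u : sphere R n | (e <= dot ((-1) ^+ b *: w) u)%R])%E.

Lemma near_one_sided_mass (w : E) : w != 0 ->
  \forall w' \near w & e \near 0^'+, one_sided_mass e w'.
Proof.
move=> /support_not_orthogonal[u0 su0 wu0].
pose k := `|dot w u0|; have k0 : 0 < k by rewrite normr_gt0.
have [b bE] : exists b : bool, dot ((-1) ^+ b *: w) u0 = k.
  by exists (dot w u0 < 0); rewrite dotZl -normrEsign.
pose U := [set u : sphere R n | k / 2 < dot ((-1) ^+ b *: w) u].
have oU : open U.
  apply: (@open_comp _ _ (fun u : sphere R n => dot _ u) [set r | k / 2 < r]) => [u _|].
    exact: dot_sphere_continuous.
  exact: open_gt.
have mU : measurable (U : set (borel (sphere R n))) by exact: sub_sigma_algebra.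
have nuU : (0 < nu U)%E by apply: su0 => //; rewrite /U /= bE; lra.
have finU : nu U \is a fin_num by exact: fin_num_measure.
have dU : 0 < fine (nu U) by rewrite fine_gt0// nuU/= ltey_eq finU.
exists ([set w' | `|w' - w| < k / (4 * n.+1%:R)], [set e | e <= k / 4 /\ e <= fine (nu U)]) => /=.
  split; last first.
    by near=> e; split; near: e; apply: nbhs_right_le => //; lra.
  apply/nbhs_ballP; exists (k / (4 * n.+1%:R)) => /=; first by rewrite divr_gt0.
  by move=> w'; rewrite -ball_normE /= distrC.
move=> [w' e] /= [ww' [ek eU]]; exists b.
apply: (@le_trans _ _ (nu U)); first by rewrite -(fineK finU) lee_fin.
apply: le_measure; rewrite ?inE//; first exact: measurable_dot_ge.
move=> u; rewrite /U /= => Uu.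
have -> : (-1) ^+ b *: w' = (-1) ^+ b *: w + (-1) ^+ b *: (w' - w).
  by rewrite -scalerDr addrC subrK.
rewrite dotDl.
have : `|dot ((-1) ^+ b *: (w' - w)) u| <= k / 4.
  apply: le_trans (normr_dot _ _) _.
  rewrite normrZ normr_sign mul1r.
  have u1 : `|direction u| <= 1 by rewrite -(direction_unit u) normr_le_enorm.
  have h1 : `|w' - w| * `|direction u| <= k / (4 * n.+1%:R).
    by apply: le_trans (ltW ww'); rewrite ler_piMr.
  apply: le_trans (ler_wpM2l (ler0n _ _) h1) _.
  by rewrite le_eqVlt; apply/orP; left; apply/eqP; field; rewrite nat1r pnatr_eq0.
by rewrite ler_norml => /andP[? _]; lra.
Unshelve. all: by end_near. Qed.

Lemma uniform_one_sided_mass : exists2 e : R, 0 < e &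
  forall w : E, `|w| = 1 -> one_sided_mass e w.
Proof.
have cS : compact [set w : E | `|w| = 1].
  apply: (@subclosed_compact _ _ (box 0 1)).
  - apply: (@preimage_closed _ _ (fun w : E => `|w|) [set 1]); last exact: closed_eq.
    by move=> w _; exact: norm_continuous.
  - exact: box_compact.
  - by move=> w /= w1; rewrite /box /= subr0 w1.
have near_e := (compact_near_coveringP _).1 cS R 0^'+ one_sided_mass _ _.
have {near_e} near_e : \forall e \near 0^'+, [set w : E | `|w| = 1] `<=` one_sided_mass e.
  apply: near_e => w /= w1; apply: near_one_sided_mass.
  by rewrite -normr_gt0 w1.
have [e [e0 he]] := filter_ex (filterI (nbhs_right_gt 0) near_e).
by exists e.
Qed.

End unit_directions.

Section lebesgue_plus_measure.
Context (R : realType).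

Let lebesgue_plus0 : @lebesgue_plus R set0 = 0%E.
Proof. exact: measure0. Qed.

Let lebesgue_plus_ge0 A : (0 <= @lebesgue_plus R A)%E.
Proof. exact: measure_ge0. Qed.

Let lebesgue_plus_sigma_additive : semi_sigma_additive (@lebesgue_plus R : set R -> \bar R).
Proof.
exact: (@measure_semi_sigma_additive _ _ _
  (mrestr lebesgue_measure (measurable_itv `[(0 : R), +oo[))).
Qed.

HB.instance Definition _ := isMeasure.Build default_measure_display R R
  (@lebesgue_plus R) lebesgue_plus0 lebesgue_plus_ge0 lebesgue_plus_sigma_additive.

End lebesgue_plus_measure.

Section hyperplane_measure_facts.
Context (R : realType) (n : nat).
Local Notation E := 'rV[R]_n.+1.
Local Notation H := (borel (hyperplane R n)).
Variable Lambda : {measure set H -> \bar R}.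
Variable nu : {finite_measure set (borel (sphere R n)) -> \bar R}.
Hypothesis Lambda_invariant : translation_invariant Lambda.
Hypothesis Lambda_polar : polar_decomposition Lambda nu.

Lemma Lambda_translate (h : E) (B : set H) : measurable B ->
  Lambda (translate_hyperplane h @^-1` B) = Lambda B.
Proof. by move=> mB; rewrite translate_hyperplane_preimage Lambda_invariant. Qed.

Lemma Lambda_hitting_translate (h : E) (K : set E) : compact K ->
  Lambda (hitting (translate h K)) = Lambda (hitting K).
Proof.
move=> cK; rewrite -(translate_hyperplane_hitting h K) Lambda_translate//.
by apply: measurable_hitting; exact: translate_compact.
Qed.

Lemma polarE (A : set H) : measurable A ->
  Lambda A = (\int[@lebesgue_plus R]_r nu (xsection (hyperplane_of @^-1` A) r))%E.
Proof. exact: Lambda_polar. Qed.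

Lemma through0_null : Lambda [set g : hyperplane R n | carrier g 0] = 0%E.
Proof.
rewrite polarE; last exact: measurable_through.
rewrite (_ : (fun r => _) = (fun r => nu (xsection (hyperplane_of @^-1` [set g : hyperplane R n | carrier g 0]) r)) \_ [set 0]); last first.
  apply/funext => r; rewrite patchE; case: ifPn => //.
  rewrite notin_setE /= => r0; rewrite (_ : xsection _ _ = set0) ?measure0//.
  by apply/seteqP; split => // u; rewrite /xsection /= inE /= dot0l => /esym.
rewrite -integral_mkcond null_set_integral//.
  exact: measurable_fun_set1.
apply/eqP; rewrite eq_le measure_ge0 andbT.
apply: (@le_trans _ _ (lebesgue_measure [set (0 : R)])).
  by rewrite /lebesgue_plus /mrestr; apply: le_measure; rewrite ?inE//; apply: measurableI => //; exact: measurable_itv.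
by rewrite lebesgue_measure_set1.
Qed.

Lemma through_null (x : E) : Lambda [set g : hyperplane R n | carrier g x] = 0%E.
Proof.
rewrite -hitting1 -through0_null -(Lambda_hitting_translate (- x)); last exact: compact_set1.
rewrite -hitting1; congr (Lambda (hitting _)); rewrite translateE; apply/seteqP; split => y /=.
  by rewrite opprK => /(canRL (addrK x)); rewrite subrr.
by move=> ->; rewrite opprK add0r.
Qed.

Lemma hitting_seg_ge (h : E) (D : R) : 0 < D ->
  (D%:E * nu [set u : sphere R n | (D <= dot h u)%R] <= Lambda (hitting (seg 0 h)))%E.
Proof.
move=> D0; rewrite polarE; last by apply: measurable_hitting; exact: seg_compact.
have mV := measurable_dot_ge h D.
set V := [set u | _].
have finV : nu V \is a fin_num by exact: fin_num_measure.
have -> : D%:E = lebesgue_plus `]0, D[%classic.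
  rewrite /lebesgue_plus /mrestr setIidl; last first.
    by move=> r /=; rewrite !in_itv /= andbT => /andP[/ltW].
  by rewrite lebesgue_measure_itv /= lte_fin D0 sube0.
rewrite -(fineK finV) muleC; apply: integral_ge_rectangle.
- exact: measurable_itv.
- by rewrite fine_ge0.
- by [].
move=> r /=; rewrite in_itv /= => /andP[r0 rD]; rewrite fineK//.
have secE : xsection (hyperplane_of @^-1` hitting (seg 0 h)) r = [set u : sphere R n | r <= dot h u].
  apply/seteqP; split=> u; rewrite /xsection /= inE /=.
    move=> [x [xr [t /andP[t0 t1] tx]]]; move: xr; rewrite /= -tx dot_seg dot0l add0r subr0 => xr.
    have [hu|hu] := leP 0 (dot h u); first by rewrite -xr ler_piMl.
    by move: r0; rewrite -xr ltNge mulr_ge0_le0// ltW.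
  by move=> rh; have [||z zs zr] := @seg_cross _ _ 0 h (direction u) r; rewrite ?dot0l ?(ltW r0)//; exists z.
rewrite secE; apply: le_measure; rewrite ?inE//; first exact: measurable_dot_ge.
by move=> u; apply: le_trans; exact: ltW.
Qed.

Hypothesis nu_span : linear_span (@direction R n @` measure_support nu) = setT.

Lemma translate_seg (h : E) : translate (- h) (seg 0 h) = seg 0 (- h).
Proof.
apply/seteqP; split=> [_ [_ [t /andP[t0 t1] <-] <-]|_ [t /andP[t0 t1] <-]].
  exists (1 - t); first by apply/andP; split; lra.
  by apply/rowP => i; rewrite !mxE; ring.
exists ((1 - t) *: h); last by apply/rowP => i; rewrite !mxE; ring.
exists (1 - t); first by apply/andP; split; lra.
by rewrite scaler0 add0r.
Qed.

Lemma hitting_seg_pinfty (M : R) : exists N : R, forall h : E, N < enorm h ->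
  (M%:E <= Lambda (hitting (seg 0 h)))%E.
Proof.
have [e e0 he] := uniform_one_sided_mass nu_span.
exists (n.+1%:R * (Num.max M 0 / (e * e))) => h Nh.
have h0 : 0 < `|h|.
  rewrite normr_gt0; apply: contraTneq Nh => ->.
  by rewrite -leNgt /enorm dot0l sqrtr0 mulr_ge0// divr_ge0 ?mulr_ge0 ?(ltW e0)// le_max lexx orbT.
have hM : M <= e * `|h| * e.
  have : n.+1%:R * (Num.max M 0 / (e * e)) < n.+1%:R * `|h| by apply: lt_le_trans Nh (enorm_le h).
  rewrite ltr_pM2l// ltr_pdivrMr ?mulr_gt0// gt_max => /andP[/ltW Mh _].
  by apply: le_trans Mh _; rewrite mulrCA mulrA.
have h1 : `|(`|h|^-1 *: h)| = 1 by rewrite normrZ normfV normr_id mulVf// gt_eqF.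
have [b eb] := he _ h1.
have -> : Lambda (hitting (seg 0 h)) = Lambda (hitting (seg 0 ((-1) ^+ b *: h))).
  case: b {eb} => /=; rewrite ?scale1r// scaleN1r -translate_seg Lambda_hitting_translate//.
  exact: seg_compact.
apply: le_trans (@hitting_seg_ge ((-1) ^+ b *: h) (e * `|h|) _); last by rewrite mulr_gt0.
apply: (@le_trans _ _ ((e * `|h|)%:E * e%:E)%E); first by rewrite -EFinM lee_fin.
apply: lee_pmul => //; rewrite ?lee_fin ?mulr_ge0// ?(ltW e0)//.
apply: le_trans eb _; rewrite le_eqVlt; apply/orP; left; apply/eqP; congr (nu _).
have -> : (-1) ^+ b *: (`|h|^-1 *: h) = `|h|^-1 *: ((-1) ^+ b *: h) by rewrite !scalerA mulrC.
by apply/seteqP; split => u /=; rewrite [X in e <= X]dotZl ler_pdivlMl// mulrC.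
Qed.

End hyperplane_measure_facts.

(** * The STIT tessellation *)

Section windows.
Context (R : realType) (n : nat).
Local Notation E := 'rV[R]_n.+1.
Implicit Types (x h : E) (r : R).

Lemma box_interior x r s : r < s -> box x r `<=` (box x s)°.
Proof.
move=> rs y; rewrite /box /= => yr; apply/nbhs_ballP; exists (s - r) => /=; first by rewrite subr_gt0.
move=> z; rewrite -ball_normE /= distrC => zy.
have : `|z - x| <= `|z - y| + `|y - x| by rewrite (le_trans _ (ler_normD _ _))// addrA subrK.
lra.
Qed.

Lemma seg_connected (x y : E) : connected (seg x y).
Proof.
apply: (@connected_continuous_connected R^o).
  rewrite (_ : [set t | _] = `[0, 1]%classic); first exact: segment_connected.
  by apply/seteqP; split => t /=; rewrite in_itv.
apply: continuous_subspaceT => t.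
apply: cvgD; apply: cvgZr_tmp; last exact: cvg_id.
by apply: cvgB; [exact: cvg_cst|exact: cvg_id].
Qed.

Lemma box_window x r : 0 < r -> window (box x r).
Proof.
move=> r0; split; first exact: box_compact.
  rewrite (_ : box x r = \bigcup_(y in box x r) seg x y).
    apply: bigcup_connected => [|y _]; last exact: seg_connected.
    by exists x => y _; exists 0; rewrite /= ?lexx ?ler01// subr0 scale1r scale0r addr0.
  apply/seteqP; split=> [y xy|y [z xz]]; last by apply: seg_box => //; exact: ltW.
  by exists y => //; exists 1; rewrite /= ?lexx ?ler01// subrr scale0r scale1r add0r.
by exists x; apply: (box_interior r0); exact: box_center.
Qed.

Lemma translate_box h x r : translate h (box x r) = box (x + h) r.
Proof. by rewrite translateE /box; apply/seteqP; split => y /=; rewrite opprD addrAC addrA. Qed.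

Lemma box_sub (x : E) r s : `|x| + r <= s -> box x r `<=` box 0 s.
Proof.
move=> xrs y; rewrite /box /= subr0 => yr.
have := ler_normD (y - x) x; rewrite subrK; lra.
Qed.

Lemma compact_box (K : set E) : compact K -> exists2 r, 0 <= r & K `<=` box 0 r.
Proof.
move=> /compact_bounded[M [_ KM]]; exists (`|M| + 1); first by rewrite addr_ge0.
move=> x Kx; rewrite /box /= subr0; apply: (KM (`|M| + 1)) Kx.
by rewrite (le_lt_trans (ler_norm M))// ltrDl.
Qed.

End windows.

Section stit_tree.
Context (R : realType) (n : nat).
Local Notation E := 'rV[R]_n.+1.
Local Notation H := (borel (hyperplane R n)).
Local Notation tree := (tree R n).
Variables (a : R) (Lambda : {measure set H -> \bar R}).
Variable P : probability (borel (closed_set E)) R.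
Hypothesis Lambda_invariant : translation_invariant Lambda.
Hypothesis Lambda0 : forall x : E, Lambda [set g : hyperplane R n | carrier g x] = 0%E.
Hypothesis P_stit : stit_law Lambda a P.
Local Open Scope ereal_scope.

Definition stit_tree_law (W : set E) (m : probability R R) (mu : probability H R)
    (theta : probability tree R) :=
  [/\ product_law m mu theta,
      forall A : set R, measurable A -> m A = exponential_prob (fine (Lambda (hitting W))) A,
      forall B : set H, measurable B ->
        mu B = Lambda (hitting W `&` B) * ((fine (Lambda (hitting W)))^-1)%:E &
      forall K : set E, compact K -> K `<=` W° -> P (hit K) = theta (hits K a)].

Lemma exists_stit_tree W : window W -> exists m mu theta, stit_tree_law W m mu theta.
Proof.
move=> wW; have [d [ Omega [Q [eps [gam [sv PQ] ] ] ] ] ] := P_stit wW.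
have law := tree_of_product_law sv.
exists (distribution Q (eps xH)), (distribution Q (gam xH)), (distribution Q (mtree_of eps gam)).
split => //; [exact: eps_law sv xH|exact: gam_law sv xH|move=> K cK KW].
rewrite PQ//.
transitivity (distribution Q (mtree_of eps gam) (boundary_hits K a)).
  rewrite /distribution /pushforward /=; congr (Q _).
  apply/seteqP; split=> w; rewrite /preimage /=.
    exact: (cell_boundaries_hits a (tree_of eps gam w) KW).1.
  exact: (cell_boundaries_hits a (tree_of eps gam w) KW).2.
apply: (@eq_mod_null _ _ _ _ _ (@irregular_trees R n)).
- exact: measurable_boundary_hits.
- exact: measurable_hits_in.
- exact: measurable_irregular_trees.
- apply: irregular_trees_null law _ _.
    rewrite (_ : [set x : R | (x <= 0)%R] = `]-oo, 0%R]%classic).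
      by apply: exponential_le0; exact: eps_law sv xH.
    by apply/seteqP; split => x /=; rewrite in_itv.
  apply: etrans (gam_law sv xH (measurable_through 0%R)) _.
  rewrite (_ : Lambda _ = 0) ?mul0e//.
  apply: subset_measure0 (Lambda0 0%R) => //.
    apply: measurableI; last exact: measurable_through.
    by apply: measurable_hitting; case: wW.
  exact: measurable_through.
by move=> t nt; exact: boundary_hits_regular.
Qed.

Lemma stit_rate_gt0 W m mu theta : compact W -> stit_tree_law W m mu theta ->
  (0 < fine (Lambda (hitting W)))%R.
Proof.
move=> cW [_ _ muE _]; rewrite lt_neqAle fine_ge0// andbT eq_sym.
apply/eqP => L0; have := muE _ measurableT.
by rewrite probability_setT L0 invr0 mule0 => -[] /eqP; rewrite oner_eq0.
Qed.

Lemma stit_translate (K : set E) (h : E) : compact K ->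
  P (hit (translate h K)) = P (hit K).
Proof.
move=> cK; have [r r0 Kr] := compact_box cK.
have rr : (r < r + 1)%R by rewrite ltrDl.
have r1 : (0 < r + 1)%R by exact: le_lt_trans rr.
have [m [mu [theta [law mE muE PE]]]] := exists_stit_tree (box_window 0%R r1).
have [m' [mu' [theta' [law' mE' muE' PE']]]] := exists_stit_tree (box_window h r1).
have hLambda : Lambda (hitting (box h (r + 1))) = Lambda (hitting (box 0%R (r + 1))).
  rewrite -[h in box h _]add0r -translate_box (Lambda_hitting_translate Lambda_invariant)//.
  exact: box_compact.
rewrite PE'; last 2 first.
- exact: translate_compact.
- apply: subset_trans (box_interior rr); rewrite -[h in box h _]add0r -translate_box.
  exact: translateS.
rewrite PE//; last by apply: subset_trans Kr _; exact: box_interior.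
apply: (hits_translate law law') => //.
- move=> A mA; rewrite hLambda in mE'.
  exact: etrans (mE' _ mA) (esym (mE _ mA)).
- move=> B mB; have mtB : measurable (translate_hyperplane h @^-1` B : set H).
    by rewrite -[X in measurable X]setTI; exact: measurable_translate_hyperplane.
  apply: etrans (muE' _ mB) _; apply/esym; apply: etrans (muE _ mtB) _; apply/esym.
  rewrite hLambda; congr (_ * _).
  rewrite -(Lambda_translate Lambda_invariant h); last first.
    by apply: measurableI => //; apply: measurable_hitting; exact: box_compact.
  by rewrite preimage_setI -[h in box h _]add0r -translate_box translate_hyperplane_hitting.
- move=> x; rewrite muE; last exact: measurable_through.
  rewrite (_ : Lambda _ = 0) ?mul0e//.
  apply: subset_measure0 (Lambda0 x) => //; last exact: measurable_through.
  apply: measurableI; last exact: measurable_through.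
  by apply: measurable_hitting; exact: box_compact.
Qed.

End stit_tree.

Section stit_mixing.
Context (R : realType) (n : nat).
Local Notation E := 'rV[R]_n.+1.
Local Notation H := (borel (hyperplane R n)).
Variables (a : R) (Lambda : {measure set H -> \bar R}).
Variable nu : {finite_measure set (borel (sphere R n)) -> \bar R}.
Variable P : probability (borel (closed_set E)) R.
Hypothesis a_gt0 : 0 < a.
Hypothesis Lambda_invariant : translation_invariant Lambda.
Hypothesis Lambda_locally_finite : locally_finite Lambda.
Hypothesis Lambda_polar : polar_decomposition Lambda nu.
Hypothesis nu_span : linear_span (@direction R n @` measure_support nu) = setT.
Hypothesis P_stit : stit_law Lambda a P.

Let Lambda0 := through_null Lambda_invariant Lambda_polar.

Lemma stit_avoid W m mu theta (K : set E) : stit_tree_law a Lambda P W m mu theta ->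
  compact K -> K `<=` W° -> P (avoid K) = avoidance theta K a.
Proof.
move=> [_ _ _ PE] cK KW; rewrite avoidE /avoidance /survival.
by rewrite !probability_setC ?PE//; [exact: measurable_hits_in|exact: measurable_hit].
Qed.

Lemma separating_sub rho (h : E) r : `|h| <= r ->
  @separating R n rho h `<=` hitting (box 0 r).
Proof.
move=> hr g [[x [gx xs]] _]; exists x; split => //; apply: seg_box xs.
  exact: le_trans hr.
by rewrite /box /= subr0.
Qed.

Lemma hitting_box (h : E) rho : Lambda (hitting (box h rho)) = Lambda (hitting (box 0 rho)).
Proof.
rewrite -[h in box h _]add0r -translate_box (Lambda_hitting_translate Lambda_invariant)//.
exact: box_compact.
Qed.

Lemma stit_mixing_bound rho (K L : set E) (h : E) : 0 <= rho ->
  compact K -> compact L -> K `<=` box 0 rho -> L `<=` box 0 rho ->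
  (0 < Lambda (separating rho h))%E ->
  `|fine (P (avoid K `&` avoid (translate h L))) - fine (P (avoid K)) * fine (P (avoid L))| <=
  6 * (fine (Lambda (box_hits rho h)) / fine (Lambda (separating rho h))).
Proof.
move=> rho0 cK cL KB LB S0.
pose s := `|h| + rho; have s0 : 0 <= s by rewrite addr_ge0.
have ss : s < s + 1 by rewrite ltrDl.
have r0 : 0 < s + 1 by exact: le_lt_trans ss.
have wW := @box_window R n 0 _ r0; set W := box 0 (s + 1) in wW.
have cW : compact W by exact: box_compact.
have [m [mu [theta sl]]] := exists_stit_tree Lambda0 P_stit wW.
have lam0 := stit_rate_gt0 cW sl.
have [law mE muE PE] := sl; set lam := fine (Lambda (hitting W)) in lam0 mE muE.
have inW (C : set E) : C `<=` box 0 s -> C `<=` W°.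
  by move=> Cs; apply: subset_trans Cs _; exact: box_interior.
have cTL : compact (translate h L) by exact: translate_compact.
have TLB : translate h L `<=` box h rho.
  by rewrite -[h in box h _]add0r -translate_box; exact: translateS.
have KW : K `<=` W°.
  apply: inW; apply: subset_trans KB _; apply: box_sub; rewrite normr0 add0r /s.
  by rewrite lerDr.
have TLW : translate h L `<=` W°.
  by apply: inW; apply: subset_trans TLB _; exact: box_sub.
have -> : avoid K `&` avoid (translate h L) = avoid (K `|` translate h L).
  apply/seteqP; split=> F; rewrite /avoid /= setIUr.
    by move=> [-> ->]; rewrite setU0.
  by rewrite setU_eq0.
have PL : P (avoid L) = P (avoid (translate h L)).
  rewrite !avoidE !probability_setC; [|exact: measurable_hit|exact: measurable_hit].
  by rewrite (stit_translate Lambda_invariant Lambda0 P_stit).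
rewrite PL !(stit_avoid sl)//; last 2 first.
- exact: compactU.
- by move=> x [/KW|/TLW].
have BW : box_hits rho h `<=` hitting W.
  have h0 : 0 <= `|h| by [].
  move=> g [|] [x [gx Bx]]; exists x; split => //; apply: box_sub Bx.
    by rewrite normr0 /s; lra.
  by rewrite /s; lra.
have mu_in (X : set H) : measurable X -> X `<=` hitting W -> mu X = (Lambda X * (lam^-1)%:E)%E.
  by move=> mX XW; rewrite muE// (setIidr XW).
have mB : mu (box_hits rho h) = (Lambda (box_hits rho h) * (lam^-1)%:E)%E.
  exact: mu_in (measurable_box_hits _ _) BW.
have mS : mu (separating rho h) = (Lambda (separating rho h) * (lam^-1)%:E)%E.
  apply: mu_in; first exact: measurable_separating.
  by apply: separating_sub; rewrite /s; lra.
have fin (X : set H) : measurable X -> X `<=` hitting W -> Lambda X \is a fin_num.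
  move=> mX XW; rewrite ge0_fin_numE//; apply: le_lt_trans (Lambda_locally_finite cW).
  by apply: le_measure => //; rewrite inE//; exact: measurable_hitting.
have fB : Lambda (box_hits rho h) \is a fin_num.
  exact: fin (measurable_box_hits _ _) BW.
have fS : Lambda (separating rho h) \is a fin_num.
  apply: fin; first exact: measurable_separating.
  by apply: separating_sub; rewrite /s; lra.
have S0' : 0 < fine (Lambda (separating rho h)) by rewrite fine_gt0// S0 ltey_eq fS.
have ratio : fine (Lambda (box_hits rho h)) / fine (Lambda (separating rho h)) =
    fine (mu (box_hits rho h)) / fine (mu (separating rho h)).
  rewrite mB mS !fineM//= invfM invrK mulrACA mulVf ?mulr1// ?gt_eqF//.
rewrite ratio; apply: (mixing_estimate law mE) => //.
- rewrite muE; last exact: measurable_through.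
  rewrite (_ : Lambda _ = 0%E) ?mul0e//.
  apply: subset_measure0 (Lambda0 0) => //; last exact: measurable_through.
  apply: measurableI; last exact: measurable_through.
  exact: measurable_hitting.
- by rewrite mS fineM//= mulr_gt0// invr_gt0.
Qed.

Lemma stit_mixing (K L : set E) : compact K -> compact L ->
  fine (P (avoid K `&` avoid (translate h L))) @[h --> enorm_infty] -->
  fine (P (avoid K)) * fine (P (avoid L)).
Proof.
move=> cK cL; have [r1 r10 Kr1] := compact_box cK; have [r2 r20 Lr2] := compact_box cL.
pose rho := r1 + r2; have rho0 : 0 <= rho by rewrite addr_ge0.
have KB : K `<=` box 0 rho.
  by apply: subset_trans Kr1 _; apply: box_sub; rewrite normr0 add0r lerDl.
have LB : L `<=` box 0 rho.
  by apply: subset_trans Lr2 _; apply: box_sub; rewrite normr0 add0r lerDr.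
pose c := fine (Lambda (hitting (box 0 rho))).
have c0 : 0 <= c by rewrite fine_ge0.
have cE : Lambda (hitting (box 0 rho)) = c%:E.
  rewrite fineK// ge0_fin_numE//; apply: Lambda_locally_finite; exact: box_compact.
apply/cvgrPdist_le => e e0.
have [N hN] := hitting_seg_pinfty Lambda_invariant Lambda_polar nu_span (2 * c + (12 * c + 1) / e).
exists N => // h /hN hseg.
have hB : (Lambda (box_hits rho h) <= (2 * c)%:E)%E.
  have mb x : measurable (hitting (box x rho) : set H) by apply: measurable_hitting; exact: box_compact.
  apply: le_trans (measureU2 _ (mb 0) (mb h)) _.
  have <- : (c%:E + c%:E)%E = (2 * c)%:E by rewrite -EFinD mulr_natl mulr2n.
  have cx x : (Lambda (hitting (box x rho)) <= c%:E)%E by rewrite hitting_box cE.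
  by apply: leeD; exact: cx.
have fB : Lambda (box_hits rho h) \is a fin_num.
  by rewrite ge0_fin_numE//; apply: le_lt_trans hB _; rewrite ltry.
have hS : (((12 * c + 1) / e)%:E <= Lambda (separating rho h))%E.
  have mseg : measurable (hitting (seg 0 h) : set H) by apply: measurable_hitting; exact: seg_compact.
  have mb := measurable_box_hits rho h.
  have : (Lambda (hitting (seg 0 h)) <= Lambda (separating rho h) + (2 * c)%:E)%E.
    rewrite (measureDI Lambda mseg mb); apply: leeD => //; apply: le_trans hB.
    by apply: le_measure; rewrite ?inE//; exact: measurableI.
  move=> /(le_trans hseg); rewrite addrC EFinD leeD2rE//.
have S0 : (0 < Lambda (separating rho h))%E.
  by apply: lt_le_trans hS; rewrite lte_fin divr_gt0//; lra.
rewrite distrC; apply: le_trans (stit_mixing_bound rho0 cK cL KB LB S0) _.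
have fS : Lambda (separating rho h) \is a fin_num.
  rewrite ge0_fin_numE//; apply: le_lt_trans (Lambda_locally_finite (@seg_compact R n 0 h)).
  apply: le_measure; rewrite ?inE; [exact: measurable_separating| |by move=> g []].
  by apply: measurable_hitting; exact: seg_compact.
have S0' : 0 < fine (Lambda (separating rho h)) by rewrite fine_gt0// S0 ltey_eq fS.
move: hS hB; rewrite -(fineK fS) -(fineK fB) !lee_fin => hS hB.
rewrite mulrA ler_pdivrMr//.
have : e * ((12 * c + 1) / e) <= e * fine (Lambda (separating rho h)) by rewrite ler_pM2l.
by rewrite mulrC divfK ?gt_eqF//; lra.
Qed.

End stit_mixing.

Theorem theorem2 (R : realType) (n : nat) (a : R)
    (Lambda : {measure set (borel (hyperplane R n)) -> \bar R})
    (nu : {finite_measure set (borel (sphere R n)) -> \bar R})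
    (P : probability (borel (closed_set 'rV[R]_n.+1)) R)
    (a_gt0 : 0 < a)
    (Lambda_invariant : translation_invariant Lambda)
    (Lambda_locally_finite : locally_finite Lambda)
    (Lambda_polar : polar_decomposition Lambda nu)
    (nu_span : linear_span (@direction R n @` measure_support nu) = setT)
    (P_stit : stit_law Lambda a P)
    (A B : set (borel 'rV[R]_n.+1))
    (mA : measurable A) (mB : measurable B) :
  completion P (avoid A `&` avoid (translate h B)) @[h --> enorm_infty] -->
    (completion P (avoid A) * completion P (avoid B))%E.
Proof.
apply: mixing_borel.
- by apply: souslin_borel mA; exact: souslin_open.
- by apply: souslin_borel mB; exact: souslin_open.
- move=> K h cK; apply: stit_translate P_stit _ _ cK => //.
  exact: through_null Lambda_polar.
- by move=> K L; exact: stit_mixing Lambda_polar nu_span P_stit _ _.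
Qed.
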